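(* Let $(M,F)$ be an arbitrary Finsler space of any dimension $N\ge3$. The tangent Riemannian space $\mathcal R_{\{x\}}$ is conformally flat if and only if the indicatrix $\mathcal I_x$ is a space of constant curvature.
   Context: $F(x,y)$ is the Finsler metric function and $g_{\{x\}}(y)$ the Finsler metric tensor $g_{ij}=\frac12\partial^2F^2/\partial y^i\partial y^j$ at fixed $x\in M$. The tangent Riemannian space at $x$ is $\mathcal R_{\{x\}}=\{T_xM,g_{\{x\}}(y)\}$: the tangent space (with the origin removed) regarded as a manifold with variable $y$ and Riemannian metric $g_{ij}(x,y)dy^idy^j$. The indicatrix $\mathcal I_x=\{y\in T_xM:F(x,y)=1\}$ carries the Riemannian metric induced from $\mathcal R_{\{x\}}$. Conformal flatness is local. *)

(* Defs.v *)
From HB Require Import structures.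
From mathcomp Require Import all_boot all_order all_algebra.
From mathcomp Require Import all_classical all_reals all_analysis.

Set Implicit Arguments.
Unset Strict Implicit.
Unset Printing Implicit Defensive.

Import Order.TTheory GRing.Theory Num.Theory.
Import numFieldNormedType.Exports.

Local Open Scope classical_set_scope.
Local Open Scope ring_scope.

(* f is of class C^k on U. [U] is meant to be open and [V] finite-dimensional:
   then the continuity of the differential is that of all directional
   derivatives. Values of f outside U play no role. *)
Fixpoint Ck_on (R : realType) (V W : normedModType R) (k : nat)
    (U : set V) (f : V -> W) : Prop :=
  if k is k'.+1 then
    (forall x, U x -> differentiable f x) /\
    (forall v : V, Ck_on k' U (fun x => 'D_v f x))
  else forall x, U x -> {for x, continuous f}.

Definition smooth_on (R : realType) (V W : normedModType R)
    (U : set V) (f : V -> W) : Prop :=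
  forall k, Ck_on k U f.

Section LocalRiemannianGeometry.
Variables (R : realType) (n : nat).

Definition partial (i : 'I_n) (f : 'rV[R]_n -> R) : 'rV[R]_n -> R :=
  fun x => 'D_(delta_mx 0 i) f x.

(* Metrics on open subsets of R^n are matrix-valued functions. *)
Implicit Type G : 'rV[R]_n -> 'M[R]_n.

(* Gamma^k_ij of the Levi-Civita connection *)
Definition christoffel G (k i j : 'I_n) : 'rV[R]_n -> R := fun x =>
  2^-1 * \sum_(l < n) invmx (G x) k l *
    (partial i (fun y => G y j l) x + partial j (fun y => G y i l) x
     - partial l (fun y => G y i j) x).

(* l-th component of R(e_i, e_j) e_k, where
   R(X, Y) Z = D_X D_Y Z - D_Y D_X Z - D_[X, Y] Z *)
Definition curvature G (i j k l : 'I_n) : 'rV[R]_n -> R := fun x =>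
  partial i (christoffel G l j k) x - partial j (christoffel G l i k) x
  + \sum_(m < n) (christoffel G l i m x * christoffel G m j k x
                  - christoffel G l j m x * christoffel G m i k x).

Definition flat_on (U : set 'rV[R]_n) G : Prop :=
  forall x, U x -> forall i j k l, curvature G i j k l x = 0.

Definition conformally_flat_on (U : set 'rV[R]_n) G : Prop :=
  forall x, U x -> exists (V : set 'rV[R]_n) (lambda : 'rV[R]_n -> R),
    [/\ open V, V x, V `<=` U, smooth_on V lambda &
        (forall y, V y -> 0 < lambda y) /\
        flat_on V (fun y => lambda y *: G y)].

Definition inner G (x X Y : 'rV[R]_n) : R := (X *m G x *m Y^T) 0 0.

Definition curvature_op G (x X Y Z : 'rV[R]_n) : 'rV[R]_n :=
  \row_l \sum_i \sum_j \sum_k X 0 i * Y 0 j * Z 0 k * curvature G i j k l x.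

Definition sectional_curvature G (x X Y : 'rV[R]_n) : R :=
  inner G x (curvature_op G x X Y Y) X /
  (inner G x X X * inner G x Y Y - inner G x X Y ^+ 2).

End LocalRiemannianGeometry.

Section Submanifold.
Variables (R : realType) (m n : nat).

(* For an m-dimensional submanifold S of R^n, such a u is the inverse of a
   local coordinate system of S: as m = dim S, an injective immersion into S is
   a homeomorphism onto an open subset of S. Vectors are rows, hence so is the
   rank condition on the jacobian. *)
Definition local_parametrization (S : set 'rV[R]_n)
    (V : set 'rV[R]_m) (u : 'rV[R]_m -> 'rV[R]_n) : Prop :=
  [/\ open V, smooth_on V u, (forall v, V v -> S (u v)),
      (forall v w, V v -> V w -> u v = u w -> v = w) &
      forall v, V v -> row_free (jacobian u v)].

Definition induced_metric (G : 'rV[R]_n -> 'M[R]_n)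
    (u : 'rV[R]_m -> 'rV[R]_n) : 'rV[R]_m -> 'M[R]_m :=
  fun v => jacobian u v *m G (u v) *m (jacobian u v)^T.

(* S, of dimension m, with the metric induced by G *)
Definition has_constant_curvature (S : set 'rV[R]_n)
    (G : 'rV[R]_n -> 'M[R]_n) : Prop :=
  exists K : R, forall V u, local_parametrization S V u ->
    forall v, V v -> forall X Y : 'rV[R]_m, row_free (col_mx X Y) ->
      sectional_curvature (induced_metric G u) v X Y = K.

End Submanifold.

Arguments has_constant_curvature {R} m {n} S G.

Record chart (R : realType) (N : nat) (M : topologicalType) := Chart {
  chart_dom : set M;
  chart_map : M -> 'rV[R]_N;
  chart_inv : 'rV[R]_N -> M;
  chart_dom_open : open chart_dom;
  chart_codom_open : open (chart_map @` chart_dom);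
  chart_mapK : forall p, chart_dom p -> chart_inv (chart_map p) = p;
  chart_map_continuous :
    forall p, chart_dom p -> {for p, continuous chart_map};
  chart_inv_continuous :
    forall x, (chart_map @` chart_dom) x -> {for x, continuous chart_inv} }.

Definition transition (R : realType) (N : nat) (M : topologicalType)
    (c d : chart R N M) : 'rV[R]_N -> 'rV[R]_N :=
  chart_map d \o chart_inv c.

Record smooth_manifold (R : realType) (N : nat) := SmoothManifold {
  manifold_carrier :> topologicalType;
  manifold_hausdorff : hausdorff_space manifold_carrier;
  manifold_second_countable : @second_countable manifold_carrier;
  atlas_index : Type;
  atlas : atlas_index -> chart R N manifold_carrier;
  atlas_cover : forall p, exists i, chart_dom (atlas i) p;
  atlas_smooth : forall i j,
    smooth_on
      (chart_map (atlas i) @` (chart_dom (atlas i) `&` chart_dom (atlas j)))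
      (transition (atlas i) (atlas j)) }.

Section Finsler.
Variables (R : realType) (N : nat).

(* g_ij(y) = 1/2 d^2 f^2 / dy^i dy^j *)
Definition finsler_metric (f : 'rV[R]_N -> R) : 'rV[R]_N -> 'M[R]_N := fun y =>
  \matrix_(i, j) (2^-1 * partial i (partial j (fun z => f z ^+ 2)) y).

Definition indicatrix (f : 'rV[R]_N -> R) : set 'rV[R]_N := [set y | f y = 1].

Definition slit_space : set 'rV[R]_N := [set y | y != 0].

(* [F i p y] is the value of the Finsler function at the tangent vector at p
   whose components in the i-th chart are y; it is only meaningful for p in the
   domain of that chart. [finsler_compat] says that this value depends only on
   the tangent vector. Homogeneity forces F to vanish at y = 0. *)
Record finsler_structure (M : smooth_manifold R N) := FinslerStructure {
  finsler_fun :> atlas_index M -> M -> 'rV[R]_N -> R;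
  finsler_compat : forall i j p y,
    chart_dom (atlas i) p -> chart_dom (atlas j) p ->
    finsler_fun j p
      ('d (transition (atlas i) (atlas j)) (chart_map (atlas i) p) y)
    = finsler_fun i p y;
  finsler_smooth : forall i,
    smooth_on
      ((chart_map (atlas i) @` chart_dom (atlas i)) `*` slit_space)
      (fun z : 'rV[R]_N * 'rV[R]_N =>
         finsler_fun i (chart_inv (atlas i) z.1) z.2 : R^o);
  finsler_pos : forall i p y,
    chart_dom (atlas i) p -> y != 0 -> 0 < finsler_fun i p y;
  finsler_homogeneous : forall i p (c : R) y,
    chart_dom (atlas i) p -> 0 < c ->
    finsler_fun i p (c *: y) = c * finsler_fun i p y;
  finsler_strongly_convex : forall i p y v,
    chart_dom (atlas i) p -> y != 0 -> v != 0 ->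
    0 < inner (finsler_metric (finsler_fun i p)) y v v }.

End Finsler.

(* Main.v *)
Require Import Defs.
From HB Require Import structures.
From mathcomp Require Import all_boot all_order all_algebra.
From mathcomp Require Import all_classical all_reals all_analysis.
From mathcomp Require Import ring lra.

Set Implicit Arguments.
Unset Strict Implicit.
Unset Printing Implicit Defensive.

Import Order.TTheory GRing.Theory Num.Theory.
Import numFieldNormedType.Exports.

Local Open Scope classical_set_scope.
Local Open Scope ring_scope.

(** Fix the base point and let E = F^2/2, a function on the tangent space minus
the origin. It is positively homogeneous of degree 2 and g is its Hessian. So g
is homogeneous of degree 0, the derivative of E in direction X is g_y(y, X), and
the Cartan tensor T, half the derivative of g, is totally symmetric and
annihilates the radial direction y. The Christoffel symbols of the Hessian
metric g are the components of T; its curvature tensor Rm [cartan_curv] is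
therefore quadratic in T and vanishes as soon as one argument is y. In other
words the tangent Riemannian space is the metric cone over the indicatrix. The
second fundamental form of the indicatrix is minus its metric, and the Gauss
equation says that its sectional curvature is that of g plus 1
[sectional_curvature_indicatrix].

Suppose lam g is flat near some point. The conformal change of the curvature
gives Rm in terms of g and P = Hess phi - dphi dphi + |dphi|^2 g / 2, where
phi = ln (lam) / 2 [conf_flatP]. Since N >= 3, inserting y forces
P = a (2 p p / F^2 - g) with p = g(y, .) and a a function, so that the
indicatrix has curvature 1 - 2 a at each of its points [cartan_curv_isotropic].
Let psi be the radial derivative of phi. Its differential is
(1 + psi) dphi + (a - |dphi|^2 / 2) p, and the symmetry of the second
derivatives of psi shows that the derivative of a vanishes along the indicatrix
[conf_coef_tangent]. This is uniform in N >= 3, whereas the lemma of Schur fails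
for surfaces, the case N = 3. Any two points of the indicatrix are joined by
curves in it, and the curvature is constant [isotropic_coef_constant].

Conversely, suppose the indicatrix has constant curvature K. Testing this on
radial projections of affine hyperplanes [hyperplane_chart] and polarizing, one
finds Rm in terms of g, F and K [cartan_curv_of_isotropic], and lam g is flat
for lam = F^(2 c - 2) with c^2 = K. The root exists because K >= 1
[indicatrix_curvature_ge1]: the trace of g is homogeneous of degree 0, hence
attains a maximum; there the trace of T vanishes, and the sum of
Rm(e_i, Y, Y, e_i) over a basis is a sum of squares. *)

(** * Functions of class C^k *)

Section CkGeneral.
Context {R : realType} {V W : normedModType R}.
Implicit Types (U : set V) (f g : V -> W).

Lemma near_open_eq U f g x : open U -> U x -> (forall y, U y -> f y = g y) ->
  \forall y \near x, f y = g y.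
Proof.
by move=> oU Ux fg; near=> y; apply: fg; near: y; exact: open_nbhs_nbhs.
Unshelve. all: by end_near. Qed.

Lemma derive_open_eq U f g x v : open U -> U x ->
  (forall y, U y -> f y = g y) -> 'D_v f x = 'D_v g x.
Proof. by move=> oU Ux fg; apply/near_eq_derive/(near_open_eq oU). Qed.

Lemma differentiable_near0 f x :
  (\forall y \near x, f y = 0) -> differentiable f x.
Proof.
move=> f0; have fx0 : f x = 0 by exact: nbhs_singleton f0.
have e : f \o shift x = cst (f x) + \0 +o_ 0 id.
  apply/eqaddoP => _/posnumP[e]; near=> h.
  rewrite !fctE /= fx0 addr0 subr0.
  rewrite (_ : f (h + x) = 0) ?normr0 ?mulr_ge0//.
  near: h; move: f0; rewrite (near_shift 0 x) subr0; exact.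
have dc : continuous (\0 : V -> W) by move=> ?; exact: cvg_cst.
have d0 := diff_unique dc e.
by apply/diff_locallyP; rewrite d0.
Unshelve. all: by end_near. Qed.

Lemma differentiable_open_eq U f g x : open U -> U x ->
  (forall y, U y -> f y = g y) -> differentiable f x -> differentiable g x.
Proof.
move=> oU Ux fg df.
have -> : g = f + (g - f) by rewrite addrC subrK.
apply: differentiableD => //; apply: differentiable_near0.
apply: (near_open_eq oU Ux (g := fun=> 0)) => y Uy.
by rewrite !fctE fg// subrr.
Qed.

(** The derivatives on an open set only depend on the values there, hence the
   class of a function may be read off a formula that is only valid on U. *)
Lemma Ck_on_eq k U f g : open U -> (forall y, U y -> f y = g y) ->
  Ck_on k U f -> Ck_on k U g.
Proof.
move=> oU; elim: k f g => [|k IH] f g fg /=.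
  move=> cf x Ux; have := cf x Ux; rewrite /prop_for /continuous_at => cfx.
  rewrite -(fg x Ux); apply: cvg_trans cfx; apply: near_eq_cvg.
  by apply: (near_open_eq oU Ux) => y Uy; rewrite fg.
case=> df Cf; split=> [x Ux|v].
  exact: (differentiable_open_eq oU Ux fg (df x Ux)).
by apply: IH (Cf v) => y Uy; apply: (derive_open_eq v oU Uy fg).
Qed.

Lemma Ck_onW k U f : Ck_on k.+1 U f -> Ck_on k U f.
Proof.
elim: k f => [|k IH] f /= [df Cf].
  by move=> x Ux; apply: differentiable_continuous; exact: df.
by split=> // v; apply: IH; exact: Cf.
Qed.

Lemma Ck_onW0 k U f : Ck_on k U f -> forall x, U x -> {for x, continuous f}.
Proof. by elim: k f => [|k IH] f // /Ck_onW; exact: IH. Qed.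

Lemma Ck_on_sub k U U' f : U' `<=` U -> Ck_on k U f -> Ck_on k U' f.
Proof.
move=> sU; elim: k f => [|k IH] f /=; first by move=> cf x /sU; exact: cf.
by case=> df Cf; split=> [x /sU|v]; [exact: df|exact: IH].
Qed.

Lemma Ck_on_cst k U (c : W) : Ck_on k U (fun=> c).
Proof.
elim: k c => [|k IH] c /=; first by move=> x _; exact: cvg_cst.
split=> [x _|v]; first exact: differentiable_cst.
have -> : (fun x => 'D_v (fun=> c) x) = (fun=> 0) :> (V -> W).
  by apply/funext => x; rewrite derive_cst.
exact: IH.
Qed.

Lemma Ck_onD k U f g : open U -> Ck_on k U f -> Ck_on k U g ->
  Ck_on k U (fun x => f x + g x).
Proof.
move=> oU; elim: k f g => [|k IH] f g /=.
  by move=> cf cg x Ux; apply: cvgD; [exact: cf|exact: cg].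
move=> [df Cf] [dg Cg]; split=> [x Ux|v].
  by apply: differentiableD; [exact: df|exact: dg].
apply: (Ck_on_eq oU) (IH _ _ (Cf v) (Cg v)) => x Ux.
by rewrite deriveD//; apply: diff_derivable; [exact: df|exact: dg].
Qed.

Lemma Ck_on_sum k U (I : finType) (f : I -> V -> W) : open U ->
  (forall i, Ck_on k U (f i)) -> Ck_on k U (fun x => \sum_i f i x).
Proof.
move=> oU Cf; elim: (index_enum I) => [|i s IH].
  rewrite (_ : (fun x => _) = fun=> 0); first exact: Ck_on_cst.
  by apply/funext => x; rewrite big_nil.
rewrite (_ : (fun x => _) = fun x => f i x + \sum_(j <- s) f j x).
  exact: Ck_onD.
by apply/funext => x; rewrite big_cons.
Qed.

Lemma Ck_on_derive k U f v : Ck_on k.+1 U f -> Ck_on k U (fun x => 'D_v f x).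
Proof. by case=> _; exact. Qed.

Lemma Ck_on_scalel k U (f : V -> R) (w : W) : open U -> Ck_on k U f ->
  Ck_on k U (fun x => f x *: w).
Proof.
move=> oU; elim: k f => [|k IH] f /=.
  by move=> cf x Ux; apply: cvgZr_tmp; exact: cf.
move=> [df Cf]; split=> [x Ux|v].
  by apply: differentiableZl; exact: df.
apply: (Ck_on_eq oU) (IH _ (Cf v)) => x Ux.
have dfx := df x Ux.
have dfz : differentiable (fun x => f x *: w) x by exact: differentiableZl.
rewrite (deriveE _ dfx) (deriveE _ dfz).
by rewrite diffZl.
Qed.

End CkGeneral.

Lemma differentiable_idfun (R : realType) (V : normedModType R) (x : V) :
  differentiable (fun y : V => y) x.
Proof. exact: (ex_diff (f := id)). Qed.

Lemma Ck_on_id (R : realType) (V : normedModType R) k (U : set V) :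
  Ck_on k U (fun x : V => x).
Proof.
case: k => [|k] /=; first by move=> x _; exact: cvg_id.
split=> [x _|v]; first exact: differentiable_idfun.
have -> : (fun x : V => 'D_v (fun y : V => y) x) = fun=> v; last exact: Ck_on_cst.
by apply/funext => x; exact: derive_id.
Qed.

Section CkScalar.
Context {R : realType} {V : normedModType R}.
Implicit Types (U : set V) (f g : V -> R).

Lemma Ck_onM k U f g : open U -> Ck_on k U f -> Ck_on k U g ->
  Ck_on k U (fun x => f x * g x).
Proof.
move=> oU; elim: k f g => [|k IH] f g.
  by move=> cf cg x Ux; apply: cvgM; [exact: cf|exact: cg].
move=> Cf1 Cg1; have [df Cf] := Cf1; have [dg Cg] := Cg1.
split=> [x Ux|v].
  by apply: differentiableM; [exact: df|exact: dg].
pose h x := f x * 'D_v g x + g x * 'D_v f x.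
have Ch : Ck_on k U h.
  by apply: Ck_onD => //; apply: IH; (try exact: Ck_onW); [exact: Cg|exact: Cf].
apply: (Ck_on_eq oU) Ch => x Ux.
rewrite deriveM//; apply: diff_derivable; [exact: df|exact: dg].
Qed.

Lemma Ck_onZ k U f (c : R) : open U -> Ck_on k U f ->
  Ck_on k U (fun x => c * f x).
Proof. by move=> oU; apply: Ck_onM => //; exact: Ck_on_cst. Qed.

Lemma Ck_onN k U f : open U -> Ck_on k U f -> Ck_on k U (fun x => - f x).
Proof.
move=> oU /(Ck_onZ (-1) oU); apply: Ck_on_eq => // x _.
by rewrite mulN1r.
Qed.

Lemma Ck_onB k U f g : open U -> Ck_on k U f -> Ck_on k U g ->
  Ck_on k U (fun x => f x - g x).
Proof. by move=> oU Cf Cg; apply: Ck_onD => //; exact: Ck_onN. Qed.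

Lemma Ck_on_prod k U (I : finType) (f : I -> V -> R) : open U ->
  (forall i, Ck_on k U (f i)) -> Ck_on k U (fun x => \prod_i f i x).
Proof.
move=> oU Cf; elim: (index_enum I) => [|i s IH].
  rewrite (_ : (fun x => _) = fun=> 1); first exact: Ck_on_cst.
  by apply/funext => x; rewrite big_nil.
rewrite (_ : (fun x => _) = fun x => f i x * \prod_(j <- s) f j x).
  exact: Ck_onM.
by apply/funext => x; rewrite big_cons.
Qed.

Lemma is_derive_powR f x v (a df : R) : 0 < f x -> differentiable f x ->
  is_derive x v f df ->
  is_derive x v (fun y => f y `^ a) (a * f x `^ (a - 1) * df).
Proof.
move=> fx0 dif [_ <-].
have /derivable1_diffP dp : derivable (@powR R ^~ a) (f x) 1.
  by apply: ex_derive; exact: is_derive1_powR.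
have dc := differentiable_comp dif dp.
apply: DeriveDef; first exact: diff_derivable.
rewrite deriveE// (diff_comp dif dp)/= deriveE//.
have [_ e] := @is_derive1_powR R a _ fx0.
set D := 'd f x v.
have -> : 'd (@powR R ^~ a) (f x) D = D *: 'd (@powR R ^~ a) (f x) 1.
  by rewrite -linearZ/= [_ *: _]mulr1.
by rewrite -deriveE// e; exact: mulrC.
Qed.

(** The derivative of f^a involves f^(a - 1), so the induction on k treats all
   exponents at once. *)
Lemma Ck_on_powR k U f (a : R) : open U -> (forall x, U x -> 0 < f x) ->
  Ck_on k U f -> Ck_on k U (fun x => f x `^ a).
Proof.
move=> oU f0; elim: k a => [|k IH] a.
  move=> cf x Ux; apply: (@continuous_comp _ _ _ f (@powR R ^~ a)); first exact: cf.
  apply/differentiable_continuous/derivable1_diffP.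
  by apply: ex_derive; apply: is_derive1_powR; exact: f0.
move=> Cf1; have [df Cf] := Cf1; split=> [x Ux|v].
  apply: (@differentiable_comp _ _ _ _ f (@powR R ^~ a)); first exact: df.
  apply/derivable1_diffP.
  by apply: ex_derive; apply: is_derive1_powR; exact: f0.
have Ch : Ck_on k U (fun x => a * f x `^ (a - 1) * 'D_v f x).
  by apply: Ck_onM (Cf v) => //; apply: Ck_onZ => //; apply: IH; exact: Ck_onW.
apply: (Ck_on_eq oU) Ch => x Ux.
have dv : is_derive x v f ('D_v f x).
  by apply: derivableP; apply: diff_derivable; exact: df.
by have [_ ->] := is_derive_powR a (f0 _ Ux) (df _ Ux) dv.
Qed.

Lemma Ck_onV k U f : open U -> (forall x, U x -> f x != 0) ->
  Ck_on k U f -> Ck_on k U (fun x => (f x)^-1).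
Proof.
move=> oU f0; elim: k => [|k IH].
  by move=> cf x Ux; apply: cvgV; [exact: f0|exact: cf].
move=> Cf1; have [df Cf] := Cf1; split=> [x Ux|v].
  by apply: differentiableV; [exact: df|exact: f0].
have Ci := IH (Ck_onW Cf1).
have Ch : Ck_on k U (fun x => - (((f x)^-1 * (f x)^-1) * 'D_v f x)).
  by apply: Ck_onN => //; apply: Ck_onM (Cf v) => //; exact: Ck_onM.
apply: (Ck_on_eq oU) Ch => x Ux.
rewrite deriveV; [|exact: f0|by apply: diff_derivable; exact: df].
by rewrite -exprVn expr2 scaleNr.
Qed.

End CkScalar.

(** * Leibniz and chain rules for directional derivatives *)

Section IsDerive.
Context {R : realType} {V : normedModType R}.
Implicit Types (f g : V -> R) (x v : V).

Lemma is_derive_add f g x v (df dg : R) : is_derive x v f df ->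
  is_derive x v g dg -> is_derive x v (fun y => f y + g y) (df + dg).
Proof. exact: is_deriveD. Qed.

Lemma is_derive_opp f x v (df : R) : is_derive x v f df ->
  is_derive x v (fun y => - f y) (- df).
Proof. exact: is_deriveN. Qed.

Lemma is_derive_mul f g x v (df dg : R) : is_derive x v f df ->
  is_derive x v g dg ->
  is_derive x v (fun y => f y * g y) (df * g x + f x * dg).
Proof.
move=> hf hg; apply: (is_derive_eq (is_deriveM hf hg)).
by rewrite addrC; congr (_ + _); exact: mulrC.
Qed.

Lemma is_derive_const (c : R) x v : is_derive x v (fun=> c) (0 : R).
Proof. exact: is_derive_cst. Qed.

Lemma is_derive_cmul f (c : R) x v (df : R) : is_derive x v f df ->
  is_derive x v (fun y => c * f y) (c * df).
Proof. exact: is_deriveZ. Qed.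

Lemma is_derive_mulc f (c : R) x v (df : R) : is_derive x v f df ->
  is_derive x v (fun y => f y * c) (df * c).
Proof.
move=> hf; have := is_derive_mul hf (is_derive_const c x v).
by rewrite mulr0 addr0.
Qed.

Lemma is_derive_bigsum n (h : 'I_n -> V -> R) x v (dh : 'I_n -> R) :
  (forall i, is_derive x v (h i) (dh i)) ->
  is_derive x v (fun y => \sum_(i < n) h i y) (\sum_(i < n) dh i).
Proof.
move=> /(is_derive_sum (h := h)).
by rewrite (_ : \sum_(i < n) h i = fun y => \sum_(i < n) h i y)//
  funeqE => y; rewrite fct_sumE.
Qed.

Lemma is_derive_inv f x v (df : R) : f x != 0 -> is_derive x v f df ->
  is_derive x v (fun y => (f y)^-1) (- (f x) ^- 2 * df).
Proof.
move=> fx0 [hf <-]; apply: DeriveDef; first exact: derivableV.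
by rewrite deriveV.
Qed.

Lemma is_derive_coord m n (u : V -> 'M[R]_(m, n)) x v du i j :
  is_derive x v u du -> is_derive x v (fun y => u y i j) (du i j).
Proof.
case=> du1 <-; apply: DeriveDef; first by move/derivable_mxP: (du1).
by rewrite (derive_mx du1) mxE.
Qed.

Lemma is_derive_mx m n (u : V -> 'M[R]_(m, n)) x v (du : 'M[R]_(m, n)) :
  (forall i j, is_derive x v (fun y => u y i j) (du i j)) ->
  is_derive x v u du.
Proof.
move=> h.
have d : derivable u x v by apply/derivable_mxP => i j; have [] := h i j.
apply: DeriveDef => //; rewrite (derive_mx d); apply/matrixP => i j.
by rewrite mxE; have [_ ->] := h i j.
Qed.

Lemma differentiable_is_derive (W : normedModType R) (f : V -> W) x v :
  differentiable f x -> is_derive x v f ('D_v f x).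
Proof. by move=> df; exact/derivableP/diff_derivable. Qed.

Lemma is_derive_comp (W W' : normedModType R) (f : W -> W') (u : V -> W) x v :
  differentiable f (u x) -> differentiable u x ->
  is_derive x v (fun y => f (u y)) ('D_('D_v u x) f (u x)).
Proof.
move=> df du.
have dc := differentiable_comp du df.
apply: DeriveDef; first exact: (diff_derivable dc).
by rewrite (deriveE _ dc) (diff_comp du df)/= (deriveE _ du) (deriveE _ df).
Qed.

Lemma deriveDl (W : normedModType R) (f : V -> W) x v w : differentiable f x ->
  'D_(v + w) f x = 'D_v f x + 'D_w f x.
Proof. by move=> df; rewrite !deriveE// linearD. Qed.

Lemma deriveZl (W : normedModType R) (f : V -> W) x c v : differentiable f x ->
  'D_(c *: v) f x = c *: 'D_v f x.
Proof. by move=> df; rewrite !deriveE// linearZ. Qed.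

Lemma is_derive_line (W : normedModType R) (f : V -> W) (v z : V) (s : R) :
  differentiable f (s *: v + z) ->
  is_derive s (1 : R) (fun s : R => f (s *: v + z)) ('D_v f (s *: v + z)).
Proof.
move=> df.
have dl : is_diff s (fun s : R => s *: v + z) ( *:%R^~ v).
  apply: (is_diff_eq (is_diffD (is_diff_scalel s v) (is_diff_cst z s))).
  by apply/funext => t; rewrite !fctE addr0.
have [ddl edl] := dl.
have dc := differentiable_comp ddl df.
apply: DeriveDef; first exact: (diff_derivable dc).
by rewrite (deriveE _ dc) (diff_comp ddl df)/= edl scale1r (deriveE _ df).
Qed.

End IsDerive.

Section Coordinates.
Context {R : realType}.

Lemma derive_coords n (W : normedModType R) (f : 'rV[R]_n -> W) x v :
  differentiable f x ->
  'D_v f x = \sum_j v 0 j *: 'D_(delta_mx 0 j) f x.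
Proof.
move=> df; rewrite [in LHS](row_sum_delta v) deriveE// linear_sum.
by apply: eq_bigr => j _; rewrite linearZ deriveE.
Qed.

Lemma Ck_on_coord (V : normedModType R) k (U : set V) m n
    (u : V -> 'M[R]_(m, n)) i j : open U -> Ck_on k U u ->
  Ck_on k U (fun x => u x i j).
Proof.
move=> oU; elim: k u => [|k IH] u.
  move=> cu x Ux; apply: (@continuous_comp _ _ _ u (fun M => M i j)).
    exact: cu.
  exact: coord_continuous.
case=> du Cu; split=> [x Ux|v].
  apply: (@differentiable_comp _ _ _ _ u (fun M => M i j)); first exact: du.
  exact: differentiable_coord.
apply: (Ck_on_eq oU) (IH _ (Cu v)) => x Ux.
have [_ ->//] := is_derive_coord i j (differentiable_is_derive v (du x Ux)).
Qed.

Lemma Ck_on_row (V : normedModType R) k (U : set V) n (u : V -> 'rV[R]_n) :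
  open U -> (forall j, Ck_on k U (fun x => u x 0 j)) -> Ck_on k U u.
Proof.
move=> oU Cu.
have : Ck_on k U (fun x => \sum_j u x 0 j *: (delta_mx 0 j : 'rV[R]_n)).
  by apply: Ck_on_sum => // j; apply: Ck_on_scalel.
by apply: Ck_on_eq => // x _; rewrite -row_sum_delta.
Qed.

(** The derivative of the composite is the sum of the partial derivatives of f
   at u, times the coordinates of the derivative of u. It has the same shape as
   the composite itself, with one derivative less. *)
Lemma Ck_on_comp (V : normedModType R) n k (U : set V) (O : set 'rV[R]_n)
    (f : 'rV[R]_n -> R) (u : V -> 'rV[R]_n) : open U -> open O ->
  (forall x, U x -> O (u x)) -> Ck_on k O f -> Ck_on k U u ->
  Ck_on k U (fun x => f (u x)).
Proof.
move=> oU oO UO; elim: k f => [|k IH] f Cf1 Cu1.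
  move=> x Ux; apply: (@continuous_comp _ _ _ u f); first exact: Cu1.
  by apply: Cf1; exact: UO.
have [df Cf] := Cf1; have [du Cu] := Cu1.
split=> [x Ux|v].
  by apply: (@differentiable_comp _ _ _ _ u f); [exact: du|exact/df/UO].
have Ch : Ck_on k U (fun x => \sum_j ('D_v u x) 0 j *
                                 'D_(delta_mx 0 j) f (u x)).
  apply: Ck_on_sum => // j; apply: Ck_onM => //.
    by apply: Ck_on_coord => //; exact: Cu.
  by apply: (IH (fun z => 'D_(delta_mx 0 j) f z)); [exact: Cf|exact: Ck_onW].
apply: (Ck_on_eq oU) Ch => x Ux.
have [_ ->] := is_derive_comp v (df _ (UO _ Ux)) (du _ Ux).
by rewrite (derive_coords _ (df _ (UO _ Ux))).
Qed.

Lemma Ck_on_det (V : normedModType R) k (U : set V) n (G : V -> 'M[R]_n) :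
  open U -> (forall i j, Ck_on k U (fun x => G x i j)) ->
  Ck_on k U (fun x => \det (G x)).
Proof.
move=> oU CG; rewrite /determinant.
apply: Ck_on_sum => // s; apply: Ck_onZ => //; exact: Ck_on_prod.
Qed.

(** By the rule of Cramer the inverse is rational in the entries. *)
Lemma Ck_on_invmx (V : normedModType R) k (U : set V) n (G : V -> 'M[R]_n) i j :
  open U -> (forall i j, Ck_on k U (fun x => G x i j)) ->
  (forall x, U x -> G x \in unitmx) ->
  Ck_on k U (fun x => invmx (G x) i j).
Proof.
move=> oU CG uG.
have : Ck_on k U (fun x => (\det (G x))^-1 * cofactor (G x) j i).
  apply: Ck_onM => //.
    apply: Ck_onV => //; first by move=> x Ux; rewrite -unitfE -unitmxE uG.
    exact: Ck_on_det.
  rewrite /cofactor; apply: Ck_onZ => //; apply: Ck_on_det => // a b.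
  by apply: (Ck_on_eq oU) (CG (lift j a) (lift i b)) => x _; rewrite !mxE.
by apply: Ck_on_eq => // x Ux; rewrite /invmx uG// !mxE.
Qed.

(** Leibniz rule for an expression that is linear in a moving vector Y.
   Linearity is stated through the coordinates of Y. Applied to one argument after
   the other, the lemma differentiates a tensor field evaluated on moving vectors
   along a moving base point. *)
Lemma is_derive_slot (V : normedModType R) n (Psi : 'rV[R]_n -> V -> R)
    (dPsi : 'rV[R]_n -> R) (Y : V -> 'rV[R]_n) dY x v :
  (forall d w, Psi d w = \sum_j d 0 j * Psi (delta_mx 0 j) w) ->
  (forall d, dPsi d = \sum_j d 0 j * dPsi (delta_mx 0 j)) ->
  is_derive x v Y dY -> (forall d, is_derive x v (Psi d) (dPsi d)) ->
  is_derive x v (fun w => Psi (Y w) w) (dPsi (Y x) + Psi dY x).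
Proof.
move=> PE dPE hY hP.
rewrite (_ : (fun w => Psi (Y w) w) =
             fun w => \sum_j Y w 0 j * Psi (delta_mx 0 j) w); last first.
  by apply/funext => w; rewrite PE.
have := is_derive_bigsum (fun j => is_derive_mul (is_derive_coord 0 j hY)
                                                 (hP (delta_mx 0 j))).
move=> h; apply: (is_derive_eq h).
by rewrite big_split/= addrC -dPE -PE.
Qed.

End Coordinates.

(** * Symmetry of second derivatives *)

Section Schwarz.
Context {R : realType} {V : normedModType R}.
Implicit Types (U : set V) (f : V -> R).

(** Mean value theorem, first along v for the difference of f at two points
   that differ by h w, then along w. *)
Lemma second_difference U f x v w (h : R) : 0 < h -> Ck_on 2 U f ->
  (forall s t : R, 0 <= s <= h -> 0 <= t <= h -> U (s *: v + (t *: w + x))) ->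
  exists s t, [/\ 0 <= s <= h, 0 <= t <= h &
    f (h *: v + (h *: w + x)) - f (h *: v + x) - (f (h *: w + x) - f x) =
    'D_w (fun z => 'D_v f z) (s *: v + (t *: w + x)) * h * h].
Proof.
move=> h0 [df Cf] Uh; have [dvf _] := Cf v.
have h0' : 0 <= h <= h by rewrite lexx ltW.
have z0' : 0 <= (0 : R) <= h by rewrite lexx ltW.
have itv_cc (r : R) : r \in `]0, h[ -> 0 <= r <= h.
  by rewrite in_itv/= => /andP[a b]; rewrite !ltW.
have hk (s : R) : 0 <= s <= h -> is_derive s (1 : R)
    (fun s : R => f (s *: v + (h *: w + x)) - f (s *: v + x))
    ('D_v f (s *: v + (h *: w + x)) - 'D_v f (s *: v + x)).
  move=> sh; apply: is_derive_add.
    by apply: is_derive_line; apply: df; exact: Uh.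
  apply: is_derive_opp; apply: is_derive_line; apply: df.
  by have := Uh s 0 sh z0'; rewrite scale0r add0r.
have [] := MVT h0 (fun s (hs : s \in `]0, h[) => hk s (itv_cc s hs)).
  apply: derivable_within_continuous => s; rewrite in_itv/= => hs.
  by have [] := hk _ hs.
move=> s; rewrite in_itv/= => /andP[s0 sh].
rewrite !scale0r !add0r subr0 => ->.
have sh' : 0 <= s <= h by rewrite !ltW.
have hl (t : R) : 0 <= t <= h -> is_derive t (1 : R)
    (fun t : R => 'D_v f (s *: v + (t *: w + x)))
    ('D_w (fun z => 'D_v f z) (s *: v + (t *: w + x))).
  move=> th.
  have := @is_derive_line _ _ _ (fun z => 'D_v f z) w (s *: v + x) t.
  rewrite addrCA => H.
  have := H (dvf _ (Uh _ _ sh' th)).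
  by under eq_fun do rewrite addrCA.
have [] := MVT h0 (fun t (ht : t \in `]0, h[) => hl t (itv_cc t ht)).
  apply: derivable_within_continuous => t; rewrite in_itv/= => ht.
  by have [] := hl _ ht.
move=> t; rewrite in_itv/= => /andP[t0 th].
rewrite scale0r add0r subr0 => ->.
by exists s, t; split=> //; rewrite !ltW.
Qed.

Lemma dist_le_of_eq (a a' b b' e : R) :
  `|a - a'| < e / 2 -> `|b - b'| < e / 2 -> a' = b' -> `|a - b| <= e.
Proof.
move=> ha hb ab; rewrite (_ : a - b = (a - a') - (b - b')); last first.
  by rewrite ab; ring.
by apply: (le_trans (ler_normB _ _)); rewrite [leRHS]splitr lerD// ltW.
Qed.

(** The second difference quotient is a value of either mixed derivative at a
   point close to x, and both are continuous. *)
Lemma derive_comm U f x v w : open U -> U x -> Ck_on 2 U f ->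
  'D_v (fun z => 'D_w f z) x = 'D_w (fun z => 'D_v f z) x.
Proof.
move=> oU Ux Cf; have [_ Cf1] := Cf.
have [[_ Cvw] [_ Cwv]] := (Cf1 w, Cf1 v).
apply/eqP; rewrite -subr_eq0 -normr_le0; apply/ler_addgt0Pl => e e0.
rewrite addr0.
have e2 : 0 < e / 2 by rewrite divr_gt0.
have nA : \forall z \near x, `|'D_v (fun z => 'D_w f z) x -
    'D_v (fun z => 'D_w f z) z| < e / 2.
  by have /cvgrPdist_lt/(_ _ e2) := Cvw v x Ux.
have nB : \forall z \near x, `|'D_w (fun z => 'D_v f z) x -
    'D_w (fun z => 'D_v f z) z| < e / 2.
  by have /cvgrPdist_lt/(_ _ e2) := Cwv w x Ux.
have nU : \forall z \near x, U z by exact: open_nbhs_nbhs.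
have [d /= d0 hd] := (nbhs_ballP _ _).1 (filterI (filterI nA nB) nU).
(* The parallelogram at x with sides h v and h w lies in the ball of radius d. *)
set m := `|v| + `|w| + 1.
have m0 : 0 < m by rewrite ltr_wpDl// addr_ge0.
pose h := d / (2 * m).
have h0 : 0 < h by rewrite divr_gt0 ?mulr_gt0.
have hb s t : 0 <= s <= h -> 0 <= t <= h -> ball x d (s *: v + (t *: w + x)).
  move=> /andP[s0 sh] /andP[t0 th].
  rewrite -ball_normE/= addrA opprD addrCA subrr addr0 normrN.
  apply: (le_lt_trans (ler_normD _ _)); rewrite !normrZ !ger0_norm//.
  apply: (@le_lt_trans _ _ (h * (`|v| + `|w|))).
    by rewrite mulrDr lerD// ler_wpM2r.
  apply: (@lt_le_trans _ _ (h * m)); first by rewrite ltr_pM2l// ltrDl.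
  have -> : h * m = d / 2 by rewrite /h; field; rewrite gt_eqF.
  by rewrite ler_pdivrMr// ler_peMr ?ltW// ltr1n.
have hU s t sh th := (hd _ (hb s t sh th)).2.
have [s [t [sh th e1]]] := second_difference h0 Cf hU.
have hb' s' t' : 0 <= s' <= h -> 0 <= t' <= h ->
    ball x d (s' *: w + (t' *: v + x)).
  by move=> ? ?; rewrite addrCA; exact: hb.
have hU' s' t' sh' th' := (hd _ (hb' s' t' sh' th')).2.
have [s' [t' [sh' th' e2']]] := second_difference h0 Cf hU'.
have [[_ B1] _] := hd _ (hb _ _ sh th).
have [[A1 _] _] := hd _ (hb' _ _ sh' th').
apply: (dist_le_of_eq A1 B1).
apply: (mulIf (lt0r_neq0 h0)); apply: (mulIf (lt0r_neq0 h0)).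
apply: (etrans (esym e2')); apply: (etrans _ e1).
rewrite [h *: w + (h *: v + x)]addrCA.
by move: (f _) (f _) (f _) (f _) => a1 a2 a3 a4; ring.
Qed.

End Schwarz.

(** * The fully covariant curvature tensor *)

Section LoweredCurvature.
Context {R : realType} {n : nat}.
Implicit Types (G : 'rV[R]_n -> 'M[R]_n) (U : set 'rV[R]_n).

Lemma innerE G x X Y :
  inner G x X Y = \sum_i \sum_j X 0 i * Y 0 j * G x i j.
Proof.
rewrite /inner mxE exchange_big/=; apply: eq_bigr => j _.
rewrite !mxE mulr_suml; apply: eq_bigr => i _.
by rewrite mulrAC.
Qed.

(** Christoffel symbols of the first kind. *)
Definition christoffel_lower G (i j l : 'I_n) : 'rV[R]_n -> R := fun x =>
  2^-1 * (partial i (fun y => G y j l) x + partial j (fun y => G y i l) x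
          - partial l (fun y => G y i j) x).

Definition christoffel_row G (i j : 'I_n) (x : 'rV[R]_n) : 'rV[R]_n :=
  \row_l christoffel_lower G i j l x.

Definition cometric G (x : 'rV[R]_n) : 'rV[R]_n -> 'rV[R]_n -> R :=
  inner (fun y => invmx (G y)) x.

(** The inner product of R(e_i, e_j) e_k with e_l. *)
Definition lowered_curvature G (i j k l : 'I_n) (x : 'rV[R]_n) : R :=
  \sum_m G x l m * curvature G i j k m x.

Lemma christoffelE G k i j x :
  christoffel G k i j x = \sum_l invmx (G x) k l * christoffel_lower G i j l x.
Proof.
rewrite /christoffel mulr_sumr; apply: eq_bigr => l _.
by rewrite mulrCA.
Qed.

Lemma lower_christoffel G l i j x : G x \in unitmx ->
  \sum_k G x l k * christoffel G k i j x = christoffel_lower G i j l x.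
Proof.
move=> uG.
have e : \col_k christoffel G k i j x = invmx (G x) *m (christoffel_row G i j x)^T.
  apply/matrixP => a b; rewrite !mxE christoffelE.
  by apply: eq_bigr => m _; rewrite !mxE.
have /matrixP/(_ l 0) : G x *m \col_k christoffel G k i j x =
    (christoffel_row G i j x)^T by rewrite e mulKVmx.
by rewrite !mxE => <-; apply: eq_bigr => k _; rewrite mxE.
Qed.

Lemma Ck_on_christoffel_lower G U k i j l : open U ->
  (forall i j, Ck_on k.+1 U (fun x => G x i j)) ->
  Ck_on k U (christoffel_lower G i j l).
Proof.
move=> oU CG; have CP a b c : Ck_on k U (partial a (fun y => G y b c)).
  exact: Ck_on_derive.
by apply: Ck_onZ => //; apply: Ck_onB => //; apply: Ck_onD.
Qed.

Lemma Ck_on_christoffel G U k m i j : open U ->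
  (forall i j, Ck_on k.+1 U (fun x => G x i j)) ->
  (forall x, U x -> G x \in unitmx) ->
  Ck_on k U (christoffel G m i j).
Proof.
move=> oU CG uG.
have : Ck_on k U (fun x =>
    \sum_l invmx (G x) m l * christoffel_lower G i j l x).
  apply: Ck_on_sum => // l; apply: Ck_onM => //.
    by apply: Ck_on_invmx => // a b; exact: Ck_onW.
  exact: Ck_on_christoffel_lower.
by apply: Ck_on_eq => // x _; rewrite christoffelE.
Qed.

Lemma cometric_christoffel G i j k l x :
  cometric G x (christoffel_row G i j x) (christoffel_row G k l x) =
  \sum_m christoffel_lower G i j m x * christoffel G m k l x.
Proof.
rewrite /cometric innerE; apply: eq_bigr => m _.
rewrite christoffelE mulr_sumr; apply: eq_bigr => q _.
by rewrite !mxE -mulrA [_ * invmx _ _ _]mulrC mulrA.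
Qed.

(** Differentiating the identity between the two kinds of Christoffel symbols
   expresses G times the derivatives of the second kind through the first kind, so
   that the inverse of G is never differentiated. *)
Lemma lowered_curvatureE G U i j k l x : open U -> U x ->
  (forall i j, Ck_on 2 U (fun x => G x i j)) ->
  (forall x, U x -> G x \in unitmx) ->
  (forall x, U x -> (G x)^T = G x) ->
  lowered_curvature G i j k l x =
    partial i (christoffel_lower G j k l) x
    - partial j (christoffel_lower G i k l) x
    + (cometric G x (christoffel_row G j l x) (christoffel_row G i k x)
       - cometric G x (christoffel_row G i l x) (christoffel_row G j k x)).
Proof.
move=> oU Ux CG uG sG.
have symG y a b : U y -> G y a b = G y b a.
  by move=> Uy; rewrite -[in LHS](sG _ Uy) mxE.
have dGam m a b : differentiable (christoffel G m a b) x.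
  have [+ _] := Ck_on_christoffel (k := 1) m a b oU CG uG; exact.
have dG a b : differentiable (fun y => G y a b) x.
  by have [+ _] := CG a b; exact.
have dlow a b c : partial a (christoffel_lower G b c l) x =
    \sum_m (partial a (fun y => G y l m) x * christoffel G m b c x
            + G x l m * partial a (christoffel G m b c) x).
  rewrite /partial (derive_open_eq (g := fun y =>
    \sum_m G y l m * christoffel G m b c y) _ oU Ux); last first.
    by move=> y Uy; rewrite lower_christoffel ?uG.
  have [_ ->//] := is_derive_bigsum (fun m => is_derive_mul
    (differentiable_is_derive (delta_mx 0 a) (dG l m))
    (differentiable_is_derive (delta_mx 0 a) (dGam m b c))).
have pG a b c : partial a (fun y => G y b c) x =
    christoffel_lower G a b c x + christoffel_lower G a c b x.
  rewrite /christoffel_lower.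
  rewrite [partial a (fun y => G y c b) x](derive_open_eq
    (g := fun y => G y b c) _ oU Ux); last by move=> y Uy; exact: symG.
  by rewrite -/(partial a (fun y => G y b c) x); field.
rewrite !cometric_christoffel /lowered_curvature.
rewrite !dlow.
have -> : \sum_m G x l m * curvature G i j k m x =
    \sum_m G x l m * (partial i (christoffel G m j k) x
                      - partial j (christoffel G m i k) x)
    + \sum_m (christoffel_lower G i m l x * christoffel G m j k x
              - christoffel_lower G j m l x * christoffel G m i k x).
  rewrite /curvature; under eq_bigr do rewrite mulrDr.
  rewrite big_split/=; congr (_ + _).
  under eq_bigr do rewrite mulr_sumr.
  rewrite exchange_big/=; apply: eq_bigr => p _.
  rewrite -!(lower_christoffel _ _ _ (uG _ Ux)) !mulr_suml -sumrB.
  by apply: eq_bigr => m _; rewrite mulrBr !mulrA.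
rewrite -!sumrB -!big_split/=; apply: eq_bigr => m _.
rewrite (pG i l m) (pG j l m).
move: (christoffel_lower G i l m x) (christoffel_lower G i m l x).
move: (christoffel_lower G j l m x) (christoffel_lower G j m l x).
move: (partial i (christoffel G m j k) x) (partial j (christoffel G m i k) x).
move: (christoffel G m j k x) (christoffel G m i k x) (G x l m) => *.
ring.
Qed.

Lemma flat_lowered_curvature G x : G x \in unitmx ->
  (forall i j k l, lowered_curvature G i j k l x = 0) <->
  (forall i j k l, curvature G i j k l x = 0).
Proof.
move=> uG; split=> h i j k l; last first.
  by rewrite /lowered_curvature big1// => m _; rewrite h mulr0.
have e : G x *m \col_m curvature G i j k m x = 0.
  apply/matrixP => a b; rewrite !mxE -[RHS](h i j k a).
  by apply: eq_bigr => m _; rewrite mxE.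
have /matrixP/(_ l 0) : \col_m curvature G i j k m x = 0.
  by rewrite -[LHS](mulKmx uG) e mulmx0.
by rewrite !mxE.
Qed.

(** The numerator of a sectional curvature is the case Z = Y, W = X. *)
Lemma inner_curvature_op G x X Y Z W : (G x)^T = G x ->
  inner G x (curvature_op G x X Y Z) W =
  \sum_i \sum_j \sum_k \sum_l
    X 0 i * Y 0 j * Z 0 k * W 0 l * lowered_curvature G i j k l x.
Proof.
move=> sG; rewrite innerE.
transitivity (\sum_m \sum_l \sum_i \sum_j \sum_k
   X 0 i * Y 0 j * Z 0 k * W 0 l * (G x l m * curvature G i j k m x)).
  apply: eq_bigr => m _; apply: eq_bigr => l _.
  rewrite mxE -[in LHS]sG mxE !mulr_suml; apply: eq_bigr => i _.
  rewrite !mulr_suml; apply: eq_bigr => j _.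
  by rewrite !mulr_suml; apply: eq_bigr => k _; ring.
rewrite exchange_big/=.
under eq_bigr => l _ do (rewrite exchange_big/=; under eq_bigr => i _ do
  (rewrite exchange_big/=; under eq_bigr => j _ do
     (rewrite exchange_big/=; under eq_bigr => k _ do rewrite -mulr_sumr))).
rewrite exchange_big/=; apply: eq_bigr => i _.
rewrite exchange_big/=; apply: eq_bigr => j _.
by rewrite exchange_big/=; apply: eq_bigr => k _.
Qed.

End LoweredCurvature.

(** * The Hessian metric of a Minkowski norm *)

Section InnerAlgebra.
Context {R : realType} {n : nat} (G : 'rV[R]_n -> 'M[R]_n) (x : 'rV[R]_n).
Implicit Types X Y Z : 'rV[R]_n.

Lemma innerDl X Y Z : inner G x (X + Y) Z = inner G x X Z + inner G x Y Z.
Proof. by rewrite /inner !mulmxDl mxE. Qed.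
Lemma innerDr X Y Z : inner G x X (Y + Z) = inner G x X Y + inner G x X Z.
Proof. by rewrite /inner linearD mulmxDr mxE. Qed.
Lemma innerZl c X Y : inner G x (c *: X) Y = c * inner G x X Y.
Proof. by rewrite /inner -!scalemxAl mxE. Qed.
Lemma innerZr c X Y : inner G x X (c *: Y) = c * inner G x X Y.
Proof. by rewrite /inner linearZ/= -!scalemxAr mxE. Qed.
Lemma innerNl X Y : inner G x (- X) Y = - inner G x X Y.
Proof. by rewrite -scaleN1r innerZl mulN1r. Qed.
Lemma innerNr X Y : inner G x X (- Y) = - inner G x X Y.
Proof. by rewrite -scaleN1r innerZr mulN1r. Qed.
Lemma inner0l Y : inner G x 0 Y = 0.
Proof. by rewrite -(scale0r 0) innerZl mul0r. Qed.
Lemma inner0r X : inner G x X 0 = 0.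
Proof. by rewrite -(scale0r 0) innerZr mul0r. Qed.
Lemma inner_suml X Y : inner G x X Y = \sum_j X 0 j * inner G x (delta_mx 0 j) Y.
Proof.
rewrite /inner [in LHS](row_sum_delta X) !mulmx_suml summxE.
by apply: eq_bigr => j _; rewrite -!scalemxAl mxE.
Qed.
Lemma inner_sumr X Y : inner G x X Y = \sum_j Y 0 j * inner G x X (delta_mx 0 j).
Proof.
rewrite /inner [in LHS](row_sum_delta Y) linear_sum/= mulmx_sumr summxE.
by apply: eq_bigr => j _; rewrite linearZ/= -!scalemxAr mxE.
Qed.
Lemma inner_delta i j : inner G x (delta_mx 0 i) (delta_mx 0 j) = G x i j.
Proof.
by rewrite /inner -rowE trmx_delta -colE !mxE.
Qed.
Lemma innerC X Y : (G x)^T = G x -> inner G x X Y = inner G x Y X.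
Proof.
move=> sG; rewrite !innerE exchange_big/=; apply: eq_bigr => i _.
by apply: eq_bigr => j _; rewrite -[in LHS]sG mxE [Y 0 i * _]mulrC.
Qed.

Lemma innerBl X Y Z : inner G x (X - Y) Z = inner G x X Z - inner G x Y Z.
Proof. by rewrite innerDl innerNl. Qed.
Lemma innerBr X Y Z : inner G x X (Y - Z) = inner G x X Y - inner G x X Z.
Proof. by rewrite innerDr innerNr. Qed.

End InnerAlgebra.

Section MinkowskiNorm.
Context {R : realType} {N : nat}.

(** The restriction of a Finsler function to one tangent space. *)
Record minkowski_norm (F : 'rV[R]_N -> R) : Prop := MinkowskiNorm {
  mink_smooth : smooth_on (@slit_space R N) F;
  mink_pos : forall y, y != 0 -> 0 < F y;
  mink_homogeneous : forall c y, 0 < c -> F (c *: y) = c * F y;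
  mink_convex : forall y v, y != 0 -> v != 0 ->
    0 < inner (finsler_metric F) y v v }.

Lemma slit_open : open (@slit_space R N).
Proof.
rewrite (_ : @slit_space R N = ~` [set 0]); last first.
  by apply/seteqP; split => y /eqP.
apply: closed_openC; apply: accessible_closed_set1.
by apply: hausdorff_accessible; exact: norm_hausdorff.
Qed.
Hint Resolve slit_open : core.

Context (F : 'rV[R]_N -> R) (hF : minkowski_norm F).
Let slit := @slit_space R N.
Let g := finsler_metric F.
Let q (y : 'rV[R]_N) : R := F y ^+ 2.
Implicit Types (X Y Z W y : 'rV[R]_N).

Lemma mink_sq_smooth : smooth_on slit (fun y => F y ^+ 2).
Proof. by move=> k; apply: Ck_onM => //; exact: (mink_smooth hF k). Qed.

Lemma finsler_metric_smooth i j : smooth_on slit (fun y => g y i j).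
Proof.
move=> k.
have H : Ck_on k slit (fun y => 2^-1 * partial i (partial j q) y).
  apply: Ck_onZ => //; apply: Ck_on_derive; apply: Ck_on_derive.
  exact: mink_sq_smooth.
by apply: Ck_on_eq H => // y _; rewrite mxE.
Qed.

Lemma smooth_differentiable (V W : normedModType R) (U : set V) (f : V -> W) x :
  smooth_on U f -> U x -> differentiable f x.
Proof. by move=> /(_ 1%N)[+ _]; exact. Qed.

Lemma smooth_derive (V W : normedModType R) (U : set V) (f : V -> W) v :
  smooth_on U f -> smooth_on U (fun x => 'D_v f x).
Proof. by move=> h k; exact: Ck_on_derive. Qed.

Lemma finsler_metric_hess y X Y : y != 0 ->
  inner g y X Y = 2^-1 * 'D_X (fun z => 'D_Y q z) y.
Proof.
move=> y0; have dp j := smooth_differentiable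
  (smooth_derive (delta_mx 0 j) mink_sq_smooth) y0.
rewrite (derive_open_eq (g := fun z => \sum_j Y 0 j * 'D_(delta_mx 0 j) q z)
   _ slit_open y0); last first.
  by move=> z z0; rewrite (derive_coords _ (smooth_differentiable mink_sq_smooth z0)).
have [_ ->] := is_derive_bigsum (fun j => is_derive_cmul (Y 0 j)
  (differentiable_is_derive X (dp j))).
rewrite innerE exchange_big/= mulr_sumr; apply: eq_bigr => j _.
rewrite (derive_coords _ (dp j)) !mulr_sumr; apply: eq_bigr => i _.
rewrite mxE; set a := partial i _ y.
change (X 0 i * Y 0 j * (2^-1 * a) = 2^-1 * (Y 0 j * (X 0 i * a))); ring.
Qed.

Lemma finsler_metric_sym y : y != 0 -> (g y)^T = g y.
Proof.
move=> y0; apply/matrixP => i j; rewrite 3!mxE.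
exact: (congr1 ( *%R 2^-1) (derive_comm _ _ slit_open y0 (mink_sq_smooth 2%N))).
Qed.

Lemma finsler_metricC y X Y : y != 0 -> inner g y X Y = inner g y Y X.
Proof. by move=> y0; exact/innerC/finsler_metric_sym. Qed.

Lemma finsler_metric_unit y : y != 0 -> g y \in unitmx.
Proof.
move=> y0; rewrite -row_free_unit; apply: inj_row_free => v vg.
apply/eqP; apply: contraT => v0.
by have := mink_convex hF y0 v0; rewrite /inner vg mul0mx mxE ltxx.
Qed.

Lemma finsler_metric_ge0 y X : y != 0 -> 0 <= inner g y X X.
Proof.
move=> y0; have [->|X0] := eqVneq X 0; first by rewrite inner0l.
exact/ltW/(mink_convex hF).
Qed.

(** Half the derivative of the metric along e_k. *)
Definition cartan_mx (k : 'I_N) (y : 'rV[R]_N) : 'M[R]_N :=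
  \matrix_(i, j) (2^-1 * partial k (fun z => finsler_metric F z i j) y).

(** The Cartan tensor. Being defined through coordinates, it is linear in each
   argument at every y, even where the metric is not differentiable. *)
Definition cartan y X Y Z : R := \sum_k X 0 k * inner (cartan_mx k) y Y Z.

Lemma cartanDl y X X' Y Z : cartan y (X + X') Y Z = cartan y X Y Z + cartan y X' Y Z.
Proof.
rewrite /cartan -big_split/=; apply: eq_bigr => k _.
by rewrite mxE mulrDl.
Qed.
Lemma cartanZl y c X Y Z : cartan y (c *: X) Y Z = c * cartan y X Y Z.
Proof.
by rewrite /cartan mulr_sumr; apply: eq_bigr => k _; rewrite mxE mulrA.
Qed.
Lemma cartanDm y X Y Y' Z : cartan y X (Y + Y') Z = cartan y X Y Z + cartan y X Y' Z.
Proof.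
by rewrite /cartan -big_split/=; apply: eq_bigr => k _; rewrite innerDl mulrDr.
Qed.
Lemma cartanZm y c X Y Z : cartan y X (c *: Y) Z = c * cartan y X Y Z.
Proof.
by rewrite /cartan mulr_sumr; apply: eq_bigr => k _; rewrite innerZl mulrCA.
Qed.
Lemma cartanDr y X Y Z Z' : cartan y X Y (Z + Z') = cartan y X Y Z + cartan y X Y Z'.
Proof.
by rewrite /cartan -big_split/=; apply: eq_bigr => k _; rewrite innerDr mulrDr.
Qed.
Lemma cartanZr y c X Y Z : cartan y X Y (c *: Z) = c * cartan y X Y Z.
Proof.
by rewrite /cartan mulr_sumr; apply: eq_bigr => k _; rewrite innerZr mulrCA.
Qed.
Lemma cartan_suml y X Y Z :
  cartan y X Y Z = \sum_j X 0 j * cartan y (delta_mx 0 j) Y Z.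
Proof.
apply: eq_bigr => k _; congr (_ * _); rewrite /cartan (bigD1 k)//=.
rewrite mxE !eqxx mul1r big1 ?addr0// => j jk.
by rewrite mxE eqxx (negbTE jk) mul0r.
Qed.
Lemma cartan_summ y X Y Z :
  cartan y X Y Z = \sum_j Y 0 j * cartan y X (delta_mx 0 j) Z.
Proof.
rewrite /cartan; under [in RHS]eq_bigr do rewrite mulr_sumr.
rewrite exchange_big/=; apply: eq_bigr => k _.
by rewrite inner_suml mulr_sumr; apply: eq_bigr => j _; rewrite mulrCA.
Qed.
Lemma cartan_sumr y X Y Z :
  cartan y X Y Z = \sum_j Z 0 j * cartan y X Y (delta_mx 0 j).
Proof.
rewrite /cartan; under [in RHS]eq_bigr do rewrite mulr_sumr.
rewrite exchange_big/=; apply: eq_bigr => k _.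
by rewrite inner_sumr mulr_sumr; apply: eq_bigr => j _; rewrite mulrCA.
Qed.

Lemma inner_metric_smooth X Y : smooth_on slit (fun z => inner g z X Y).
Proof.
move=> k.
have H : Ck_on k slit (fun z => \sum_i \sum_j X 0 i * Y 0 j * g z i j).
  apply: Ck_on_sum => // i; apply: Ck_on_sum => // j; apply: Ck_onZ => //.
  exact: finsler_metric_smooth.
by apply: Ck_on_eq H => // z _; rewrite innerE.
Qed.

Lemma cartanE y X Y Z : y != 0 ->
  cartan y X Y Z = 2^-1 * 'D_X (fun z => inner g z Y Z) y.
Proof.
move=> y0.
rewrite (derive_coords _ (smooth_differentiable (inner_metric_smooth Y Z) y0)).
rewrite mulr_sumr; apply: eq_bigr => k _.
rewrite [_ *: _]/(_ * _) mulrCA; congr (_ * _).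
rewrite (derive_open_eq (g := fun z => \sum_i \sum_j Y 0 i * Z 0 j * g z i j)
   _ slit_open y0); last by move=> z _; rewrite innerE.
have dg i j := smooth_differentiable (finsler_metric_smooth i j) y0.
have [_ ->] := is_derive_bigsum (fun i => is_derive_bigsum (fun j =>
  is_derive_cmul (Y 0 i * Z 0 j)
    (differentiable_is_derive (delta_mx 0 k) (dg i j)))).
rewrite innerE mulr_sumr; apply: eq_bigr => i _.
rewrite mulr_sumr; apply: eq_bigr => j _.
by rewrite mxE mulrCA.
Qed.

Lemma cartanCr y X Y Z : y != 0 -> cartan y X Y Z = cartan y X Z Y.
Proof.
move=> y0; rewrite !cartanE//; apply: (congr1 ( *%R 2^-1)).
by apply: (derive_open_eq _ slit_open y0) => z z0; rewrite finsler_metricC.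
Qed.

(** The metric is a Hessian, so this is an exchange of second derivatives. *)
Lemma cartanCl y X Y Z : y != 0 -> cartan y X Y Z = cartan y Y X Z.
Proof.
move=> y0; rewrite !cartanE//; apply: (congr1 ( *%R 2^-1)).
have e A B C : 'D_A (fun z => inner g z B C) y =
    2^-1 * 'D_A (fun z => 'D_B (fun w => 'D_C q w) z) y.
  rewrite (derive_open_eq (g := fun z => 2^-1 * 'D_B (fun w => 'D_C q w) z)
     _ slit_open y0); last by move=> z z0; exact: finsler_metric_hess.
  have d := smooth_differentiable
    (smooth_derive B (smooth_derive C mink_sq_smooth)) y0.
  by have [_ ->//] := is_derive_cmul 2^-1 (differentiable_is_derive A d).
rewrite !e; apply: (congr1 ( *%R 2^-1)).
exact: (derive_comm _ _ slit_open y0 (smooth_derive Z mink_sq_smooth 2%N)).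
Qed.

Lemma cartan_smooth X Y Z : smooth_on slit (fun z => cartan z X Y Z).
Proof.
move=> k.
have H : Ck_on k slit (fun z => 2^-1 * 'D_X (fun w => inner g w Y Z) z).
  by apply: Ck_onZ => //; exact/smooth_derive/inner_metric_smooth.
by apply: Ck_on_eq H => // z z0; rewrite cartanE.
Qed.

Definition dcartan y W X Y Z : R := 'D_W (fun z => cartan z X Y Z) y.

Lemma dcartanCl y W X Y Z : y != 0 -> dcartan y W X Y Z = dcartan y X W Y Z.
Proof.
move=> y0.
have e A B : dcartan y A B Y Z =
    2^-1 * 'D_A (fun z => 'D_B (fun w => inner g w Y Z) z) y.
  rewrite /dcartan (derive_open_eq (g := fun z => 2^-1 *
    'D_B (fun w => inner g w Y Z) z) _ slit_open y0); last first.
    by move=> z z0; exact: cartanE.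
  have d := smooth_differentiable (smooth_derive B (inner_metric_smooth Y Z)) y0.
  by have [_ ->//] := is_derive_cmul 2^-1 (differentiable_is_derive A d).
rewrite !e; apply: (congr1 ( *%R 2^-1)).
exact: (derive_comm _ _ slit_open y0 (inner_metric_smooth Y Z 2%N)).
Qed.

End MinkowskiNorm.

Section MinkowskiCalculus.
Context {R : realType} {N : nat} (F : 'rV[R]_N -> R) (hF : minkowski_norm F).
Let slit := @slit_space R N.
Let g := finsler_metric F.
Let T := cartan F.
Let q (y : 'rV[R]_N) : R := F y ^+ 2.
Implicit Types (X Y Z W y : 'rV[R]_N).

(** Leibniz rule for g_u(X, Y), where the point u and the vectors X, Y move. *)
Lemma is_derive_metric_field (V : normedModType R) (u X Y : V -> 'rV[R]_N)
    (v a : V) dX dY :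
  differentiable u v -> u v != 0 ->
  is_derive v a X dX -> is_derive v a Y dY ->
  is_derive v a (fun w => inner g (u w) (X w) (Y w))
    (2 * T (u v) ('D_a u v) (X v) (Y v)
     + inner g (u v) dX (Y v) + inner g (u v) (X v) dY).
Proof.
move=> du u0 hX hY.
have step0 c d : is_derive v a (fun w => inner g (u w) c d)
    (2 * T (u v) ('D_a u v) c d).
  apply: (is_derive_eq (is_derive_comp a
    (smooth_differentiable (inner_metric_smooth hF c d) u0) du)).
  by rewrite /T (cartanE hF)// mulVKf.
have step1 d : is_derive v a (fun w => inner g (u w) (X w) d)
    (2 * T (u v) ('D_a u v) (X v) d + inner g (u v) dX d).
  apply: (is_derive_slot (Psi := fun c w => inner g (u w) c d)
    (dPsi := fun c => 2 * T (u v) ('D_a u v) c d)) => //.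
  - by move=> c w; exact: inner_suml.
  - move=> c; rewrite /T cartan_summ mulr_sumr; apply: eq_bigr => j _.
    by rewrite mulrCA.
apply: (is_derive_slot (Psi := fun c w => inner g (u w) (X w) c)
  (dPsi := fun c => 2 * T (u v) ('D_a u v) (X v) c + inner g (u v) dX c)) => //.
- by move=> c w; exact: inner_sumr.
- move=> c; rewrite /T cartan_sumr inner_sumr mulr_sumr -big_split/=.
  by apply: eq_bigr => j _; rewrite mulrCA -mulrDr.
Qed.

Lemma is_derive_cartan_const X Y Z y W : y != 0 ->
  is_derive y W (fun z => T z X Y Z) (dcartan F y W X Y Z).
Proof.
move=> y0; apply: differentiable_is_derive.
exact: smooth_differentiable (cartan_smooth hF X Y Z) y0.
Qed.

Lemma dcartan_suml y W X Y Z : y != 0 ->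
  dcartan F y W X Y Z = \sum_j X 0 j * dcartan F y W (delta_mx 0 j) Y Z.
Proof.
move=> y0; rewrite /dcartan.
rewrite (derive_open_eq (g := fun z => \sum_j X 0 j * T z (delta_mx 0 j) Y Z)
  _ (@slit_open R N) y0); last by move=> z _; exact: cartan_suml.
by have [_ ->] := is_derive_bigsum (fun j => is_derive_cmul (X 0 j)
  (is_derive_cartan_const (delta_mx 0 j) Y Z W y0)).
Qed.

Lemma dcartan_summ y W X Y Z : y != 0 ->
  dcartan F y W X Y Z = \sum_j Y 0 j * dcartan F y W X (delta_mx 0 j) Z.
Proof.
move=> y0; rewrite /dcartan.
rewrite (derive_open_eq (g := fun z => \sum_j Y 0 j * T z X (delta_mx 0 j) Z)
  _ (@slit_open R N) y0); last by move=> z _; exact: cartan_summ.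
by have [_ ->] := is_derive_bigsum (fun j => is_derive_cmul (Y 0 j)
  (is_derive_cartan_const X (delta_mx 0 j) Z W y0)).
Qed.

Lemma dcartan_sumr y W X Y Z : y != 0 ->
  dcartan F y W X Y Z = \sum_j Z 0 j * dcartan F y W X Y (delta_mx 0 j).
Proof.
move=> y0; rewrite /dcartan.
rewrite (derive_open_eq (g := fun z => \sum_j Z 0 j * T z X Y (delta_mx 0 j))
  _ (@slit_open R N) y0); last by move=> z _; exact: cartan_sumr.
by have [_ ->] := is_derive_bigsum (fun j => is_derive_cmul (Z 0 j)
  (is_derive_cartan_const X Y (delta_mx 0 j) W y0)).
Qed.

Lemma is_derive_cartan_field (V : normedModType R) (u X Y Z : V -> 'rV[R]_N)
    (v a : V) dX dY dZ :
  differentiable u v -> u v != 0 ->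
  is_derive v a X dX -> is_derive v a Y dY -> is_derive v a Z dZ ->
  is_derive v a (fun w => T (u w) (X w) (Y w) (Z w))
    (dcartan F (u v) ('D_a u v) (X v) (Y v) (Z v)
     + T (u v) dX (Y v) (Z v) + T (u v) (X v) dY (Z v)
     + T (u v) (X v) (Y v) dZ).
Proof.
move=> du u0 hX hY hZ.
have step0 c d e : is_derive v a (fun w => T (u w) c d e)
    (dcartan F (u v) ('D_a u v) c d e).
  exact: (is_derive_comp a
    (smooth_differentiable (cartan_smooth hF c d e) u0) du).
have step1 d e : is_derive v a (fun w => T (u w) (X w) d e)
    (dcartan F (u v) ('D_a u v) (X v) d e + T (u v) dX d e).
  apply: (is_derive_slot (Psi := fun c w => T (u w) c d e)
    (dPsi := fun c => dcartan F (u v) ('D_a u v) c d e)) => //.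
  - by move=> c w; exact: cartan_suml.
  - by move=> c; exact: dcartan_suml.
have step2 e : is_derive v a (fun w => T (u w) (X w) (Y w) e)
    (dcartan F (u v) ('D_a u v) (X v) (Y v) e + T (u v) dX (Y v) e
     + T (u v) (X v) dY e).
  apply: (is_derive_slot (Psi := fun c w => T (u w) (X w) c e)
    (dPsi := fun c => dcartan F (u v) ('D_a u v) (X v) c e
                      + T (u v) dX c e)) => //.
  - by move=> c w; exact: cartan_summ.
  - move=> c; rewrite dcartan_summ// /T cartan_summ -big_split/=.
    by apply: eq_bigr => j _; rewrite -mulrDr.
apply: (is_derive_slot (Psi := fun c w => T (u w) (X w) (Y w) c)
  (dPsi := fun c => dcartan F (u v) ('D_a u v) (X v) (Y v) c
     + T (u v) dX (Y v) c + T (u v) (X v) dY c)) => //.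
- by move=> c w; exact: cartan_sumr.
- move=> c; rewrite dcartan_sumr// /T.
  rewrite [cartan F _ dX _ _]cartan_sumr [cartan F _ _ dY _]cartan_sumr.
  by rewrite -!big_split/=; apply: eq_bigr => j _; rewrite -!mulrDr.
Qed.

(** Chain rule for f o (t *: _); it lowers the degree of homogeneity by one. *)
Lemma derive_homothety (f : 'rV[R]_N -> R) (t c : R) y X :
  (forall z, z != 0 -> differentiable f z) -> t != 0 ->
  (forall z, z != 0 -> f (t *: z) = c * f z) -> y != 0 ->
  t * 'D_X f (t *: y) = c * 'D_X f y.
Proof.
move=> df t0 fc y0.
have ty0 : t *: y != 0 by rewrite scaler_eq0 negb_or t0.
have dt : is_derive y X (fun z => t *: z) (t *: X) by exact: is_deriveZ.
have dift : differentiable (fun z : 'rV[R]_N => t *: z) y.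
  exact: differentiableZ.
have [_ e1] := is_derive_comp X (df _ ty0) dift.
have [_ dte] := dt; rewrite dte deriveZl in e1; last exact: df.
rewrite -[LHS]e1 (derive_open_eq (g := fun z => c * f z) _ (@slit_open R N) y0)//.
by have [_ ->] := is_derive_cmul c (differentiable_is_derive X (df _ y0)).
Qed.

(** The radial derivative of f is the derivative of s |-> f (s y) at s = 1. *)
Lemma derive_euler (f : 'rV[R]_N -> R) (phi : R -> R) (dphi : R) y :
  differentiable f y ->
  (forall s, 0 < s -> f (s *: y) = phi s * f y) ->
  is_derive (1 : R) (1 : R) phi dphi -> 'D_y f y = dphi * f y.
Proof.
move=> df fphi hphi.
have := @is_derive_line _ _ _ f y 0 1.
rewrite scale1r addr0 => /(_ df)[_ <-].
rewrite (near_eq_derive (g := fun s => phi s * f y)).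
  by have [_ ->] := is_derive_mulc (f y) hphi.
near=> s; rewrite addr0; apply: fphi; near: s; exact: lt_nbhsr.
Unshelve. all: by end_near. Qed.

Lemma mink_sq_diff y : y != 0 -> differentiable q y.
Proof. by move=> y0; exact: smooth_differentiable (mink_sq_smooth hF) y0. Qed.

Lemma mink_sq_derive_diff X y : y != 0 -> differentiable (fun z => 'D_X q z) y.
Proof.
by move=> y0; exact: smooth_differentiable (smooth_derive X (mink_sq_smooth hF)) y0.
Qed.

Lemma inner_metric_diff X Y y : y != 0 -> differentiable (fun z => inner g z X Y) y.
Proof.
by move=> y0; exact: smooth_differentiable (inner_metric_smooth hF X Y) y0.
Qed.

Lemma derive_sq_scale t y X : 0 < t -> y != 0 ->
  'D_X q (t *: y) = t * 'D_X q y.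
Proof.
move=> t0 y0; apply: (mulfI (lt0r_neq0 t0)).
rewrite (derive_homothety (c := t ^+ 2) X mink_sq_diff (lt0r_neq0 t0))//.
  by rewrite mulrA.
by move=> z z0; rewrite /q (mink_homogeneous hF)// exprMn.
Qed.

Lemma metric_scale t y X Y : 0 < t -> y != 0 ->
  inner g (t *: y) X Y = inner g y X Y.
Proof.
move=> t0 y0.
have ty0 : t *: y != 0 by rewrite scaler_eq0 negb_or lt0r_neq0.
rewrite (finsler_metric_hess hF X Y ty0) (finsler_metric_hess hF X Y y0).
apply: (congr1 ( *%R 2^-1)).
apply: (mulfI (lt0r_neq0 t0)).
apply: (derive_homothety (c := t) X (mink_sq_derive_diff Y) (lt0r_neq0 t0)) => //.
by move=> z z0; exact: derive_sq_scale.
Qed.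

Lemma metric_scale_mx t y : 0 < t -> y != 0 -> g (t *: y) = g y.
Proof.
move=> t0 y0; apply/matrixP => i j.
have := metric_scale (delta_mx 0 i) (delta_mx 0 j) t0 y0.
by rewrite !inner_delta.
Qed.

Lemma cartan_scale t y X Y Z : 0 < t -> y != 0 ->
  t * T (t *: y) X Y Z = T y X Y Z.
Proof.
move=> t0 y0.
have ty0 : t *: y != 0 by rewrite scaler_eq0 negb_or lt0r_neq0.
rewrite /T !(cartanE hF)// mulrCA; apply: (congr1 ( *%R 2^-1)).
rewrite (derive_homothety (c := 1) X (inner_metric_diff Y Z) (lt0r_neq0 t0))//.
  by rewrite mul1r.
by move=> z z0; rewrite mul1r; exact: metric_scale.
Qed.

(** The metric is homogeneous of degree 0, hence constant along rays. *)
Lemma cartan_radial y X Y : y != 0 -> T y y X Y = 0.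
Proof.
move=> y0; rewrite /T (cartanE hF)//.
rewrite (derive_euler (phi := fun=> 1) (dphi := 0) (inner_metric_diff X Y y0)).
- by rewrite mul0r mulr0.
- by move=> s s0; rewrite mul1r; exact: metric_scale.
Qed.

Lemma metric_radial y X : y != 0 -> 'D_X q y = 2 * inner g y y X.
Proof.
move=> y0; rewrite (finsler_metric_hess hF)// mulVKf//.
rewrite (derive_euler (phi := id) (dphi := 1) (mink_sq_derive_diff X y0)).
- by rewrite mul1r.
- by move=> s s0; exact: derive_sq_scale.
Qed.

Lemma metric_radial_radial y : y != 0 -> inner g y y y = F y ^+ 2.
Proof.
move=> y0; apply: (mulfI (_ : 2 != 0 :> R)) => //.
rewrite -metric_radial//.
have hsq : is_derive (1 : R) (1 : R) (fun s : R => s ^+ 2) 2.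
  have h := is_derive_mul (is_derive_id (1 : R) (1 : R)) (is_derive_id (1 : R) (1 : R)).
  by apply: (is_derive_eq h); rewrite !mulr1.
rewrite (derive_euler (phi := fun s => s ^+ 2) (dphi := 2) (mink_sq_diff y0))//.
by move=> s s0; rewrite /q (mink_homogeneous hF)// exprMn.
Qed.

Lemma cometricC y (al be : 'rV[R]_N) : y != 0 ->
  cometric g y al be = cometric g y be al.
Proof.
move=> y0; apply: innerC; rewrite trmx_inv.
by rewrite (finsler_metric_sym hF).
Qed.

Lemma cometric_flat y (al v : 'rV[R]_N) : y != 0 ->
  cometric g y al (v *m g y) = \sum_j v 0 j * al 0 j.
Proof.
move=> y0; rewrite /cometric /inner trmx_mul (finsler_metric_sym hF)//.
rewrite mulmxA mulmxKV ?(finsler_metric_unit hF)// mxE.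
by apply: eq_bigr => j _; rewrite mxE mulrC.
Qed.

(** The covector T(X, Y, .). *)
Definition cartan_row y X Y : 'rV[R]_N := \row_j T y X Y (delta_mx 0 j).

Lemma cometric_cartan_flat y X Y v : y != 0 ->
  cometric g y (cartan_row y X Y) (v *m g y) = T y X Y v.
Proof.
move=> y0; rewrite cometric_flat// /T [RHS]cartan_sumr.
by apply: eq_bigr => j _; rewrite mxE.
Qed.

(** For the inverse metric, a covector T(X, Y, .) pairs with g(W, .) to
   T(X, Y, W), and g(W, .) pairs with g(W', .) to g(W, W'). *)
Lemma cometric_cartan_shift y X Y X' Y' W W' : y != 0 ->
  cometric g y (cartan_row y X Y + W *m g y) (cartan_row y X' Y' + W' *m g y) =
  cometric g y (cartan_row y X Y) (cartan_row y X' Y')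
  + T y X Y W' + T y X' Y' W + inner g y W W'.
Proof.
move=> y0; rewrite /cometric innerDl !innerDr -!/(cometric _ _ _ _).
rewrite cometric_cartan_flat// [cometric _ _ (W *m _) (cartan_row _ _ _)]cometricC//.
rewrite cometric_cartan_flat//.
have -> : cometric g y (W *m g y) (W' *m g y) = inner g y W W'.
  rewrite cometric_flat// inner_sumr; apply: eq_bigr => j _.
  by rewrite /inner trmx_delta -colE !mxE.
by rewrite !addrA.
Qed.

Lemma cartan_rowC y X Y : y != 0 -> cartan_row y X Y = cartan_row y Y X.
Proof.
by move=> y0; apply/rowP => j; rewrite !mxE; exact: (cartanCl hF).
Qed.

Lemma cartan_rowDl y X X' Y :
  cartan_row y (X + X') Y = cartan_row y X Y + cartan_row y X' Y.
Proof. by apply/rowP => j; rewrite !mxE; exact: cartanDl. Qed.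

Lemma cartan_rowZl y c X Y : cartan_row y (c *: X) Y = c *: cartan_row y X Y.
Proof. by apply/rowP => j; rewrite !mxE; exact: cartanZl. Qed.

Lemma cartan_row_radial y X : y != 0 -> cartan_row y y X = 0.
Proof. by move=> y0; apply/rowP => j; rewrite !mxE; exact: cartan_radial. Qed.

(** The curvature of the Hessian metric g, fully covariant and with the
   arguments in the order of [lowered_curvature]. The Levi-Civita connection
   differs from the flat one by T, and the terms linear in derivatives of T cancel
   because dT is totally symmetric; what is left is the commutator of T with
   itself. *)
Definition cartan_curv y X Y Z W : R :=
  cometric g y (cartan_row y X Z) (cartan_row y Y W)
  - cometric g y (cartan_row y Y Z) (cartan_row y X W).

Lemma cartan_curvDl y X X' Y Z W : cartan_curv y (X + X') Y Z W =
  cartan_curv y X Y Z W + cartan_curv y X' Y Z W.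
Proof.
by rewrite /cartan_curv !cartan_rowDl /cometric innerDl innerDr; ring.
Qed.

Lemma cartan_curvZl y c X Y Z W : cartan_curv y (c *: X) Y Z W =
  c * cartan_curv y X Y Z W.
Proof.
by rewrite /cartan_curv !cartan_rowZl /cometric innerZl innerZr; ring.
Qed.

Lemma cartan_curv_antil y X Y Z W : cartan_curv y Y X Z W = - cartan_curv y X Y Z W.
Proof. by rewrite /cartan_curv opprB. Qed.

Lemma cartan_curv_pair y X Y Z W : y != 0 ->
  cartan_curv y Z W X Y = cartan_curv y X Y Z W.
Proof.
move=> y0; rewrite /cartan_curv [in LHS](cartan_rowC Z X)//.
by rewrite (cartan_rowC W Y)// (cartan_rowC W X)// (cartan_rowC Z Y)//
  [X in _ - X = _]cometricC.
Qed.

Lemma cartan_curv_bianchi y X Y Z W : y != 0 ->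
  cartan_curv y X Y Z W + cartan_curv y Y Z X W + cartan_curv y Z X Y W = 0.
Proof.
move=> y0; rewrite /cartan_curv (cartan_rowC Y X)// (cartan_rowC Z X)//.
by rewrite (cartan_rowC Z Y)//; ring.
Qed.

(** The metric of a cone is flat in the radial direction. *)
Lemma cartan_curv_radial y Y Z W : y != 0 -> cartan_curv y y Y Z W = 0.
Proof.
move=> y0; rewrite /cartan_curv !cartan_row_radial// /cometric.
by rewrite inner0l inner0r subrr.
Qed.

Lemma cartan_curv_scale t y X Y Z W : 0 < t -> y != 0 ->
  t ^+ 2 * cartan_curv (t *: y) X Y Z W = cartan_curv y X Y Z W.
Proof.
move=> t0 y0.
have e A B : t *: cartan_row (t *: y) A B = cartan_row y A B.
  apply/rowP => j; rewrite [LHS]mxE [X in _ * X]mxE [RHS]mxE.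
  exact: (cartan_scale A B (delta_mx 0 j) t0 y0).
have ec al be : cometric g (t *: y) al be = cometric g y al be.
  by rewrite /cometric /inner metric_scale_mx.
rewrite /cartan_curv -!e !ec /cometric !innerZl !innerZr.
move: (inner _ _ _ (cartan_row _ Y W)) (inner _ _ _ (cartan_row _ X W)) => a b.
ring.
Qed.

End MinkowskiCalculus.

(** * Orthogonal frames and quadrilinear forms *)

Section FrameCompleteness.
Context {K : fieldType} {m N : nat}.

(** The vector u and the rows of J together form a basis, and the right-hand
   side inverts g on each of its vectors. The inverse metric thus splits into its
   normal and its tangential part along a hypersurface with tangent frame J and
   unit normal u. *)
Lemma invmx_orthogonal_frame (g : 'M[K]_N) (u : 'rV[K]_N) (J : 'M[K]_(m, N)) :
  (m.+1 = N)%N -> g \in unitmx -> g^T = g ->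
  u *m g *m u^T = 1%:M -> u *m g *m J^T = 0 ->
  J *m g *m J^T \in unitmx ->
  invmx g = u^T *m u + J^T *m invmx (J *m g *m J^T) *m J.
Proof.
move=> mN ug sg uu uJ uh; set h := J *m g *m J^T in uh *.
have Ju : J *m g *m u^T = 0.
  by have := congr1 trmx uJ; rewrite !trmx_mul trmxK sg trmx0 mulmxA.
pose P := col_mx u J.
have PD : P *m row_mx (g *m u^T) (g *m J^T *m invmx h) = 1%:M.
  rewrite mul_col_row !mulmxA uu uJ Ju mul0mx mulmxV//.
  by rewrite -scalar_mx_block.
have fP : row_full P.
  have /eqP rP : row_free P.
    by apply/row_freeP; exists (row_mx (g *m u^T) (g *m J^T *m invmx h)).
  by rewrite /row_full rP add1n mN.
set E := (X in _ = X).
have gE : g *m E = 1%:M.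
  apply: (row_full_inj fP); rewrite mulmx1 /P mul_col_mx /E !mulmxDr !mulmxA.
  by rewrite uu uJ Ju !mul0mx addr0 add0r mulmxV// !mul1mx.
by rewrite -[RHS](mulKmx ug) gE mulmx1.
Qed.

End FrameCompleteness.

Section VectorSchwarz.
Context {R : realType} {V : normedModType R} {n : nat}.

Lemma derive_comm_row (U : set V) (u : V -> 'rV[R]_n) x v w :
  open U -> U x -> smooth_on U u ->
  'D_v (fun z => 'D_w u z) x = 'D_w (fun z => 'D_v u z) x.
Proof.
move=> oU Ux Su; apply/rowP => j.
have e a b : ('D_a (fun z => 'D_b u z) x) 0 j =
    'D_a (fun z => 'D_b (fun y => u y 0 j) z) x.
  have d := smooth_differentiable (smooth_derive b Su) Ux.
  have [_ <-] := is_derive_coord 0 j (differentiable_is_derive a d).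
  apply: (derive_open_eq _ oU Ux) => z Uz.
  by have [_ ->] := is_derive_coord 0 j
    (differentiable_is_derive b (smooth_differentiable Su Uz)).
have C2 := Ck_on_coord 0 j oU (Su 2%N).
have H := derive_comm v w oU Ux C2.

exact: (etrans (e v w) (etrans H (esym (e w v)))).
Qed.

End VectorSchwarz.

Section MultilinearForms.
Context {R : realType} {n : nat}.

Definition additive_homogeneous (f : 'rV[R]_n -> R) : Prop :=
  (forall X Y, f (X + Y) = f X + f Y) /\ (forall c X, f (c *: X) = c * f X).

Lemma additive_homogeneous_sum (f : 'rV[R]_n -> R) (I : finType)
    (c : I -> R) (X : I -> 'rV[R]_n) : additive_homogeneous f ->
  f (\sum_i c i *: X i) = \sum_i c i * f (X i).
Proof.
move=> [fD fZ]; have f0 : f 0 = 0 by rewrite -(scale0r 0) fZ mul0r.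
by rewrite (big_morph f fD f0); apply: eq_bigr => i _; rewrite fZ.
Qed.

Lemma additive_homogeneous_mulmx m (f : 'rV[R]_n -> R) (J : 'M[R]_(m, n)) X :
  additive_homogeneous f -> f (X *m J) = \sum_a X 0 a * f (row a J).
Proof. by move=> hf; rewrite mulmx_sum_row additive_homogeneous_sum. Qed.

Lemma additive_homogeneous_eq (f1 f2 : 'rV[R]_n -> R) :
  additive_homogeneous f1 -> additive_homogeneous f2 ->
  (forall j, f1 (delta_mx 0 j) = f2 (delta_mx 0 j)) -> forall X, f1 X = f2 X.
Proof.
move=> h1 h2 f12 X; rewrite (row_sum_delta X) !additive_homogeneous_sum//.
by apply: eq_bigr => j _; rewrite f12.
Qed.

Definition quadrilinear (f : 'rV[R]_n -> 'rV[R]_n -> 'rV[R]_n -> 'rV[R]_n -> R)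
  : Prop :=
  [/\ forall Y Z W, additive_homogeneous (fun X => f X Y Z W),
      forall X Z W, additive_homogeneous (fun Y => f X Y Z W),
      forall X Y W, additive_homogeneous (fun Z => f X Y Z W) &
      forall X Y Z, additive_homogeneous (f X Y Z)].

(** The value on combinations of the rows of J. *)
Lemma quadrilinear_mulmx m f (J : 'M[R]_(m, n)) X Y Z W : quadrilinear f ->
  f (X *m J) (Y *m J) (Z *m J) (W *m J) =
  \sum_i \sum_j \sum_k \sum_l X 0 i * Y 0 j * Z 0 k * W 0 l *
    f (row i J) (row j J) (row k J) (row l J).
Proof.
move=> [h1 h2 h3 h4].
rewrite (additive_homogeneous_mulmx J X (h1 _ _ _)); apply: eq_bigr => i _.
rewrite (additive_homogeneous_mulmx J Y (h2 _ _ _)) mulr_sumr.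
apply: eq_bigr => j _.
rewrite (additive_homogeneous_mulmx J Z (h3 _ _ _)) !mulr_sumr.
apply: eq_bigr => k _.
rewrite (additive_homogeneous_mulmx J W (h4 _ _ _)) !mulr_sumr.
by apply: eq_bigr => l _; rewrite !mulrA.
Qed.

Lemma quadrilinear_eq f1 f2 : quadrilinear f1 -> quadrilinear f2 ->
  (forall i j k l,
     f1 (delta_mx 0 i) (delta_mx 0 j) (delta_mx 0 k) (delta_mx 0 l) =
     f2 (delta_mx 0 i) (delta_mx 0 j) (delta_mx 0 k) (delta_mx 0 l)) ->
  forall X Y Z W, f1 X Y Z W = f2 X Y Z W.
Proof.
move=> [a1 a2 a3 a4] [b1 b2 b3 b4] e X Y Z W.
apply: (additive_homogeneous_eq (a1 Y Z W) (b1 Y Z W)) => i.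
apply: (additive_homogeneous_eq (a2 _ Z W) (b2 _ Z W)) => j.
apply: (additive_homogeneous_eq (a3 _ _ W) (b3 _ _ W)) => k.
exact: (additive_homogeneous_eq (a4 _ _ _) (b4 _ _ _)).
Qed.

(** The curvature tensor of a space of constant curvature 1 with metric B. *)
Definition metric_curv (B : 'rV[R]_n -> 'rV[R]_n -> R) X Y Z W : R :=
  B Y Z * B X W - B X Z * B Y W.

Lemma quadrilinear_metric_curv (G : 'rV[R]_n -> 'M[R]_n) x :
  quadrilinear (metric_curv (inner G x)).
Proof.
by split=> A B C; split=> [X Y|c X]; rewrite /metric_curv
  ?(innerDl, innerDr, innerZl, innerZr); ring.
Qed.

Lemma quadrilinearD f1 f2 : quadrilinear f1 -> quadrilinear f2 ->
  quadrilinear (fun X Y Z W => f1 X Y Z W + f2 X Y Z W).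
Proof.
move=> [a1 a2 a3 a4] [b1 b2 b3 b4].
split=> A B C; split=> [X Y|c X].
- by have [-> _] := a1 A B C; have [-> _] := b1 A B C; ring.
- by have [_ ->] := a1 A B C; have [_ ->] := b1 A B C; ring.
- by have [-> _] := a2 A B C; have [-> _] := b2 A B C; ring.
- by have [_ ->] := a2 A B C; have [_ ->] := b2 A B C; ring.
- by have [-> _] := a3 A B C; have [-> _] := b3 A B C; ring.
- by have [_ ->] := a3 A B C; have [_ ->] := b3 A B C; ring.
- by have [-> _] := a4 A B C; have [-> _] := b4 A B C; ring.
- by have [_ ->] := a4 A B C; have [_ ->] := b4 A B C; ring.
Qed.

Lemma quadrilinearZ (c : R) f : quadrilinear f ->
  quadrilinear (fun X Y Z W => c * f X Y Z W).
Proof.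
move=> [a1 a2 a3 a4].
split=> A B C; split=> [X Y|d X].
- by have [-> _] := a1 A B C; ring.
- by have [_ ->] := a1 A B C; ring.
- by have [-> _] := a2 A B C; ring.
- by have [_ ->] := a2 A B C; ring.
- by have [-> _] := a3 A B C; ring.
- by have [_ ->] := a3 A B C; ring.
- by have [-> _] := a4 A B C; ring.
- by have [_ ->] := a4 A B C; ring.
Qed.

End MultilinearForms.

Lemma quadrilinear_cartan_curv (R : realType) N (F : 'rV[R]_N -> R) y :
  minkowski_norm F -> y != 0 -> quadrilinear (cartan_curv F y).
Proof.
move=> hF y0.
have a1 A B C : additive_homogeneous (fun X => cartan_curv F y X A B C).
  by split=> [X Y|c X]; [exact: cartan_curvDl|exact: cartan_curvZl].
have a2 A B C : additive_homogeneous (fun X => cartan_curv F y A X B C).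
  split=> [X Y|c X].
    rewrite cartan_curv_antil cartan_curvDl (cartan_curv_antil _ _ A X).
    by rewrite (cartan_curv_antil _ _ A Y) opprD !opprK.
  by rewrite cartan_curv_antil cartan_curvZl (cartan_curv_antil _ _ A X) mulrN opprK.
have p A B C D := cartan_curv_pair hF A B C D y0.
split; [exact: a1|exact: a2| |] => A B C; split=> [X Y|c X].
- by have [+ _] := a1 C A B => /(_ X Y); rewrite !(p A B).
- by have [_ +] := a1 C A B => /(_ c X); rewrite !(p A B).
- by have [+ _] := a2 C A B => /(_ X Y); rewrite !(p A B).
- by have [_ +] := a2 C A B => /(_ c X); rewrite !(p A B).
Qed.

(** * The Gauss equation of the indicatrix *)

Section RadialProjection.
Context {R : realType} {N : nat} (F : 'rV[R]_N -> R) (hF : minkowski_norm F).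

(** Homogeneity under y |-> 2 y forces F to vanish at the origin. *)
Lemma indicatrix_neq0 y : F y = 1 -> y != 0.
Proof.
move=> Fy; apply/eqP => y0; move: Fy; rewrite {}y0 => F0.
have := mink_homogeneous hF 0 (ltr0n R 2 : 0 < 2%:R).
rewrite scaler0 F0 => e; lra.
Qed.

Lemma radial_projection_smooth (V : normedModType R) (U : set V)
    (w : V -> 'rV[R]_N) : open U -> (forall x, U x -> w x != 0) ->
  smooth_on U w -> smooth_on U (fun x => (F (w x))^-1 *: w x).
Proof.
move=> oU w0 Sw k; apply: Ck_on_row => // j.
have h : Ck_on k U (fun x => (F (w x))^-1 * w x 0 j).
  apply: (Ck_onM oU _ (Ck_on_coord 0 j oU (Sw k))).
  apply: Ck_onV => //.
    by move=> x Ux; rewrite gt_eqF// (mink_pos hF)// w0.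
  exact: (Ck_on_comp oU (@slit_open R N) w0 (mink_smooth hF k) (Sw k)).
by apply: Ck_on_eq h => // x _; rewrite mxE.
Qed.

Lemma radial_projection_indicatrix y : y != 0 -> F ((F y)^-1 *: y) = 1.
Proof.
move=> y0; have Fy := mink_pos hF y0.
by rewrite (mink_homogeneous hF) ?invr_gt0// mulVf// gt_eqF.
Qed.

(** F^2 is constant along u, and its derivative is 2 g(u, .). *)
Lemma indicatrix_tangent (V : normedModType R) (U : set V) (u : V -> 'rV[R]_N) x v :
  open U -> U x -> differentiable u x -> (forall x, U x -> F (u x) = 1) ->
  inner (finsler_metric F) (u x) (u x) ('D_v u x) = 0.
Proof.
move=> oU Ux du u1; have u0 : u x != 0 by apply: indicatrix_neq0; exact: u1.
apply: (mulfI (_ : 2 != 0 :> R)) => //.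
rewrite mulr0 -(metric_radial hF)//.
have [_ <-] := is_derive_comp v (mink_sq_diff hF u0) du.
rewrite (derive_open_eq (g := fun=> (1 : R)) _ oU Ux) ?derive_cst// => w Uw.
by rewrite u1// expr1n.
Qed.

End RadialProjection.

Lemma mulmx_tr_row (K : pzSemiRingType) m n (A : 'rV[K]_n) (J : 'M[K]_(m, n)) j :
  (A *m J^T) 0 j = (A *m (row j J)^T) 0 0.
Proof. by rewrite tr_row colE mulmxA -colE [RHS]mxE. Qed.

Section GaussEquation.
Context {R : realType} {N m : nat} (F : 'rV[R]_N -> R) (hF : minkowski_norm F).
Context (mN : (m.+1 = N)%N) (V : set 'rV[R]_m) (u : 'rV[R]_m -> 'rV[R]_N).
Context (pu : local_parametrization (indicatrix F) V u).
Let g := finsler_metric F.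
Let T := cartan F.
Let h := induced_metric g u.
(* The derivatives of u are kept abstract, so that comparing two of them does
   not unfold limits. *)
Context (X : 'I_m -> 'rV[R]_m -> 'rV[R]_N)
  (XX : 'I_m -> 'I_m -> 'rV[R]_m -> 'rV[R]_N)
  (XXX : 'I_m -> 'I_m -> 'I_m -> 'rV[R]_m -> 'rV[R]_N).
Context (XE : forall a v, 'D_(delta_mx 0 a) u v = X a v)
  (XXE : forall a b v, 'D_(delta_mx 0 a) (X b) v = XX a b v)
  (XXXE : forall a b c v, 'D_(delta_mx 0 a) (XX b c) v = XXX a b c v).
Implicit Types (v : 'rV[R]_m) (a b c d : 'I_m).

Let oV : open V. Proof. by case: pu. Qed.
Let Su : smooth_on V u. Proof. by case: pu. Qed.
Let u1 v : V v -> F (u v) = 1. Proof. by case: pu => _ _ + _ _; exact. Qed.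
Let u0 v : V v -> u v != 0. Proof. by move=> /u1 uv1; exact: (indicatrix_neq0 hF uv1). Qed.
Let XfE a : X a = fun v => 'D_(delta_mx 0 a) u v.
Proof. by apply/funext => v; rewrite XE. Qed.
Let XXfE a b : XX a b = fun v => 'D_(delta_mx 0 a) (X b) v.
Proof. by apply/funext => v; rewrite XXE. Qed.
Let SX a : smooth_on V (X a). Proof. by rewrite XfE; exact: smooth_derive. Qed.
Let SXX a b : smooth_on V (XX a b).
Proof. by rewrite XXfE; exact: smooth_derive. Qed.
Let du v : V v -> differentiable u v.
Proof. exact: smooth_differentiable. Qed.
Let dX v b a : V v -> is_derive v (delta_mx 0 a) (X b) (XX a b v).
Proof.
by move=> Vv; rewrite -XXE; apply: differentiable_is_derive;
  exact: smooth_differentiable (SX b) Vv.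
Qed.
Let dXX v a b c : V v -> is_derive v (delta_mx 0 a) (XX b c) (XXX a b c v).
Proof.
by move=> Vv; rewrite -XXXE; apply: differentiable_is_derive;
  exact: smooth_differentiable (SXX b c) Vv.
Qed.

Lemma row_jacobian v a : V v -> row a (jacobian u v) = X a v.
Proof.
by move=> Vv; rewrite /jacobian rowE mul_rV_lin1 -XE deriveE//; exact: du.
Qed.

Lemma inner_induced_metric v Y Z : inner h v Y Z =
  inner g (u v) (Y *m jacobian u v) (Z *m jacobian u v).
Proof. by rewrite /inner /h /induced_metric trmx_mul !mulmxA. Qed.

Lemma induced_metricE v a b : V v -> h v a b = inner g (u v) (X a v) (X b v).
Proof.
by move=> Vv; rewrite -inner_delta inner_induced_metric -!rowE !row_jacobian.
Qed.

Lemma tangent_orthogonal v b : V v -> inner g (u v) (u v) (X b v) = 0.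
Proof.
by move=> Vv; rewrite -XE; exact: (indicatrix_tangent hF _ oV Vv (du Vv) u1).
Qed.

(** Derivative of the tangency g(u, X_b) = 0. Thus the second fundamental form
   of the indicatrix with respect to its unit normal u is minus its metric. *)
Lemma second_derivative_normal v a b : V v ->
  inner g (u v) (u v) (XX a b v) = - h v a b.
Proof.
move=> Vv; have u0v := u0 Vv.
have [_] := is_derive_metric_field hF (du Vv) u0v
  (differentiable_is_derive (delta_mx 0 a) (du Vv)) (dX b a Vv).
rewrite (derive_open_eq (g := fun=> (0 : R)) _ oV Vv); last first.
  by move=> w Vw; exact: tangent_orthogonal.
rewrite derive_cst XE (cartanCl hF)// (cartan_radial hF)// mulr0 add0r.
rewrite -induced_metricE// => /eqP.
by rewrite eq_sym addrC addr_eq0 => /eqP.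
Qed.

Lemma XXC v a b : V v -> XX a b v = XX b a v.
Proof.
move=> Vv; rewrite -!XXE !XfE; exact: derive_comm_row oV Vv Su.
Qed.

Lemma XXXC v a b c : V v -> XXX a b c v = XXX b a c v.
Proof.
move=> Vv; rewrite -!XXXE !XXfE; exact: derive_comm_row oV Vv (SX c).
Qed.

Lemma induced_metric_derive v a b c : V v ->
  partial a (fun w => h w b c) v = 2 * T (u v) (X a v) (X b v) (X c v)
    + inner g (u v) (XX a b v) (X c v) + inner g (u v) (X b v) (XX a c v).
Proof.
move=> Vv; rewrite /partial.
rewrite (derive_open_eq (g := fun w => inner g (u w) (X b w) (X c w)) _ oV Vv).
  have [_ ->] := is_derive_metric_field hF (du Vv) (u0 Vv) (dX b a Vv) (dX c a Vv).
  by rewrite XE.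
by move=> w Vw; exact: induced_metricE.
Qed.

(** The Levi-Civita connection of the induced metric is the tangential part of
   the one of g, which maps X_a, X_b to X_ab + T(X_a, X_b, .). *)
Lemma induced_christoffel_lower v a b c : V v ->
  christoffel_lower h a b c v =
    T (u v) (X a v) (X b v) (X c v) + inner g (u v) (XX a b v) (X c v).
Proof.
move=> Vv; have u0v := u0 Vv.
rewrite /christoffel_lower !induced_metric_derive//.
rewrite (XXC b a)// (XXC c a)// (XXC c b)//.
rewrite [inner g _ (X b v) (XX a c v)](finsler_metricC hF)//.
rewrite [inner g _ (X a v) (XX b c v)](finsler_metricC hF)//.
rewrite /T (cartanCl hF (X b v) (X a v))//.
rewrite (cartanCl hF (X c v) (X a v))// (cartanCr hF (X a v) (X c v))//.
have alg (t p q r : R) : 2^-1 * (2 * t + p + q + (2 * t + p + r)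
    - (2 * t + q + r)) = t + p by field.
exact: alg.
Qed.

Lemma induced_christoffel_derive v a b c d : V v ->
  partial a (christoffel_lower h b c d) v =
    dcartan F (u v) (X a v) (X b v) (X c v) (X d v)
    + T (u v) (XX a b v) (X c v) (X d v) + T (u v) (X b v) (XX a c v) (X d v)
    + T (u v) (X b v) (X c v) (XX a d v)
    + 2 * T (u v) (X a v) (XX b c v) (X d v)
    + inner g (u v) (XXX a b c v) (X d v)
    + inner g (u v) (XX b c v) (XX a d v).
Proof.
move=> Vv; rewrite /partial.
rewrite (derive_open_eq (g := fun w => T (u w) (X b w) (X c w) (X d w)
  + inner g (u w) (XX b c w) (X d w)) _ oV Vv); last first.
  by move=> w Vw; exact: induced_christoffel_lower.
have [_ ->] := is_derive_add
  (is_derive_cartan_field hF (du Vv) (u0 Vv) (dX b a Vv) (dX c a Vv) (dX d a Vv))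
  (is_derive_metric_field hF (du Vv) (u0 Vv) (dXX a b c Vv) (dX d a Vv)).
have alg (x1 x2 x3 x4 x5 x6 x7 : R) : x1 + x2 + x3 + x4 + (x5 + x6 + x7) =
  x1 + x2 + x3 + x4 + x5 + x6 + x7 by rewrite !addrA.
by rewrite XE; exact: alg.
Qed.

Lemma induced_metric_sym v : V v -> (h v)^T = h v.
Proof.
move=> Vv; rewrite /h /induced_metric !trmx_mul trmxK mulmxA.
by rewrite (finsler_metric_sym hF)//; exact: u0.
Qed.

Lemma jacobian_row_free v : V v -> row_free (jacobian u v).
Proof. by case: pu => _ _ _ _; exact. Qed.

Lemma induced_metric_unit v : V v -> h v \in unitmx.
Proof.
move=> Vv; rewrite -row_free_unit; apply: inj_row_free => w wh.
have : inner h v w w = 0 by rewrite /inner wh mul0mx mxE.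
rewrite inner_induced_metric => /eqP; apply: contraTeq => w0.
rewrite gt_eqF//; apply: (mink_convex hF); first exact: u0.
apply: contra w0 => /eqP wJ; apply/eqP.
by apply: (row_free_inj (jacobian_row_free Vv)); rewrite mul0mx.
Qed.

Lemma induced_metric_Ck k a b : Ck_on k V (fun w => h w a b).
Proof.
have H : Ck_on k V (fun w => \sum_i \sum_j X a w 0 i * X b w 0 j * g (u w) i j).
  apply: Ck_on_sum => // i; apply: Ck_on_sum => // j.
  apply: Ck_onM => //.
    by apply: Ck_onM => //; apply: Ck_on_coord => //; exact: SX.
  apply: (Ck_on_comp oV (@slit_open R N) _ (finsler_metric_smooth hF i j k) (Su k)).
  exact: u0.
by apply: Ck_on_eq H => // w Vw; rewrite induced_metricE// innerE.
Qed.

Lemma inverse_metric_frame v : V v -> invmx (g (u v)) =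
  (u v)^T *m u v + (jacobian u v)^T *m invmx (h v) *m jacobian u v.
Proof.
move=> Vv; have u0v := u0 Vv.
apply: invmx_orthogonal_frame => //.
- exact: (finsler_metric_unit hF).
- exact: (finsler_metric_sym hF).
- apply/matrixP => i j; rewrite !ord1 [RHS]mxE eqxx/=.
  by have := metric_radial_radial hF u0v; rewrite u1// expr1n.
- apply/matrixP => i j; rewrite ord1 [RHS]mxE -[RHS](tangent_orthogonal j Vv).
  by rewrite -row_jacobian// /inner mulmx_tr_row.
- exact: induced_metric_unit.
Qed.

(* The ambient covariant derivative of X_b along X_a, as a covector. *)
Let al (a b : 'I_m) v : 'rV[R]_N :=
  cartan_row F (u v) (X a v) (X b v) + XX a b v *m g (u v).

Lemma christoffel_row_tangential v a b : V v ->
  christoffel_row h a b v = al a b v *m (jacobian u v)^T.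
Proof.
move=> Vv; apply/rowP => c; rewrite [LHS]mxE induced_christoffel_lower//.
rewrite /al mulmxDl mxE; congr (_ + _).
  rewrite mxE /T cartan_sumr; apply: eq_bigr => j _.
  by rewrite [in RHS]mxE -row_jacobian// !mxE mulrC.
by rewrite -row_jacobian// /inner [RHS]mulmx_tr_row.
Qed.

Lemma al_normal v a b : V v -> (al a b v *m (u v)^T) 0 0 = - h v a b.
Proof.
move=> Vv; have u0v := u0 Vv.
rewrite /al mulmxDl mxE -[X in _ + X]/(inner g (u v) (XX a b v) (u v)).
rewrite (finsler_metricC hF)// second_derivative_normal//.
rewrite [X in X + _](_ : _ = 0) ?add0r//.
rewrite mxE; under eq_bigr do rewrite [X in X * _]mxE [X in _ * X]mxE mulrC.
by rewrite -cartan_sumr (cartanCr hF)// (cartanCl hF)// (cartan_radial hF).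
Qed.

(** The normal parts of the covariant derivatives are given by the second
   fundamental form. *)
Lemma cometric_induced v a b c d : V v ->
  cometric h v (christoffel_row h a b v) (christoffel_row h c d v) =
  cometric g (u v) (al a b v) (al c d v) - h v a b * h v c d.
Proof.
move=> Vv; rewrite !christoffel_row_tangential//.
rewrite {2}/cometric /inner inverse_metric_frame// mulmxDr mulmxDl mxE.
set rhs := (X in _ = _ + X - _).
have -> : cometric h v (al a b v *m (jacobian u v)^T)
    (al c d v *m (jacobian u v)^T) = rhs.
  by rewrite /cometric /inner /rhs trmx_mul trmxK !mulmxA.
have -> : (al a b v *m ((u v)^T *m u v) *m (al c d v)^T) 0 0 = h v a b * h v c d.
  rewrite !mulmxA -mulmxA mxE big_ord1 al_normal//.
  have tr (x y : 'rV[R]_N) : (x *m y^T) 0 0 = (y *m x^T) 0 0.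
    by rewrite !mxE; apply: eq_bigr => i _; rewrite !mxE mulrC.
  by rewrite tr al_normal// mulrNN.
by rewrite addrAC subrr add0r.
Qed.

Lemma cometric_al v a b c d : V v ->
  cometric g (u v) (al a b v) (al c d v) =
  cometric g (u v) (cartan_row F (u v) (X a v) (X b v))
                   (cartan_row F (u v) (X c v) (X d v))
  + T (u v) (X a v) (X b v) (XX c d v) + T (u v) (X c v) (X d v) (XX a b v)
  + inner g (u v) (XX a b v) (XX c d v).
Proof.
move=> Vv; have u0v := u0 Vv.
exact: (cometric_cartan_shift hF).
Qed.

(** All third derivatives of u and all terms linear in T cancel. The second
   summand is the contribution of the second fundamental form, which equals minus
   the metric. *)
Lemma gauss_equation_coord v a b c d : V v ->
  lowered_curvature h a b c d v =
    cartan_curv F (u v) (X a v) (X b v) (X c v) (X d v)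
    + metric_curv (inner g (u v)) (X a v) (X b v) (X c v) (X d v).
Proof.
move=> Vv; have u0v := u0 Vv.
rewrite (lowered_curvatureE a b c d oV Vv (induced_metric_Ck 2)
  induced_metric_unit induced_metric_sym).
rewrite !induced_christoffel_derive// !cometric_induced// !cometric_al//.
rewrite /cartan_curv /metric_curv !induced_metricE//.
rewrite (XXXC b a)// (XXC b a)// (dcartanCl hF (X b v))// /T.
rewrite (cartanCr hF (X b v) (X d v))// (cartanCr hF (X a v) (X d v))//.
rewrite [inner g _ (XX b d v) _](finsler_metricC hF)//.
rewrite [inner g _ (XX a d v) _](finsler_metricC hF)//.
rewrite [cometric g _ (cartan_row _ _ (X b v) (X d v)) _](cometricC hF)//.
rewrite [cometric g _ (cartan_row _ _ (X a v) (X d v)) _](cometricC hF)//.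
have alg (x1 x2 x3 x4 x5 x6 x7 x8 x9 y1 y2 y3 y4 y5 y6 : R) :
  x1 + x2 + x3 + x4 + 2 * x5 + x6 + x7
  - (x1 + x2 + x5 + x8 + 2 * x3 + x6 + x9)
  + (y1 + x3 + x8 + x9 - y2 * y3 - (y4 + x5 + x4 + x7 - y5 * y6))
  = y1 - y4 + (y6 * y5 - y3 * y2) by ring.
exact: alg.
Qed.

Lemma gauss_equation v A B C D : V v ->
  let J := jacobian u v in
  inner h v (curvature_op h v A B C) D =
  cartan_curv F (u v) (A *m J) (B *m J) (C *m J) (D *m J)
  + metric_curv (inner g (u v)) (A *m J) (B *m J) (C *m J) (D *m J).
Proof.
move=> Vv J; rewrite inner_curvature_op; last exact: induced_metric_sym.
have Q := quadrilinearD (quadrilinear_cartan_curv hF (u0 Vv))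
  (quadrilinear_metric_curv g (u v)).
rewrite [RHS](quadrilinear_mulmx J A B C D Q).
apply: eq_bigr => i _; apply: eq_bigr => j _; apply: eq_bigr => k _.
apply: eq_bigr => l _; rewrite gauss_equation_coord//.
by rewrite !row_jacobian.
Qed.

End GaussEquation.

Section GaussSectional.
Context {R : realType} {N m : nat} (F : 'rV[R]_N -> R) (hF : minkowski_norm F).
Let g := finsler_metric F.

(** The squared area of the parallelogram spanned by X and Y. *)
Definition area2 (B : 'rV[R]_N -> 'rV[R]_N -> R) X Y := B X X * B Y Y - B X Y ^+ 2.

Lemma sectional_curvature_indicatrix (V : set 'rV[R]_m) (u : 'rV[R]_m -> 'rV[R]_N)
    v A B : (m.+1 = N)%N ->
  local_parametrization (indicatrix F) V u -> V v ->
  let X := A *m jacobian u v in let Y := B *m jacobian u v in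
  sectional_curvature (induced_metric g u) v A B =
  (cartan_curv F (u v) X Y Y X + area2 (inner g (u v)) X Y)
  / area2 (inner g (u v)) X Y.
Proof.
move=> mN pu Vv X Y; rewrite /sectional_curvature.
rewrite (gauss_equation hF mN pu (fun _ _ => erefl) (fun _ _ _ => erefl)
  (fun _ _ _ _ => erefl) A B B A Vv) !inner_induced_metric -/X -/Y.
rewrite /area2 /metric_curv.
have u0 : u v != 0.
  apply: (indicatrix_neq0 hF); case: pu => _ _ h _ _; exact: h.
rewrite (finsler_metricC hF Y X u0).
move: (inner _ _ X X) (inner _ _ X Y) (inner _ _ Y Y) => x y z.
by congr (_ / _); ring.
Qed.

End GaussSectional.

(** * Conformal change of the metric *)

Section ConformalChange.
Context {R : realType} {N : nat} (F : 'rV[R]_N -> R) (hF : minkowski_norm F).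
Context (V : set 'rV[R]_N) (oV : open V) (V0 : forall y, V y -> y != 0).
Context (lam : 'rV[R]_N -> R) (Sl : smooth_on V lam)
  (lam0 : forall y, V y -> 0 < lam y).
Let g := finsler_metric F.
Let T := cartan F.
Let G y := lam y *: g y.
(* The basis vectors, the differential of the logarithm of the square root of
   the conformal factor and its derivative are kept abstract, so that comparing
   two of their values does not unfold matrices or limits. *)
Context (e : 'I_N -> 'rV[R]_N) (eE : forall i, delta_mx 0 i = e i).
Context (ph : 'rV[R]_N -> 'rV[R]_N -> R)
  (phE : forall y X, (2 * lam y)^-1 * 'D_X lam y = ph y X).
Context (H : 'rV[R]_N -> 'rV[R]_N -> 'rV[R]_N -> R)
  (HE : forall y X Y, 'D_X (fun z => ph z Y) y = H y X Y).
Implicit Types (y X Y Z W : 'rV[R]_N).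

Let dlam y : V y -> differentiable lam y.
Proof. exact: smooth_differentiable. Qed.

(** Here ph is the differential of phi = ln (lam) / 2, and H collects the second
   partial derivatives of phi. *)
Lemma conf_form_smooth X : smooth_on V (fun z => ph z X).
Proof.
rewrite (_ : (fun z => ph z X) = fun z => (2 * lam z)^-1 * 'D_X lam z); last first.
  by apply/funext => z; rewrite phE.
move=> k; apply: Ck_onM => //; last exact: smooth_derive.
apply: Ck_onV => //; last by apply: Ck_onZ => //; exact: Sl.
by move=> z Vz; rewrite mulf_neq0// gt_eqF// lam0.
Qed.

Lemma is_derive_lam y X : V y -> is_derive y X lam (lam y * (2 * ph y X)).
Proof.
move=> Vy; apply: (is_derive_eq (differentiable_is_derive X (dlam Vy))).
by rewrite -phE invfM; have := lt0r_neq0 (lam0 Vy) => l0; field.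
Qed.

Lemma is_derive_conf_form y X Y : V y -> is_derive y X (fun z => ph z Y) (H y X Y).
Proof.
move=> Vy; rewrite -HE; apply: differentiable_is_derive.
exact: smooth_differentiable (conf_form_smooth Y) Vy.
Qed.

Lemma conf_form_linear y : V y -> additive_homogeneous (ph y).
Proof.
move=> Vy; split=> [X Y|c X]; rewrite -!phE.
  by rewrite deriveDl ?mulrDr//; exact: dlam.
rewrite deriveZl; last exact: dlam.
by rewrite mulrCA.
Qed.

Lemma conf_hess_lineml y Y : V y -> additive_homogeneous (fun X => H y X Y).
Proof.
move=> Vy; have d := smooth_differentiable (conf_form_smooth Y) Vy.
by split=> [X Z|c X]; rewrite -!HE; [exact: deriveDl|exact: deriveZl].
Qed.

(** The differential of phi is closed, because second derivatives of lam
   commute. *)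
Lemma conf_hess_sym y X Y : V y -> H y X Y = H y Y X.
Proof.
move=> Vy.
have hH A B : H y A B = 'D_A (fun z => 'D_B lam z) y * (2 * lam y)^-1
    - 2 * (ph y A * ph y B).
  have dB := smooth_differentiable (smooth_derive B Sl) Vy.
  have l2 : 2 * lam y != 0 by rewrite mulf_neq0// gt_eqF// lam0.
  rewrite -HE (derive_open_eq (g := fun z => (2 * lam z)^-1 * 'D_B lam z) _ oV Vy);
    last by move=> z _; rewrite phE.
  have [_ ->] := is_derive_mul
    (is_derive_inv (f := fun z => 2 * lam z) l2
      (is_derive_cmul 2 (is_derive_lam A Vy)))
    (differentiable_is_derive A dB).
  rewrite -(phE y B); move: ('D_B lam y) ('D_A _ y) (ph y A) => b c a.
  by have := lt0r_neq0 (lam0 Vy); move: (lam y) => l l0; field.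
rewrite !hH (derive_comm X Y oV Vy (Sl 2%N)).
by rewrite [ph y Y * _]mulrC.
Qed.

Lemma conf_hess_linear y X : V y -> additive_homogeneous (H y X).
Proof.
move=> Vy; have [hD hZ] := conf_hess_lineml X Vy.
by split=> [Y Z|c Y]; rewrite !(conf_hess_sym X)// ?hD ?hZ.
Qed.

(** The gradient of phi with respect to g. *)
Definition conf_grad y : 'rV[R]_N := (\row_j ph y (delta_mx 0 j)) *m invmx (g y).

Lemma inner_conf_grad y X : V y -> inner g y (conf_grad y) X = ph y X.
Proof.
move=> Vy; rewrite /inner /conf_grad mulmxKV ?(finsler_metric_unit hF) ?V0//.
rewrite [in RHS](row_sum_delta X) additive_homogeneous_sum//; last first.
  exact: conf_form_linear.
by rewrite mxE; apply: eq_bigr => j _; rewrite !mxE mulrC.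
Qed.

(** The tensor Hess phi - dphi dphi + |dphi|^2 g / 2. The covariant Hessian
   contains T because the Christoffel symbols of g are the components of T. It is
   the Schouten tensor of g when lam g is flat. *)
Definition conf_schouten y X Y : R :=
  H y X Y - T y X Y (conf_grad y) - ph y X * ph y Y
  + 2^-1 * inner g y (conf_grad y) (conf_grad y) * inner g y X Y.

Lemma conf_schoutenC y X Y : V y -> conf_schouten y X Y = conf_schouten y Y X.
Proof.
move=> Vy; rewrite /conf_schouten (conf_hess_sym X)// [ph y X * _]mulrC.
by rewrite /T (cartanCl hF X)// ?(finsler_metricC hF X)// V0.
Qed.

Lemma conf_schouten_linear y X : V y -> additive_homogeneous (conf_schouten y X).
Proof.
move=> Vy; have [hD hZ] := conf_hess_linear X Vy.
have [pD pZ] := conf_form_linear Vy.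
split=> [Y Z|c Y]; rewrite /conf_schouten /T ?hD ?hZ ?pD ?pZ.
  by rewrite cartanDm innerDr; ring.
by rewrite cartanZm innerZr; ring.
Qed.

Lemma conf_schouten_lineml y Y : V y ->
  additive_homogeneous (fun X => conf_schouten y X Y).
Proof.
move=> Vy; have [hD hZ] := conf_schouten_linear Y Vy.
by split=> [X Z|c X]; rewrite !(fun A => conf_schoutenC A Y Vy) ?hD ?hZ.
Qed.

Definition kulkarni_nomizu (B P : 'rV[R]_N -> 'rV[R]_N -> R) X Y Z W : R :=
  B Y W * P X Z + B X Z * P Y W - B Y Z * P X W - B X W * P Y Z.

Lemma quadrilinear_kulkarni_nomizu y : V y ->
  quadrilinear (kulkarni_nomizu (inner g y) (conf_schouten y)).
Proof.
move=> Vy; rewrite /kulkarni_nomizu.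
split=> A B C; split=> [X Y|c X]; rewrite ?(innerDl, innerDr, innerZl, innerZr).
- by rewrite !(conf_schouten_lineml _ Vy).1; ring.
- by rewrite !(conf_schouten_lineml _ Vy).2; ring.
- by rewrite !(conf_schouten_lineml _ Vy).1; ring.
- by rewrite !(conf_schouten_lineml _ Vy).2; ring.
- by rewrite !(conf_schouten_linear _ Vy).1; ring.
- by rewrite !(conf_schouten_linear _ Vy).2; ring.
- by rewrite !(conf_schouten_linear _ Vy).1; ring.
- by rewrite !(conf_schouten_linear _ Vy).2; ring.
Qed.

Let A (i j l : 'I_N) y : R :=
  T y (e i) (e j) (e l) + ph y (e i) * inner g y (e j) (e l)
  + ph y (e j) * inner g y (e i) (e l) - ph y (e l) * inner g y (e i) (e j).

Let dg y X Y Z : V y -> is_derive y X (fun z => inner g z Y Z) (2 * T y X Y Z).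
Proof.
move=> Vy; apply: (is_derive_eq
  (differentiable_is_derive X (inner_metric_diff hF Y Z (V0 Vy)))).
by rewrite /T (cartanE hF)// ?V0// mulVKf.
Qed.

Lemma conf_metricE y i j : G y i j = lam y * inner g y (e i) (e j).
Proof. by rewrite -!eE inner_delta mxE. Qed.

Lemma conf_metric_partial y a i j : V y -> partial a (fun z => G z i j) y =
  lam y * (2 * (ph y (e a) * inner g y (e i) (e j) + T y (e a) (e i) (e j))).
Proof.
move=> Vy; rewrite /partial eE.
rewrite (derive_open_eq (g := fun z => lam z * inner g z (e i) (e j)) _ oV Vy);
  last by move=> z _; exact: conf_metricE.
have [_ ->] := is_derive_mul (is_derive_lam (e a) Vy) (dg (e a) (e i) (e j) Vy).
by ring.
Qed.

Lemma conf_christoffel_lower y i j l : V y ->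
  christoffel_lower G i j l y = lam y * A i j l y.
Proof.
move=> Vy; have y0 := V0 Vy.
rewrite /christoffel_lower !conf_metric_partial// /A /T.
rewrite (cartanCl hF (e j) (e i))// (cartanCl hF (e l) (e i))//.
rewrite (cartanCr hF (e i) (e l))//.
by field.
Qed.

Lemma conf_christoffel_partial y a i j l : V y ->
  partial a (christoffel_lower G i j l) y =
  lam y * (2 * ph y (e a) * A i j l y
   + (dcartan F y (e a) (e i) (e j) (e l)
      + (H y (e a) (e i) * inner g y (e j) (e l)
         + ph y (e i) * (2 * T y (e a) (e j) (e l)))
      + (H y (e a) (e j) * inner g y (e i) (e l)
         + ph y (e j) * (2 * T y (e a) (e i) (e l)))
      - (H y (e a) (e l) * inner g y (e i) (e j)
         + ph y (e l) * (2 * T y (e a) (e i) (e j))))).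
Proof.
move=> Vy; have y0 := V0 Vy; rewrite /partial eE.
rewrite (derive_open_eq (g := fun z => lam z * A i j l z) _ oV Vy);
  last by move=> z Vz; exact: conf_christoffel_lower.
have dp X Y Z B := is_derive_mul (is_derive_conf_form X B Vy) (dg X Y Z Vy).
have [_ ->] := is_derive_mul (is_derive_lam (e a) Vy)
  (is_derive_add (is_derive_add (is_derive_add
     (is_derive_cartan_const hF (e i) (e j) (e l) (e a) y0)
     (dp (e a) (e j) (e l) (e i))) (dp (e a) (e i) (e l) (e j)))
     (is_derive_opp (dp (e a) (e i) (e j) (e l)))).
have alg (x p q r : R) : x * (2 * p) * q + x * r = x * (2 * p * q + r) by ring.
exact: alg.
Qed.

Lemma cometric_conf y al be : V y ->
  cometric G y al be = (lam y)^-1 * cometric g y al be.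
Proof.
move=> Vy; rewrite /cometric /inner /G invmxZ; last first.
  by rewrite unitmxZ ?unitfE ?gt_eqF ?lam0// (finsler_metric_unit hF)// V0.
by rewrite -scalemxAr -scalemxAl mxE.
Qed.

Let Wr y (i j : 'I_N) : 'rV[R]_N :=
  ph y (e i) *: e j + ph y (e j) *: e i - inner g y (e i) (e j) *: conf_grad y.

Lemma conf_christoffel_row y i j : V y -> christoffel_row G i j y =
  lam y *: (cartan_row F y (e i) (e j) + Wr y i j *m g y).
Proof.
move=> Vy; apply/rowP => l; rewrite [LHS]mxE conf_christoffel_lower//.
rewrite [RHS]mxE; congr (_ * _); rewrite mxE [X in _ = X + _]mxE eE.
have -> : (Wr y i j *m g y) 0 l = inner g y (Wr y i j) (e l).
  by rewrite -eE /inner trmx_delta -colE [RHS]mxE.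
rewrite /Wr innerBl innerDl !innerZl inner_conf_grad//.
by rewrite /A [_ * ph y (e l)]mulrC !addrA.
Qed.

Lemma conf_metric_unit y : V y -> G y \in unitmx.
Proof.
move=> Vy; rewrite unitmxZ ?unitfE ?gt_eqF ?lam0//.
by rewrite (finsler_metric_unit hF)// V0.
Qed.

Lemma conf_metric_sym y : V y -> (G y)^T = G y.
Proof. by move=> Vy; rewrite /G linearZ/= (finsler_metric_sym hF)// V0. Qed.

Lemma conf_metric_Ck k i j : Ck_on k V (fun y => G y i j).
Proof.
have h : Ck_on k V (fun y => lam y * g y i j).
  apply: Ck_onM => //.
  apply: (Ck_on_sub (U := @slit_space R N)); first exact: V0.
  exact: (finsler_metric_smooth hF).
by apply: Ck_on_eq h => // y Vy; rewrite [RHS]mxE.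
Qed.

Lemma cometric_conf_christoffel y i j k l : V y ->
  cometric G y (christoffel_row G i j y) (christoffel_row G k l y) =
  lam y * (cometric g y (cartan_row F y (e i) (e j)) (cartan_row F y (e k) (e l))
    + T y (e i) (e j) (Wr y k l) + T y (e k) (e l) (Wr y i j)
    + inner g y (Wr y i j) (Wr y k l)).
Proof.
move=> Vy; rewrite cometric_conf// !conf_christoffel_row//.
rewrite /cometric innerZl innerZr -!/(cometric _ _ _ _).
rewrite (cometric_cartan_shift hF) ?V0// !mulrA mulVf ?mul1r//.
by rewrite gt_eqF// lam0.
Qed.

Lemma cartan_Wr y X Y i j : T y X Y (Wr y i j) =
  ph y (e i) * T y X Y (e j) + ph y (e j) * T y X Y (e i)
  - inner g y (e i) (e j) * T y X Y (conf_grad y).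
Proof.
by rewrite /Wr /T !cartanDr !cartanZr -scaleNr cartanZr mulNr.
Qed.

Lemma inner_Wr y i j k l : V y -> inner g y (Wr y i j) (Wr y k l) =
  ph y (e i) * (ph y (e k) * inner g y (e j) (e l)
                + ph y (e l) * inner g y (e j) (e k)
                - inner g y (e k) (e l) * ph y (e j))
  + ph y (e j) * (ph y (e k) * inner g y (e i) (e l)
                + ph y (e l) * inner g y (e i) (e k)
                - inner g y (e k) (e l) * ph y (e i))
  - inner g y (e i) (e j) * (ph y (e k) * ph y (e l) + ph y (e l) * ph y (e k)
      - inner g y (e k) (e l) * inner g y (conf_grad y) (conf_grad y)).
Proof.
move=> Vy; have cv a : inner g y (e a) (conf_grad y) = ph y (e a).
  by rewrite (finsler_metricC hF) ?V0// inner_conf_grad.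
rewrite /Wr innerBl innerDl !innerZl !innerBr !innerDr !innerZr.
by rewrite !cv !inner_conf_grad.
Qed.

(** Conformal change of the curvature tensor. Both sides are polynomials in ph,
   H, T, g and the contraction of T with itself. *)
Lemma conf_lowered_curvature y i j k l : V y ->
  lowered_curvature G i j k l y =
  lam y * (cartan_curv F y (e i) (e j) (e k) (e l)
    + kulkarni_nomizu (inner g y) (conf_schouten y) (e i) (e j) (e k) (e l)).
Proof.
move=> Vy; have y0 := V0 Vy.
rewrite (lowered_curvatureE i j k l oV Vy (conf_metric_Ck 2)
  conf_metric_unit conf_metric_sym).
rewrite !conf_christoffel_partial// !cometric_conf_christoffel//.
rewrite !cartan_Wr !inner_Wr// /A /cartan_curv /kulkarni_nomizu /conf_schouten.
rewrite (dcartanCl hF (e j) (e i))// (conf_hess_sym (e j) (e i))//.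
have TC X Y Z : T y X Y Z = T y Y X Z by exact: (cartanCl hF).
have TR X Y Z : T y X Y Z = T y X Z Y by exact: (cartanCr hF).
have BC X Y : inner g y X Y = inner g y Y X by exact: (finsler_metricC hF).
rewrite (TC (e j) (e i) (e l)) (TC (e j) (e i) (e k)).
rewrite (TR (e j) (e l) (e k)) (TR (e j) (e l) (e i)) (TC (e j) (e i) (e l)).
rewrite (TR (e i) (e k) (e j)) (TR (e i) (e l) (e k)) (TR (e i) (e l) (e j)).
rewrite (TR (e j) (e k) (e i)) (TC (e j) (e i) (e k)).
rewrite (BC (e l) (e k)) (BC (e l) (e i)) (BC (e j) (e i)) (BC (e l) (e j)).
rewrite [cometric g y (cartan_row F y (e j) (e l)) _](cometricC hF)//.
rewrite [cometric g y (cartan_row F y (e i) (e l)) _](cometricC hF)//.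
by field.
Qed.

(** The coordinate identity extends to all vectors by multilinearity. *)
Lemma conf_flatP y : V y ->
  (forall i j k l, curvature G i j k l y = 0) <->
  (forall X Y Z W, cartan_curv F y X Y Z W =
    - kulkarni_nomizu (inner g y) (conf_schouten y) X Y Z W).
Proof.
move=> Vy; rewrite -flat_lowered_curvature; last exact: conf_metric_unit.
split=> [h X Y Z W|h i j k l]; last first.
  by rewrite conf_lowered_curvature// h addNr mulr0.
have Q := quadrilinearZ (-1) (quadrilinear_kulkarni_nomizu Vy).
rewrite -mulN1r; apply: (quadrilinear_eq
  (quadrilinear_cartan_curv hF (V0 Vy)) Q) => i j k l.
have := h i j k l; rewrite conf_lowered_curvature// !eE => /eqP.
by rewrite mulf_eq0 gt_eqF ?lam0//= addr_eq0 mulN1r => /eqP.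
Qed.

End ConformalChange.

(** * Orthogonal vectors and areas *)

Lemma exists_nonzero_row (R : realType) n : (0 < n)%N ->
  exists y : 'rV[R]_n, y != 0.
Proof.
move=> n0; exists (delta_mx 0 (Ordinal n0)).
apply/eqP => /matrixP/(_ 0 (Ordinal n0)); rewrite !mxE !eqxx => /eqP.
by rewrite oner_eq0.
Qed.

Section MetricLinearAlgebra.
Context {R : realType} {N : nat} (F : 'rV[R]_N -> R) (hF : minkowski_norm F).
Let g := finsler_metric F.
Implicit Types (y X Y Z W : 'rV[R]_N).

(** Being orthogonal to the k rows of A is a linear system of rank at most k. *)
Lemma exists_orthogonal k (A : 'M[R]_(k, N)) y : (k < N)%N ->
  exists2 X, X != 0 & forall i, inner g y X (row i A) = 0.
Proof.
move=> kN; pose M := g y *m A^T.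
have rk : kermx M != 0.
  rewrite -mxrank_eq0 mxrank_ker subn_eq0 -ltnNge.
  exact: leq_ltn_trans (rank_leq_col _) kN.
exists (nz_row (kermx M)); first by rewrite nz_row_eq0.
move=> i; have /sub_kermxP e : (nz_row (kermx M) <= kermx M)%MS by exact: nz_row_sub.
rewrite /inner -mulmx_tr_row -mulmxA -/M e.
by rewrite mxE.
Qed.

Lemma exists_orthogonal1 y X : y != 0 -> (2 <= N)%N ->
  exists2 Y, Y != 0 & inner g y X Y = 0.
Proof.
move=> y0 hN; have [Y Y0 h] := exists_orthogonal X y hN.
by exists Y => //; rewrite (finsler_metricC hF)// -(h 0) row_id.
Qed.

Lemma exists_orthogonal2 y X Y : y != 0 -> (3 <= N)%N ->
  exists2 Z, Z != 0 & inner g y X Z = 0 /\ inner g y Y Z = 0.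
Proof.
move=> y0 hN; have [Z Z0 h] := exists_orthogonal (col_mx X Y) y hN.
exists Z => //; split; rewrite (finsler_metricC hF)//.
  by have := h (lshift 1 0); rewrite rowKu row_id.
by have := h (rshift 1 0); rewrite rowKd row_id.
Qed.

Lemma exists_not_sub k (A : 'M[R]_(k, N)) : (k < N)%N ->
  exists i, ~~ ((delta_mx 0 i : 'rV[R]_N) <= A)%MS.
Proof.
move=> kN; apply/existsP; rewrite -negb_forall.
apply/negP => /forallP h.
have : ((1%:M : 'M[R]_N) <= A)%MS.
  by apply/row_subP => i; rewrite row1; exact: h.
move/mxrankS; rewrite mxrank1 => rA.
by have := leq_ltn_trans (leq_trans rA (rank_leq_row A)) kN; rewrite ltnn.
Qed.

Lemma area2_orthogonal y X Y : inner g y X Y = 0 ->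
  area2 (inner g y) X Y = inner g y X X * inner g y Y Y.
Proof. by move=> e; rewrite /area2 e expr0n subr0. Qed.

(** The vector Z is a multiple of the component of Y orthogonal to X. *)
Lemma inner_gram y X Y : y != 0 ->
  let Z := inner g y X X *: Y - inner g y X Y *: X in
  inner g y Z Z = inner g y X X * area2 (inner g y) X Y.
Proof.
move=> y0 Z; rewrite /Z /area2 innerBl !innerBr !innerZl !innerZr.
rewrite (finsler_metricC hF Y X)//.
move: (inner g y X X) (inner g y X Y) (inner g y Y Y) => a b c; ring.
Qed.

Lemma inner_eq0 y X : y != 0 -> (inner g y X X == 0) = (X == 0).
Proof.
move=> y0; apply/idP/idP => [|/eqP->]; last by rewrite inner0l.
by apply: contraTT => X0; rewrite gt_eqF// (mink_convex hF).
Qed.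

Lemma row_free_col2 (n : nat) (A B : 'rV[R]_n) : row_free (col_mx A B) <->
  (forall c d, c *: A + d *: B = 0 -> c = 0 /\ d = 0).
Proof.
split=> [fAB c d e|h].
  have : row_mx c%:M d%:M *m col_mx A B = 0 *m col_mx A B.
    by rewrite mul0mx mul_row_col !mul_scalar_mx.
  move/(row_free_inj fAB) => /eqP; rewrite row_mx_eq0.
  move=> /andP[/eqP/matrixP/(_ 0 0) + /eqP/matrixP/(_ 0 0)].
  by rewrite !mxE !eqxx !mulr1n.
apply: inj_row_free => v; rewrite -[v]hsubmxK mul_row_col.
rewrite [lsubmx v]mx11_scalar [rsubmx v]mx11_scalar !mul_scalar_mx.
move=> /h[-> ->]; rewrite -[LHS]/(row_mx _ _).
by apply/eqP; rewrite row_mx_eq0 !raddf0 eqxx.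
Qed.

Lemma area2_eq0 y X Y : y != 0 -> (area2 (inner g y) X Y == 0) = ~~ row_free (col_mx X Y).
Proof.
move=> y0; apply/idP/idP.
  move=> /eqP a0; apply/negP => /row_free_col2 f.
  have /eqP := inner_gram X Y y0; rewrite a0 mulr0 inner_eq0// => /eqP.
  rewrite addrC -scaleNr => /f[_ /eqP]; rewrite inner_eq0// => /eqP X0.
  by have [] := f 1 0; rewrite ?X0 ?scaler0 ?scale0r ?addr0// => /eqP; rewrite oner_eq0.
apply: contraNT => a0; apply/row_free_col2 => c d e.
have XX0 : inner g y X X != 0.
  apply: contra a0; rewrite inner_eq0// => /eqP ->.
  by rewrite /area2 !inner0l mul0r expr0n subr0.
have e1 : c * inner g y X X + d * inner g y X Y = 0.
  by rewrite -!innerZr -innerDr e inner0r.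
have e2 : c * inner g y X Y + d * inner g y Y Y = 0.
  by rewrite (finsler_metricC hF X Y)// -!innerZr -innerDr e inner0r.
have d0 : d = 0.
  apply/eqP; rewrite -(mulIr_eq0 _ (mulIf a0)); apply/eqP.
  rewrite /area2; move: e1 e2.
  move: (inner g y X X) (inner g y X Y) (inner g y Y Y) => x z w e1 e2.
  have -> : d * (x * w - z ^+ 2) = (c * z + d * w) * x - (c * x + d * z) * z by ring.
  by rewrite e1 e2 !mul0r subrr.
split=> //; move: e1; rewrite d0 mul0r addr0 => /eqP.
by rewrite mulf_eq0 (negbTE XX0) orbF => /eqP.
Qed.

End MetricLinearAlgebra.

(** * The curvature at one point of a conformally flat tangent space *)

Section ConformallyFlatPoint.
Context {R : realType} {N : nat} (hN : (3 <= N)%N) (F : 'rV[R]_N -> R)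
  (hF : minkowski_norm F).
Let g := finsler_metric F.
Context (y : 'rV[R]_N) (y0 : y != 0) (P : 'rV[R]_N -> 'rV[R]_N -> R).
Context (PC : forall X Y, P X Y = P Y X)
  (Pl : forall X, additive_homogeneous (P X)).
Context (PR : forall X Y Z W,
  cartan_curv F y X Y Z W = - kulkarni_nomizu (inner g y) P X Y Z W).
Let a := P y y / F y ^+ 2.
Implicit Types (X Y Z W : 'rV[R]_N).

Let F0 : F y ^+ 2 != 0.
Proof. by rewrite expf_neq0// gt_eqF// (mink_pos hF). Qed.

Let kn0 Y Z W : kulkarni_nomizu (inner g y) P y Y Z W = 0.
Proof. by apply/eqP; rewrite -oppr_eq0 -PR (cartan_curv_radial hF). Qed.

(** As N >= 3, there is a vector X orthogonal to both y and W; the identity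
   Rm(y, X, X, W) = 0 then reads g(X, X) P(y, W) = 0. *)
Lemma schouten_radial_tangent W : inner g y y W = 0 -> P y W = 0.
Proof.
move=> tW; have [X X0 [tX XW]] := exists_orthogonal2 hF y W y0 hN.
have XX0 : inner g y X X != 0 by rewrite (inner_eq0 hF).
apply: (mulfI XX0); rewrite mulr0; apply/eqP; rewrite -oppr_eq0.
have := kn0 X X W; rewrite /kulkarni_nomizu tW tX (finsler_metricC hF X W)// XW.
by rewrite !mul0r subr0 add0r sub0r => ->.
Qed.

Lemma schouten_radial X : P X y = a * inner g y X y.
Proof.
pose c := inner g y X y / F y ^+ 2.
have yy : inner g y y y = F y ^+ 2 by exact: metric_radial_radial.
have t : inner g y y (X - c *: y) = 0.
  by rewrite innerBr innerZr yy divfK// (finsler_metricC hF X)// subrr.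
have [PD PZ] := Pl y.
rewrite PC -[X in P y X](subrK (c *: y)) PD schouten_radial_tangent// add0r PZ.
rewrite /c /a; move: (inner g y X y) (P y y) ((F y ^+ 2)^-1) => p q r.
ring.
Qed.

(** This is Rm(y, X, Y, y) = 0. *)
Lemma schouten_tangent X Y : inner g y y X = 0 -> inner g y y Y = 0 ->
  P X Y = - a * inner g y X Y.
Proof.
move=> tX tY; have yy : inner g y y y = F y ^+ 2 by exact: metric_radial_radial.
have := kn0 X Y y; rewrite /kulkarni_nomizu tY yy (finsler_metricC hF X y)// tX.
rewrite !mul0r !add0r => /eqP; rewrite addrC subr_eq0 => /eqP e.
apply: (mulfI F0); apply: oppr_inj; rewrite e /a mulNr mulrN opprK.
by rewrite mulrA mulrCA divff// mulr1 mulrC.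
Qed.

Lemma schouten_tangentl X Y : inner g y y X = 0 -> P X Y = - a * inner g y X Y.
Proof.
move=> tX; pose c := inner g y Y y / F y ^+ 2.
have yy : inner g y y y = F y ^+ 2 by exact: metric_radial_radial.
have t : inner g y y (Y - c *: y) = 0.
  by rewrite innerBr innerZr yy divfK// (finsler_metricC hF Y)// subrr.
have [PD PZ] := Pl X.
rewrite -[in LHS](subrK (c *: y) Y) PD schouten_tangent// PZ.
rewrite (PC X y) schouten_radial_tangent// mulr0 addr0.
by rewrite innerBr innerZr (finsler_metricC hF X y)// tX mulr0 subr0.
Qed.

Lemma cartan_curv_isotropic X Y : inner g y y X = 0 -> inner g y y Y = 0 ->
  cartan_curv F y X Y Y X = - 2 * a * area2 (inner g y) X Y.
Proof.
move=> tX tY; rewrite PR /kulkarni_nomizu /area2 !schouten_tangent//.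
rewrite (finsler_metricC hF Y X)//.
move: (inner g y X X) (inner g y X Y) (inner g y Y Y) => p q r; ring.
Qed.

End ConformallyFlatPoint.

(** * The curvature of a conformally flat tangent space is locally constant *)

Section ConformallyFlatFactor.
Context {R : realType} {N : nat} (hN : (3 <= N)%N) (F : 'rV[R]_N -> R)
  (hF : minkowski_norm F).
Context (V : set 'rV[R]_N) (oV : open V) (V0 : forall y, V y -> y != 0).
Context (lam : 'rV[R]_N -> R) (Sl : smooth_on V lam)
  (lam0 : forall y, V y -> 0 < lam y).
Let g := finsler_metric F.
Let T := cartan F.
Context (ph : 'rV[R]_N -> 'rV[R]_N -> R)
  (phE : forall y X, (2 * lam y)^-1 * 'D_X lam y = ph y X).
Context (H : 'rV[R]_N -> 'rV[R]_N -> 'rV[R]_N -> R)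
  (HE : forall y X Y, 'D_X (fun z => ph z Y) y = H y X Y).
Let P := conf_schouten F ph H.
Let w := conf_grad F ph.
Context (PR : forall y, V y -> forall X Y Z W,
  cartan_curv F y X Y Z W = - kulkarni_nomizu (inner g y) (P y) X Y Z W).
Implicit Types (y X Y Z W : 'rV[R]_N).

(* The derivative of phi in the radial direction. *)
Let psi y : R := ph y y.
Let a y : R := P y y y / F y ^+ 2.
Let nn y : R := inner g y (w y) (w y).
(* This equals a - nn / 2, but is visibly smooth. *)
Let s y : R := ('D_y psi y - psi y * (1 + psi y)) / F y ^+ 2.

Let F0 y : V y -> F y ^+ 2 != 0.
Proof. by move=> Vy; rewrite expf_neq0// gt_eqF// (mink_pos hF)// V0. Qed.

Let Sph X : smooth_on V (fun z => ph z X).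
Proof. exact: (conf_form_smooth oV Sl lam0 phE). Qed.

Let PC y X Y : V y -> P y X Y = P y Y X.
Proof. exact: (conf_schoutenC hF oV V0 Sl lam0 phE HE). Qed.

Let Plin y X : V y -> additive_homogeneous (P y X).
Proof. exact: (conf_schouten_linear F oV Sl lam0 phE HE). Qed.

Let phlin y : V y -> additive_homogeneous (ph y).
Proof. exact: (conf_form_linear Sl phE). Qed.

Let wE y X : V y -> inner g y (w y) X = ph y X.
Proof. exact: (inner_conf_grad hF V0 Sl phE). Qed.

Let dph y X Y : V y -> is_derive y X (fun z => ph z Y) (H y X Y).
Proof. exact: (is_derive_conf_form oV Sl lam0 phE HE). Qed.

Let Hsym y X Y : V y -> H y X Y = H y Y X.
Proof. exact: (conf_hess_sym oV Sl lam0 phE HE). Qed.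

Let metric_V k i j : Ck_on k V (fun y => g y i j).
Proof.
apply: (Ck_on_sub (U := @slit_space R N)); first exact: V0.
exact: (finsler_metric_smooth hF).
Qed.

Let SN : smooth_on V (fun y => (F y ^+ 2)^-1).
Proof.
move=> k; apply: Ck_onV => //.
apply: (Ck_on_sub (U := @slit_space R N)); first exact: V0.
exact: (mink_sq_smooth hF).
Qed.

Let Scoord j : smooth_on V (fun y : 'rV[R]_N => y 0 j).
Proof.
by move=> k; apply: (Ck_on_coord (u := fun y => y)) => //; exact: Ck_on_id.
Qed.

Let Spsi : smooth_on V psi.
Proof.
move=> k.
have h : Ck_on k V (fun y => \sum_j y 0 j * ph y (delta_mx 0 j)).
  apply: Ck_on_sum => // j; apply: Ck_onM => //; [exact: Scoord|exact: Sph].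
apply: Ck_on_eq h => // y Vy.
have := additive_homogeneous_sum (fun j => y 0 j)
  (fun j => delta_mx 0 j) (phlin Vy).
by rewrite -row_sum_delta.
Qed.

Let Sdpsi : smooth_on V (fun y => 'D_y psi y).
Proof.
move=> k.
have h : Ck_on k V (fun y => \sum_j y 0 j * 'D_(delta_mx 0 j) psi y).
  apply: Ck_on_sum => // j; apply: Ck_onM => //; [exact: Scoord|exact: smooth_derive].
apply: Ck_on_eq h => // y Vy.
by rewrite (derive_coords y (smooth_differentiable Spsi Vy)).
Qed.

Let Ss : smooth_on V s.
Proof.
move=> k; apply: (Ck_onM oV _ (SN k)); apply: (Ck_onB oV (Sdpsi k)).
apply: (Ck_onM oV (Spsi k)).
apply: Ck_onD => //; first exact: Ck_on_cst.
Qed.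

Let Sw : smooth_on V w.
Proof.
move=> k; apply: Ck_on_row => // i.
have h : Ck_on k V (fun y => \sum_j ph y (delta_mx 0 j) * invmx (g y) j i).
  apply: Ck_on_sum => // j; apply: (Ck_onM oV (Sph _ k)).
  apply: Ck_on_invmx => //.
  by move=> x Vx; apply: (finsler_metric_unit hF); exact: V0.
apply: Ck_on_eq h => // y Vy; rewrite /w /conf_grad [RHS]mxE.
by apply: eq_bigr => j _; rewrite mxE.
Qed.

Let dw y X : V y -> is_derive y X w ('D_X w y).
Proof.
by move=> Vy; apply: differentiable_is_derive; exact: smooth_differentiable Sw Vy.
Qed.

Let dpsi y X : V y -> is_derive y X psi ('D_X psi y).
Proof.
by move=> Vy; apply: differentiable_is_derive; exact: smooth_differentiable Spsi Vy.
Qed.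

Let Did y X : 'D_X (fun z : 'rV[R]_N => z) y = X.
Proof. exact: derive_id. Qed.

Let did y : differentiable (fun z : 'rV[R]_N => z) y.
Proof. exact: differentiable_idfun. Qed.

Lemma derive_conf_radial y X : V y -> 'D_X psi y = H y X y + ph y X.
Proof.
move=> Vy.
have Hlin : additive_homogeneous (H y X).
  exact: (conf_hess_linear oV Sl lam0 phE HE).
have h : is_derive y X (fun z => \sum_j z 0 j * ph z (delta_mx 0 j))
    (\sum_j (X 0 j * ph y (delta_mx 0 j) + y 0 j * H y X (delta_mx 0 j))).
  apply: is_derive_bigsum => j; apply: is_derive_mul; last exact: dph.
  by apply: is_derive_coord; rewrite -[X in is_derive _ _ _ X](Did y X);
    apply: differentiable_is_derive.
have [_ <-] : is_derive y X psi (H y X y + ph y X); last by [].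
have e : H y X y + ph y X =
    \sum_j (X 0 j * ph y (delta_mx 0 j) + y 0 j * H y X (delta_mx 0 j)).
  rewrite big_split/= addrC; congr (_ + _).
    have := additive_homogeneous_sum (fun j => y 0 j)
      (fun j => delta_mx 0 j) Hlin.
    by rewrite -row_sum_delta.
  have := additive_homogeneous_sum (fun j => X 0 j)
    (fun j => delta_mx 0 j) (phlin Vy).
  by rewrite -row_sum_delta.
rewrite e; apply: near_eq_is_derive h.
apply: (near_open_eq oV Vy) => z Vz.
have := additive_homogeneous_sum (fun j => z 0 j)
  (fun j => delta_mx 0 j) (phlin Vz).
by rewrite -row_sum_delta.
Qed.

Let PyE y X : V y -> P y X y = a y * inner g y X y.
Proof.
move=> Vy; apply: (schouten_radial hN hF (V0 Vy) _ _ (PR Vy)).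
- by move=> A B; exact: PC.
- by move=> A; exact: Plin.
Qed.

(** Combine [derive_conf_radial] with the fact that P(., y) is a times g(., y);
   T does not contribute because it annihilates y. *)
Lemma derive_conf_radialE y X : V y ->
  'D_X psi y = ph y X * (1 + psi y) + (a y - 2^-1 * nn y) * inner g y y X.
Proof.
move=> Vy; have y0 := V0 Vy; rewrite derive_conf_radial//.
have := PyE X Vy; rewrite /P /conf_schouten -/g -/w -/(nn y) -/(psi y).
rewrite (cartanCl hF)// (cartan_radial hF)// subr0.
rewrite (finsler_metricC hF X y)// => e.
have -> : H y X y = a y * inner g y y X + ph y X * psi y
   - 2^-1 * nn y * inner g y y X by rewrite -e; ring.
by ring.
Qed.

Let yy y : V y -> inner g y y y = F y ^+ 2.
Proof. by move=> Vy; rewrite (metric_radial_radial hF)//; exact: V0. Qed.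

Lemma conf_coefE y : V y -> s y = a y - 2^-1 * nn y.
Proof.
move=> Vy; rewrite /s derive_conf_radialE// yy// -/(psi y).
by rewrite addrAC subrr add0r mulfK// F0.
Qed.

Lemma conf_coef_differentiable y : V y -> differentiable a y.
Proof.
move=> Vy.
have Sn : smooth_on V (fun y => s y + 2^-1 * nn y).
  move=> k; apply: (Ck_onD oV (Ss k)); apply: Ck_onZ => //.
  have h : Ck_on k V (fun y => \sum_i \sum_j w y 0 i * w y 0 j * g y i j).
    apply: Ck_on_sum => // i; apply: Ck_on_sum => // j.
    apply: (Ck_onM oV _ (metric_V k i j)).
    by apply: (Ck_onM oV); exact: (Ck_on_coord _ _ oV (Sw k)).
  by apply: Ck_on_eq h => // z Vz; rewrite /nn innerE.
apply: (differentiable_open_eq oV Vy _ (smooth_differentiable Sn Vy)) => z Vz.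
by rewrite conf_coefE// subrK.
Qed.

(** The symmetry of the second derivatives of psi, computed from
   [derive_conf_radialE] and evaluated on y and Z. *)
Lemma conf_coef_tangent_s y Z : V y -> inner g y y Z = 0 -> 'D_Z s y = s y * ph y Z.
Proof.
move=> Vy tZ; have y0 := V0 Vy.
have dsp X : V y -> is_derive y X s ('D_X s y).
  by move=> _; apply: differentiable_is_derive; exact: smooth_differentiable Ss Vy.
have dd A B : 'D_A (fun z => 'D_B psi z) y =
    H y A B * (1 + psi y) + ph y B * 'D_A psi y
    + ('D_A s y * inner g y y B + s y * inner g y A B).
  rewrite (derive_open_eq (g := fun z => ph z B * (1 + psi z) + s z * inner g z z B)
    _ oV Vy); last by move=> z Vz; rewrite derive_conf_radialE// conf_coefE.
  have d1 := is_derive_mul (dph A B Vy)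
    (is_derive_add (is_derive_const 1 y A) (dpsi A Vy)).
  have d2 : is_derive y A (fun z => inner g z z B) (inner g y A B).
    have := is_derive_metric_field (a := A) hF (did y) y0
      (differentiable_is_derive A (did y)) (is_derive_cst B y A).
    move=> h; apply: (is_derive_eq h).
    rewrite !Did inner0r addr0.
    by rewrite (cartanCl hF)// (cartan_radial hF)// mulr0 add0r.
  have [_ ->] := is_derive_add d1 (is_derive_mul (dsp A Vy) d2).
  by rewrite add0r.
have := derive_comm Z y oV Vy (Spsi 2%N).
rewrite !dd (Hsym Z y)// (finsler_metricC hF Z y)// tZ !mulr0 !addr0 -addrA.
move=> /addrI.
rewrite !derive_conf_radialE// -conf_coefE// tZ mulr0 addr0 yy//.
rewrite -/(psi y) => e; apply: (mulIf (F0 Vy)).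
move: e; move: ('D_Z s y) (s y) (ph y Z) (psi y) (F y ^+ 2) => p q r t f e.
have -> : p * f = t * (r * (1 + t)) + p * f - t * (r * (1 + t)) by ring.
by rewrite e; ring.
Qed.

(** The derivative of |dphi|^2 is twice the Hessian applied to the gradient, and
   the Hessian is known on tangent vectors from P(Z, .) = - a g(Z, .). *)
Lemma derive_conf_norm y Z : V y -> inner g y y Z = 0 ->
  'D_Z nn y = - (2 * s y * ph y Z).
Proof.
move=> Vy tZ; have y0 := V0 Vy.
have dwX X : 2 * T y Z (w y) X + inner g y ('D_Z w y) X = H y Z X.
  have h := is_derive_metric_field (a := Z) hF (did y) y0 (dw Z Vy)
    (is_derive_cst X y Z).
  have [_ e1] := h; have [_ e2] := dph Z X Vy.
  rewrite -e2 -(derive_open_eq (f := fun z => inner g z (w z) X) _ oV Vy).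
    by rewrite e1 Did inner0r addr0.
  by move=> z Vz; exact: wE.
have h := is_derive_metric_field (a := Z) hF (did y) y0 (dw Z Vy) (dw Z Vy).
have [_ ->] := h; rewrite Did (finsler_metricC hF (w y) ('D_Z w y))//.
have e := dwX (w y).
have -> : inner g y ('D_Z w y) (w y) = H y Z (w y) - 2 * T y Z (w y) (w y).
  by rewrite -e addrC addKr.
have := schouten_tangentl hN hF y0 (fun A B => PC A B Vy) (fun A => Plin A Vy)
  (PR Vy) (w y) tZ.
rewrite -/(a y) /P /conf_schouten -/g -/w -/(nn y).
rewrite (finsler_metricC hF Z (w y))// wE// -(wE (w y))// -/(nn y) -/T.
rewrite conf_coefE//.
move: (H y Z (w y)) (T y Z (w y) (w y)) (ph y Z) (nn y) (a y) => p q r n b e1.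
have -> : p = - b * r + q + r * n - 2^-1 * n * r by rewrite -e1; ring.
by field.
Qed.

(** The derivatives of s and of nn / 2 cancel. *)
Lemma conf_coef_tangent y Z : V y -> inner g y y Z = 0 -> 'D_Z a y = 0.
Proof.
move=> Vy tZ.
have dn : differentiable nn y.
  have h : differentiable (fun z => 2 * (a z - s z)) y.
    apply: (@differentiableZ _ _ _ (fun z => a z - s z)).
    apply: differentiableB; first exact: conf_coef_differentiable.
    exact: smooth_differentiable Ss Vy.
  apply: (differentiable_open_eq oV Vy _ h) => z Vz.
  by rewrite conf_coefE//; field.
rewrite (derive_open_eq (g := fun z => s z + 2^-1 * nn z) _ oV Vy); last first.
  by move=> z Vz; rewrite conf_coefE// subrK.
have [_ ->] := is_derive_add
  (differentiable_is_derive Z (smooth_differentiable Ss Vy))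
  (is_derive_cmul 2^-1 (differentiable_is_derive Z dn)).
rewrite conf_coef_tangent_s// derive_conf_norm//.
by field.
Qed.

End ConformallyFlatFactor.

(** * Conformally flat implies constant curvature *)

Section ConstantCurvatureOfConformallyFlat.
Context {R : realType} {N : nat} (hN : (3 <= N)%N) (F : 'rV[R]_N -> R)
  (hF : minkowski_norm F).
Let g := finsler_metric F.
Implicit Types (y X Y : 'rV[R]_N).

(** All sectional curvatures of g in planes tangent to the indicatrix equal k. *)
Definition isotropic_at y (k : R) : Prop := forall X Y,
  inner g y y X = 0 -> inner g y y Y = 0 ->
  cartan_curv F y X Y Y X = k * area2 (inner g y) X Y.

(** As N >= 3, there is a nondegenerate tangent plane. *)
Lemma isotropic_at_uniq y k k' : y != 0 ->
  isotropic_at y k -> isotropic_at y k' -> k = k'.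
Proof.
move=> y0 hk hk'.
have [X X0 tX] := exists_orthogonal1 hF y y0 (ltnW hN).
have [Y Y0 [tY XY]] := exists_orthogonal2 hF y X y0 hN.
have aXY : area2 (inner g y) X Y != 0.
  by rewrite area2_orthogonal// mulf_neq0// (inner_eq0 hF).
by apply: (mulIf aXY); rewrite -hk// -hk'.
Qed.

Context (CF : conformally_flat_on (@slit_space R N) g).

Lemma conformally_flat_isotropic y : y != 0 ->
  exists (V : set 'rV[R]_N) (a : 'rV[R]_N -> R),
  [/\ open V, V y, forall z, V z -> differentiable a z,
      forall z Z, V z -> inner g z z Z = 0 -> 'D_Z a z = 0 &
      forall z, V z -> isotropic_at z (- 2 * a z)].
Proof.
move=> y0; have [V [lam [oV Vy VS Sl [lam0 fl]]]] := CF y0.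
have V0 z : V z -> z != 0 by exact: VS.
pose ph (z Z : 'rV[R]_N) := (2 * lam z)^-1 * 'D_Z lam z.
pose H (z Z W : 'rV[R]_N) := 'D_Z (fun x => ph x W) z.
have phE (z Z : 'rV[R]_N) : (2 * lam z)^-1 * 'D_Z lam z = ph z Z by [].
have HE (z Z W : 'rV[R]_N) : 'D_Z (fun x => ph x W) z = H z Z W by [].
have PR z : V z -> forall X Y Z W, cartan_curv F z X Y Z W =
    - kulkarni_nomizu (inner g z) (conf_schouten F ph H z) X Y Z W.
  move=> Vz.
  apply/(conf_flatP hF oV V0 Sl lam0 (fun=> erefl) phE HE Vz) => i j k l.
  exact: fl.
exists V, (fun z => conf_schouten F ph H z z z / F z ^+ 2); split => //.
- exact: (conf_coef_differentiable hN hF oV V0 Sl lam0 phE HE PR).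
- exact: (conf_coef_tangent hN hF oV V0 Sl lam0 phE HE PR).
- move=> z Vz X Y tX tY.
  exact: (cartan_curv_isotropic hF (V0 _ Vz) (PR _ Vz) tX tY).
Qed.

(** The unique k such that [isotropic_at y k]; see [isotropic_coefP]. *)
Definition isotropic_coef y : R := xget 0 [set k | isotropic_at y k].

Lemma isotropic_coefP y : y != 0 -> isotropic_at y (isotropic_coef y).
Proof.
move=> y0; have [V [a [_ Vy _ _ ia]]] := conformally_flat_isotropic y0.
exact: (xgetPex 0 (ex_intro _ _ (ia _ Vy))).
Qed.

(** Near each parameter the coefficient is - 2 a for a local function a whose
   derivative vanishes on the velocity of the curve, which is tangent to the
   indicatrix. *)
Lemma isotropic_coef_path (c : R -> 'rV[R]_N) s t :
  (forall r, differentiable c r) -> (forall r, F (c r) = 1) ->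
  isotropic_coef (c s) = isotropic_coef (c t).
Proof.
move=> dc c1.
apply: (@is_derive_0_is_cst R (fun t => isotropic_coef (c t)) s t) => r.
have c0 r' : c r' != 0 := indicatrix_neq0 hF (c1 r').
have [V [a [oV Vy da ta ia]]] := conformally_flat_isotropic (c0 r).
have h : is_derive r (1 : R) (fun r => - 2 * a (c r)) 0.
  have d1 := is_derive_comp (f := a) (u := c) (1 : R) (da _ Vy) (dc r).
  apply: (is_derive_eq (is_derive_cmul (- 2) d1)).
  rewrite ta ?mulr0//.
  apply: (@indicatrix_tangent R N F hF R setT c r 1 openT) => //.
apply: near_eq_is_derive h.
have nV : \forall z \near c r, V z by exact: open_nbhs_nbhs.
have cc : {for r, continuous c} := differentiable_continuous (dc r).
have nc : \forall r' \near r, V (c r') by exact: (cc _ nV).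
near=> r'.
have Vr' : V (c r') by near: r'; exact: nc.
apply: (isotropic_at_uniq (c0 r')); first exact: ia.
exact: isotropic_coefP.
Unshelve. all: by end_near. Qed.

(** The line through y and x avoids the origin, and its radial projection is a
   curve in the indicatrix. *)
Lemma isotropic_coef_segment y x : F y = 1 -> ~~ (x <= y)%MS ->
  isotropic_coef y = isotropic_coef ((F x)^-1 *: x).
Proof.
move=> y1 xy; have y0 := indicatrix_neq0 hF y1.
pose w (t : R) : 'rV[R]_N := y + t *: (x - y).
have w0 t : w t != 0.
  apply: contra xy => /eqP; rewrite /w => e.
  have [t0|t0] := eqVneq t 0.
    by move: e; rewrite t0 scale0r addr0 => e; rewrite e eqxx in y0.
  apply/sub_rVP; exists (- ((1 - t) / t)).
  apply: (scalerI t0); rewrite scalerA mulrN mulrC divfK// scaleNr scalerBl scale1r.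
  move: e; rewrite scalerBr addrA addrAC => /eqP.
  by rewrite addr_eq0 => /eqP ->; rewrite opprK.
have Sw : smooth_on setT w.
  move=> k; apply: Ck_on_row => [|j]; first exact: openT.
  have h : Ck_on k setT (fun t : R => y 0 j + t * (x 0 j - y 0 j)).
    apply: (Ck_onD openT (Ck_on_cst k _ _)).
    apply: (Ck_onM openT (@Ck_on_id R R k setT) (Ck_on_cst k _ _)).
  by apply: (Ck_on_eq openT) h => t _; rewrite /w !mxE.
have Sc := radial_projection_smooth hF openT (fun t _ => w0 t) Sw.
have := isotropic_coef_path 0 1 (fun r => smooth_differentiable Sc (I : setT r))
  (fun r => radial_projection_indicatrix hF (w0 r)).
by rewrite /w scale0r addr0 y1 invr1 !scale1r addrC subrK.
Qed.

(** Two opposite points are not joined by a projected line, so both points are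
   joined to a third one outside their span. *)
Lemma isotropic_coef_constant y y' : F y = 1 -> F y' = 1 ->
  isotropic_coef y = isotropic_coef y'.
Proof.
move=> y1 y1'.
have [i hi] := exists_not_sub (col_mx y y') hN.
have := submx_refl (col_mx y y'); rewrite col_mx_sub => /andP[sy sy'].
rewrite (isotropic_coef_segment y1 (x := delta_mx 0 i)).
  rewrite (isotropic_coef_segment y1' (x := delta_mx 0 i))//.
  by apply: contra hi => h; exact: submx_trans h sy'.
by apply: contra hi => h; exact: submx_trans h sy.
Qed.

Theorem conformally_flat_constant_curvature :
  has_constant_curvature N.-1 (indicatrix F) g.
Proof.
have N0 : (0 < N)%N by exact: leq_trans hN.
have [e0 e00] := exists_nonzero_row R N0.
pose b := (F e0)^-1 *: e0.
have b1 : F b = 1 by exact: radial_projection_indicatrix.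
exists (isotropic_coef b + 1) => V u pu v Vv A B fAB.
have mN : (N.-1.+1 = N)%N by rewrite prednK.
rewrite (sectional_curvature_indicatrix hF A B mN pu Vv) -/g.
have u1 : F (u v) = 1 by case: pu => _ _ h _ _; exact: h.
have u0 := indicatrix_neq0 hF u1.
have fJ : row_free (jacobian u v) by case: pu => _ _ _ _; exact.
have tJ C : inner g (u v) (u v) (C *m jacobian u v) = 0.
  have [oV du] : open V /\ differentiable u v.
    by case: pu => oV Su _ _ _; split=> //; exact: smooth_differentiable Su Vv.
  have uV x : V x -> F (u x) = 1 by case: pu => _ _ h _ _; exact: h.
  have := indicatrix_tangent hF C oV Vv du uV.
  by rewrite /jacobian mul_rV_lin1 deriveE.
rewrite (isotropic_coefP u0) ?tJ// (isotropic_coef_constant b1 u1).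
have aAB : area2 (inner g (u v)) (A *m jacobian u v) (B *m jacobian u v) != 0.
  rewrite (area2_eq0 hF)// negbK; apply/row_free_col2 => c d e.
  apply: (row_free_col2 A B).1 => //.
  apply: (row_free_inj fJ).
  by rewrite mul0mx mulmxDl -!scalemxAl.
by rewrite mulrDl mulfK// divff.
Qed.

End ConstantCurvatureOfConformallyFlat.

(** * Algebraic curvature tensors *)

Section CurvatureLike.
Context {R : realType} {n : nat}.
Implicit Types (f : 'rV[R]_n -> 'rV[R]_n -> 'rV[R]_n -> 'rV[R]_n -> R)
  (X Y Z W : 'rV[R]_n).

Record curvature_like f : Prop := CurvatureLike {
  curvature_like_lin : quadrilinear f;
  curvature_like_anti : forall X Y Z W, f Y X Z W = - f X Y Z W;
  curvature_like_pair : forall X Y Z W, f Z W X Y = f X Y Z W;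
  curvature_like_bianchi : forall X Y Z W,
    f X Y Z W + f Y Z X W + f Z X Y W = 0 }.

(** Polarization in Y and Z, then in X and W, makes f skew in its first three
   arguments, and the Bianchi identity becomes 3 f = 0. *)
Lemma curvature_like_eq0 f : curvature_like f ->
  (forall X Y, f X Y Y X = 0) -> forall X Y Z W, f X Y Z W = 0.
Proof.
move=> [[l1 l2 l3 l4] anti pair bianchi] f0 X Y Z W.
(* Exchanging the pairs and the arguments within both of them is harmless. *)
have sw A B C D : f C D A B = f B A D C.
  by rewrite pair anti -(pair B A) anti opprK pair.
have f1 A B C : f A B C A = 0.
  have h := f0 A (B + C).
  have [D2 _] := l2 A (B + C) A; have [D3 _] := l3 A B A.
  have [D3' _] := l3 A C A.
  move: h; rewrite D2 D3 D3' !f0 add0r addr0 (sw B A A C) => h.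
  by apply: (mulfI (_ : 2 != 0 :> R)) => //; rewrite mulr0 -h; ring.
have f2 A B C D : f A B C D = - f A C B D.
  have h := f1 (A + D) B C.
  have [D1 _] := l1 B C (A + D); have [D4 _] := l4 A B C.
  have [D4' _] := l4 D B C.
  move: h; rewrite D1 D4 D4' !f1 add0r addr0 (sw C A D B) => /eqP.
  by rewrite addr_eq0 => /eqP.
have c A B C D : f A B C D = f B C A D.
  by rewrite (anti B A) (f2 B A C D) opprK.
have := bianchi X Y Z W; rewrite -(c X Y Z W) -(c Z X Y W) => h.
by apply: (mulfI (_ : 3 != 0 :> R)) => //; rewrite mulr0 -h; ring.
Qed.

Lemma curvature_like_eq f1 f2 : curvature_like f1 -> curvature_like f2 ->
  (forall X Y, f1 X Y Y X = f2 X Y Y X) ->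
  forall X Y Z W, f1 X Y Z W = f2 X Y Z W.
Proof.
move=> [q1 a1 p1 b1] [q2 a2 p2 b2] e X Y Z W.
pose f A B C D := f1 A B C D + -1 * f2 A B C D.
have cf : curvature_like f.
  split=> [|A B C D|A B C D|A B C D].
  - exact: (quadrilinearD q1 (quadrilinearZ (-1) q2)).
  - by rewrite /f a1 a2; ring.
  - by rewrite /f p1 p2.
  - have -> : f A B C D + f B C A D + f C A B D =
        (f1 A B C D + f1 B C A D + f1 C A B D)
        + -1 * (f2 A B C D + f2 B C A D + f2 C A B D) by rewrite /f; ring.
    by rewrite b1 b2 mulr0 addr0.
have f0 A B : f A B B A = 0 by rewrite /f mulN1r e subrr.
by apply/eqP; rewrite -subr_eq0 -mulN1r -/(f X Y Z W) curvature_like_eq0.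
Qed.

Lemma curvature_like_metric (B : 'rV[R]_n -> 'rV[R]_n -> R) :
  (forall X Y, B X Y = B Y X) ->
  (forall X, additive_homogeneous (B X)) -> curvature_like (metric_curv B).
Proof.
move=> BC Bl; have BD X Y Z : B X (Y + Z) = B X Y + B X Z by have [] := Bl X.
have BZ X c Y : B X (c *: Y) = c * B X Y by have [] := Bl X.
have BDl X Y Z : B (X + Y) Z = B X Z + B Y Z by rewrite BC BD !(BC Z).
have BZl c X Y : B (c *: X) Y = c * B X Y by rewrite BC BZ (BC Y).
split=> [|X Y Z W|X Y Z W|X Y Z W].
- by split=> C D E; split=> [X Y|c X]; rewrite /metric_curv
    ?(BD, BDl, BZ, BZl); ring.
- by rewrite /metric_curv; ring.
- by rewrite /metric_curv (BC W X) (BC Z Y) (BC Z X) (BC W Y); ring.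
- by rewrite /metric_curv (BC Y X) (BC Z X) (BC Z Y); ring.
Qed.

Lemma curvature_likeZ (c : R) f : curvature_like f ->
  curvature_like (fun X Y Z W => c * f X Y Z W).
Proof.
move=> [q a p b]; split=> [|X Y Z W|X Y Z W|X Y Z W].
- exact: quadrilinearZ.
- by rewrite a mulrN.
- by rewrite p.
- by rewrite -!mulrDr b mulr0.
Qed.

End CurvatureLike.

(** * The curvature tensor of an isotropic tangent space *)

Section IsotropicCurvature.
Context {R : realType} {N : nat} (hN : (3 <= N)%N) (F : 'rV[R]_N -> R)
  (hF : minkowski_norm F).
Let g := finsler_metric F.
Implicit Types (y X Y Z W : 'rV[R]_N).

Lemma curvature_like_cartan y : y != 0 -> curvature_like (cartan_curv F y).
Proof.
move=> y0; split=> [|X Y Z W|X Y Z W|X Y Z W].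
- exact: quadrilinear_cartan_curv.
- exact: cartan_curv_antil.
- exact: cartan_curv_pair.
- exact: cartan_curv_bianchi.
Qed.

(** The metric of the tangential components. *)
Definition angular_metric y X Y : R :=
  inner g y X Y - inner g y y X * inner g y y Y / F y ^+ 2.

Definition tangential_part y X : 'rV[R]_N := X - (inner g y y X / F y ^+ 2) *: y.

Let F0 y : y != 0 -> F y ^+ 2 != 0.
Proof. by move=> y0; rewrite expf_neq0// gt_eqF// (mink_pos hF). Qed.

Lemma tangential_part_tangent y X : y != 0 -> inner g y y (tangential_part y X) = 0.
Proof.
move=> y0; rewrite /tangential_part innerBr innerZr (metric_radial_radial hF)//.
by rewrite divfK ?F0// subrr.
Qed.

Lemma angular_metricE y X Y : y != 0 -> angular_metric y X Y =
  inner g y (tangential_part y X) (tangential_part y Y).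
Proof.
move=> y0; rewrite /tangential_part innerBl !innerBr !innerZl !innerZr.
rewrite (metric_radial_radial hF)// (finsler_metricC hF X y)// /angular_metric.
have := F0 y0; move: (F y ^+ 2) => f f0; field.
exact: f0.
Qed.

Lemma angular_metricC y X Y : y != 0 -> angular_metric y X Y = angular_metric y Y X.
Proof.
by move=> y0; rewrite /angular_metric (finsler_metricC hF X)// [_ * inner g y y Y]mulrC.
Qed.

Lemma angular_metric_linear y X : additive_homogeneous (angular_metric y X).
Proof.
split=> [Y Z|c Y]; rewrite /angular_metric ?innerDr ?innerZr.
  by ring.
by ring.
Qed.

Lemma cartan_curv_tangential_part y X Y Z W : y != 0 ->
  cartan_curv F y (tangential_part y X) Y Z W = cartan_curv F y X Y Z W.
Proof.
move=> y0; rewrite /tangential_part -scaleNr cartan_curvDl cartan_curvZl.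
by rewrite (cartan_curv_radial hF)// mulr0 addr0.
Qed.

(** Radial components do not contribute to Rm, so that the hypothesis on
   tangent planes controls Rm(X, Y, Y, X) for all X and Y, hence Rm. *)
Lemma cartan_curv_of_isotropic y k : y != 0 -> isotropic_at F y k ->
  forall X Y Z W, cartan_curv F y X Y Z W =
    k * metric_curv (angular_metric y) X Y Z W.
Proof.
move=> y0 iy.
have cm : curvature_like (metric_curv (angular_metric y)).
  by apply: curvature_like_metric => [X Y|X];
    [exact: angular_metricC|exact: angular_metric_linear].
apply: (curvature_like_eq (curvature_like_cartan y0) (curvature_likeZ k cm)) => X Y.
have cp A B C D := cartan_curv_pair hF A B C D y0.
rewrite -(cartan_curv_tangential_part X)// -cp.
rewrite cartan_curv_antil -(cartan_curv_tangential_part X)//.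
rewrite -cartan_curv_antil -(cartan_curv_tangential_part Y)// -cp.
rewrite cartan_curv_antil -(cartan_curv_tangential_part Y)// -cartan_curv_antil.
rewrite iy; [|exact: tangential_part_tangent|exact: tangential_part_tangent].
rewrite /area2 /metric_curv -!angular_metricE//.
by rewrite (angular_metricC X Y)// expr2; congr (_ * (_ - _)); rewrite mulrC.
Qed.

Lemma isotropic_at_scale y t k : 0 < t -> y != 0 ->
  isotropic_at F y k -> isotropic_at F (t *: y) (k / t ^+ 2).
Proof.
move=> t0 y0 iy X Y; rewrite !(metric_scale hF)// !innerZl.
have tn0 := lt0r_neq0 t0.
move=> /eqP; rewrite mulf_eq0 (negbTE tn0)/= => /eqP tX.
move=> /eqP; rewrite mulf_eq0 (negbTE tn0)/= => /eqP tY.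
apply: (mulfI (expf_neq0 2 tn0)); rewrite (cartan_curv_scale hF)// iy//.
rewrite /area2 !(metric_scale hF)//.
by rewrite mulrA [t ^+ 2 * _]mulrC divfK// expf_neq0.
Qed.

End IsotropicCurvature.

(** * The curvature of the indicatrix is at least 1 *)

Section TracePositivity.
Context {R : realType} {N : nat} (hN : (3 <= N)%N) (F : 'rV[R]_N -> R)
  (hF : minkowski_norm F).
Let g := finsler_metric F.
Implicit Types (y X Y Z W : 'rV[R]_N).

Let trg y : R := \sum_i inner g y (delta_mx 0 i) (delta_mx 0 i).

Let Strg : smooth_on (@slit_space R N) trg.
Proof.
move=> k; apply: Ck_on_sum => [|i]; first exact: slit_open.
exact: (inner_metric_smooth hF).
Qed.

Lemma trace_metric_scale t y : 0 < t -> y != 0 -> trg (t *: y) = trg y.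
Proof. by move=> t0 y0; apply: eq_bigr => i _; exact: (metric_scale hF). Qed.

(** The trace is constant along rays, so its maximum on the unit sphere of the
   supremum norm is global. *)
Lemma trace_metric_max : exists2 y, y != 0 & forall z, z != 0 -> trg z <= trg y.
Proof.
pose S : set 'rV[R]_N := [set y | `|y| = 1].
have S0 y : S y -> y != 0.
  by move=> Sy; rewrite -normr_gt0 Sy.
have SN y : y != 0 -> S (`|y|^-1 *: y).
  move=> y0; rewrite /S /= normrZ normfV normr_id mulVf//.
  by rewrite normr_eq0.
have N0 : (0 < N)%N by exact: leq_trans hN.
have [e0 e00] := exists_nonzero_row R N0.
have cS : compact S.
  apply: bounded_closed_compact.
    exists 1; split; first exact: num_real.
    by move=> M M1 y /= ->; exact: ltW.
  rewrite (_ : S = (fun y => `|y|) @^-1` [set 1])//.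
  apply: closed_comp; last exact: closed_eq.
  by move=> y _; exact: norm_continuous.
have [||c cS' cmax] := @EVT_max_rV R N trg S _ cS.
- by exists (`|e0|^-1 *: e0); exact: SN.
- apply: continuous_in_subspaceT => y; rewrite inE => Sy.
  exact: (Ck_onW0 (Strg 0%N) (S0 _ Sy)).
exists c; first by apply: S0; rewrite inE in cS'.
move=> z z0; have zz : 0 < `|z|^-1 by rewrite invr_gt0 normr_gt0.
rewrite -(trace_metric_scale zz z0); apply: cmax.
by rewrite inE; exact: SN.
Qed.

Lemma trace_metric_critical y X : y != 0 -> (forall z, z != 0 -> trg z <= trg y) ->
  'D_X trg y = 0.
Proof.
move=> y0 ymax.
have nU : \forall z \near 0 *: X + y, z != 0.
  rewrite scale0r add0r; exact: (open_nbhs_nbhs (conj (@slit_open R N) y0)).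
have cl : {for (0 : R), continuous (fun t : R => t *: X + y)}.
  by move=> /=; apply: cvgD; [exact: scalel_continuous|exact: cvg_cst].
have n0 : \forall t \near (0 : R), t *: X + y != 0.
  exact: (cl _ nU).
have [d /= d0 hd] := (nbhs_ballP _ _).1 n0.
have hd' t : t \in `](- d), d[ -> t *: X + y != 0.
  rewrite in_itv/= => /andP[t1 t2]; apply: hd.
  by rewrite -ball_normE/= sub0r normrN ltr_norml t1.
have dl t : t \in `](- d), d[ ->
    is_derive t (1 : R) (fun t : R => trg (t *: X + y)) ('D_X trg (t *: X + y)).
  move=> ht; apply: is_derive_line.
  exact: smooth_differentiable Strg (hd' _ ht).
have z0 : (0 : R) \in `](- d), d[ by rewrite in_itv/= oppr_lt0 d0.
have := @derive1_at_max R (fun t : R => trg (t *: X + y)) (- d) d 0 _ _ z0 _.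
case.
- by rewrite ge0_cp// ltW.
- by move=> t /dl[].
- by move=> t /hd' h; rewrite scale0r add0r; exact: ymax.
by move=> _; have [_ ->] := dl _ z0; rewrite scale0r add0r.
Qed.

(** The derivative of the trace of g in direction X is 2 times the trace of
   T(X, ., .). *)
Lemma trace_cartan_zero : exists2 y, y != 0 &
  \sum_i cartan_row F y (delta_mx 0 i) (delta_mx 0 i) = 0.
Proof.
have [y y0 ymax] := trace_metric_max; exists y => //.
apply/rowP => j; rewrite summxE mxE.
have := trace_metric_critical (delta_mx 0 j) y0 ymax.
have [_ ->] := is_derive_bigsum (fun i => differentiable_is_derive (delta_mx 0 j)
  (inner_metric_diff hF (delta_mx 0 i) (delta_mx 0 i) y0)).
move=> e; apply: (mulfI (_ : 2 != 0 :> R)) => //; rewrite mulr0.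
apply: (etrans _ e); rewrite mulr_sumr; apply: eq_bigr => i _.
rewrite mxE (cartanCr hF)// (cartanCl hF)//.
by rewrite (cartanE hF)// mulVKf.
Qed.

Lemma cometric_ge0 y (al : 'rV[R]_N) : y != 0 -> 0 <= cometric g y al al.
Proof.
move=> y0; have -> : al = (al *m invmx (g y)) *m g y.
  by rewrite mulmxKV// (finsler_metric_unit hF).
rewrite (cometric_flat hF)//.
set v := al *m _; rewrite (_ : \sum_j _ = inner g y v v).
  exact: (finsler_metric_ge0 hF).
rewrite inner_sumr; apply: eq_bigr => j _.
by congr (_ * _); rewrite /inner trmx_delta -colE [RHS]mxE.
Qed.

Lemma area2_ge0 y X Y : y != 0 -> 0 <= area2 (inner g y) X Y.
Proof.
move=> y0; have [->|X0] := eqVneq X 0.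
  by rewrite /area2 !inner0l mul0r expr0n subr0.
have XX : 0 < inner g y X X by exact: (mink_convex hF).
by rewrite -(pmulr_rge0 _ XX) -(inner_gram hF)// (finsler_metric_ge0 hF).
Qed.

(** At the point of [trace_cartan_zero] the sum of Rm(e_i, Y, Y, e_i) is a sum
   of squared norms of T(e_i, Y, .), and it equals k times a sum of squared areas,
   not all of which vanish. *)
Lemma isotropic_coef_ge0 : exists2 y, y != 0 &
  forall k, isotropic_at F y k -> 0 <= k.
Proof.
have [y y0 tr0] := trace_cartan_zero; exists y => // k iy.
have [Y Y0 tY] := exists_orthogonal1 hF y y0 (ltnW hN).
pose e i : 'rV[R]_N := tangential_part F y (delta_mx 0 i).
have Rk i : cartan_curv F y (delta_mx 0 i) Y Y (delta_mx 0 i) =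
    k * area2 (inner g y) (e i) Y.
  rewrite -iy ?(tangential_part_tangent hF)//.
  rewrite /e (cartan_curv_tangential_part hF)// -[RHS](cartan_curv_pair hF)//.
  rewrite [RHS]cartan_curv_antil (cartan_curv_tangential_part hF)//.
  by rewrite -cartan_curv_antil (cartan_curv_pair hF).
have sge0 : 0 <= \sum_i cartan_curv F y (delta_mx 0 i) Y Y (delta_mx 0 i).
  rewrite /cartan_curv sumrB.
  have -> : \sum_i cometric g y (cartan_row F y Y Y)
      (cartan_row F y (delta_mx 0 i) (delta_mx 0 i)) = 0.
    rewrite -[RHS](inner0r (fun y => invmx (g y)) y (cartan_row F y Y Y)) -tr0.
    rewrite /cometric /inner linear_sum/= mulmx_sumr summxE.
    by [].
  rewrite subr0; apply: sumr_ge0 => i _.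
  by rewrite (cartan_rowC hF Y)//; exact: cometric_ge0.
have [i hi] := exists_not_sub (col_mx y Y) hN.
have ai : 0 < area2 (inner g y) (e i) Y.
  rewrite lt_def area2_ge0// andbT (area2_eq0 hF)// negbK.
  apply/row_free_col2 => c d; rewrite /e /tangential_part.
  set mu := _ / _ => h.
  have c0 : c = 0.
    apply/eqP; apply: contraR hi => c0.
    have := submx_refl (col_mx y Y); rewrite col_mx_sub => /andP[sy sY].
    have -> : (delta_mx 0 i : 'rV[R]_N) = mu *: y - (d / c) *: Y.
      apply: (scalerI c0); rewrite scalerBr !scalerA [c * (d / c)]mulrC divfK//.
      move: h; rewrite scalerBr scalerA => /eqP.
      by rewrite addrAC subr_eq add0r => /eqP h; rewrite -h addrK.
    by rewrite -scaleNr addmx_sub// scalemx_sub.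
  split=> //; move: h; rewrite c0 scale0r add0r => /eqP.
  by rewrite scaler_eq0 (negbTE Y0) orbF => /eqP.
have : 0 <= k * \sum_i area2 (inner g y) (e i) Y.
  by rewrite mulr_sumr; move: sge0; under eq_bigr do rewrite Rk.
rewrite pmulr_lge0//.
rewrite (bigD1 i)//= ltr_wpDr// sumr_ge0// => j _.
exact: area2_ge0.
Qed.

End TracePositivity.

(** * Charts of the indicatrix by affine hyperplanes *)

Section HyperplaneChart.
Context {R : realType} {N : nat} (F : 'rV[R]_N -> R)
  (hF : minkowski_norm F).
Let g := finsler_metric F.
Implicit Types (y X Y Z W : 'rV[R]_N).

Lemma tangent_basis y : y != 0 -> exists Bm : 'M[R]_(N.-1, N),
  [/\ row_free Bm, forall A, inner g y y (A *m Bm) = 0 &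
      forall X, inner g y y X = 0 -> exists A, X = A *m Bm].
Proof.
move=> y0; pose c : 'cV[R]_N := g y *m y^T.
have cE X : (X *m c) 0 0 = inner g y y X.
  by rewrite (finsler_metricC hF y)// /inner /c mulmxA.
have cP X : X *m c = 0 <-> inner g y y X = 0.
  split=> [h|h]; first by rewrite -cE h mxE.
  by apply/matrixP => i j; rewrite !ord1 cE h mxE.
have c0 : c != 0.
  apply/eqP => c0; have := cE y; rewrite c0 mulmx0 mxE => /esym/eqP.
  by rewrite (inner_eq0 hF)// (negbTE y0).
have E : \rank (kermx c) = N.-1.
  by rewrite mxrank_ker -mxrank_tr rank_rV trmx_eq0 c0 subn1.
rewrite -E; exists (row_base (kermx c)); split; first exact: row_base_free.
- move=> A; apply/cP; apply/sub_kermxP.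
  by apply: (submx_trans (submxMl _ _)); rewrite eq_row_base.
- move=> X /cP/sub_kermxP h; apply/submxP; rewrite eq_row_base.
  exact: h.
Qed.

Context (y : 'rV[R]_N) (y1 : F y = 1) (Bm : 'M[R]_(N.-1, N)) (fB : row_free Bm)
  (tB : forall A, inner g y y (A *m Bm) = 0).

Let w (v : 'rV[R]_N.-1) : 'rV[R]_N := y + v *m Bm.
Let rho (v : 'rV[R]_N.-1) : R := (F (w v))^-1.

(** The radial projection to the indicatrix of its affine tangent hyperplane at
   y, whose directions are spanned by the rows of Bm. *)
Definition hyperplane_chart (v : 'rV[R]_N.-1) : 'rV[R]_N :=
  (F (y + v *m Bm))^-1 *: (y + v *m Bm).

Let y0 : y != 0. Proof. exact: (indicatrix_neq0 hF). Qed.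

(* Since g(y, w) = 1, the factor rho is recovered from the chart. *)
Let yw v : inner g y y (w v) = 1.
Proof. by rewrite innerDr tB addr0 (metric_radial_radial hF)// y1 expr1n. Qed.

Let w0 v : w v != 0.
Proof.
apply/eqP => e; have := yw v; rewrite e inner0r => /eqP.
by rewrite eq_sym oner_eq0.
Qed.

Let Sw : smooth_on setT w.
Proof.
move=> k; apply: Ck_on_row => [|j]; first exact: openT.
have h : Ck_on k setT (fun v : 'rV[R]_N.-1 => y 0 j + \sum_a v 0 a * Bm a j).
  apply: (Ck_onD openT (Ck_on_cst k _ _)).
  apply: Ck_on_sum => [|a]; first exact: openT.
  apply: (Ck_onM openT _ (Ck_on_cst k _ _)).
  apply: (Ck_on_coord (u := fun v => v)); first exact: openT.
  exact: Ck_on_id.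
by apply: (Ck_on_eq openT) h => v _; rewrite /w !mxE.
Qed.

Let yu v : inner g y y (hyperplane_chart v) = rho v.
Proof. by rewrite /hyperplane_chart innerZr -/(w v) yw mulr1. Qed.

Let dw v A : is_derive v A w (A *m Bm).
Proof.
apply: is_derive_mx => i j; rewrite ord1.
have h := is_derive_add (is_derive_const (y 0 j) v A)
  (is_derive_bigsum (fun a => is_derive_mulc (Bm a j)
    (is_derive_coord 0 a (is_derive_id v A)))).
have e : (fun v => w v 0 j) = (fun v : 'rV[R]_N.-1 => y 0 j + \sum_a v 0 a * Bm a j).
  by apply/funext => x; rewrite /w !mxE.
by rewrite e; apply: (is_derive_eq h); rewrite add0r !mxE.
Qed.

Let Srho : smooth_on setT rho.
Proof.
move=> k; apply: Ck_onV; first exact: openT.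
  by move=> v _; rewrite gt_eqF// (mink_pos hF).
exact: (Ck_on_comp openT (@slit_open R N) (fun v _ => w0 v) (mink_smooth hF k) (Sw k)).
Qed.

Let drho v A : is_derive v A rho ('D_A rho v).
Proof.
by apply: differentiable_is_derive; exact: smooth_differentiable Srho I.
Qed.

Let Su : smooth_on setT hyperplane_chart.
Proof. exact: (radial_projection_smooth hF openT (fun v _ => w0 v) Sw). Qed.

Let duE v A : 'D_A hyperplane_chart v = 'D_A rho v *: w v + rho v *: (A *m Bm).
Proof.
have [_ ->//] : is_derive v A hyperplane_chart
    ('D_A rho v *: w v + rho v *: (A *m Bm)).
apply: is_derive_mx => i j; rewrite ord1.
have h := is_derive_mul (drho v A) (is_derive_coord 0 j (dw v A)).
have e : (fun v => hyperplane_chart v 0 j) = (fun v => rho v * w v 0 j).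
  by apply/funext => x; rewrite mxE.
by rewrite e; apply: (is_derive_eq h); rewrite !mxE.
Qed.

Let jacE v A : A *m jacobian hyperplane_chart v = 'D_A rho v *: w v + rho v *: (A *m Bm).
Proof.
have d : differentiable hyperplane_chart v by exact: smooth_differentiable Su I.
by rewrite /jacobian mul_rV_lin1 -deriveE// duE.
Qed.

Lemma hyperplane_chart_param :
  local_parametrization (indicatrix F) setT hyperplane_chart.
Proof.
split; [exact: openT|exact: Su| | |].
- by move=> v _; exact: (radial_projection_indicatrix hF (w0 v)).
- move=> v v' _ _ e.
  have er : rho v = rho v' by rewrite -!yu e.
  have r0 : rho v != 0 by rewrite invr_eq0 gt_eqF// (mink_pos hF).
  apply: (row_free_inj fB); apply: (addrI y); apply: (scalerI r0).
  by rewrite [in RHS]er; exact: e.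
- move=> v _; apply: inj_row_free => A; rewrite jacE => e.
  have r0 : rho v != 0 by rewrite invr_eq0 gt_eqF// (mink_pos hF).
  have dr0 : 'D_A rho v = 0.
    have := congr1 (inner g y y) e.
    by rewrite innerDr !innerZr yw tB mulr0 addr0 mulr1 inner0r.
  apply: (row_free_inj fB); apply: (scalerI r0).
  by rewrite mul0mx scaler0 -[RHS]e dr0 scale0r add0r.
Qed.

Lemma hyperplane_chart0 : hyperplane_chart 0 = y.
Proof. by rewrite /hyperplane_chart mul0mx addr0 y1 invr1 scale1r. Qed.

(** The derivative of rho vanishes at 0, because the derivative of the chart is
   tangent to the indicatrix there. *)
Lemma jacobian_hyperplane_chart0 (A : 'rV[R]_N.-1) :
  A *m jacobian hyperplane_chart 0 = A *m Bm.
Proof.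
have d : differentiable hyperplane_chart 0 by exact: smooth_differentiable Su I.
have := indicatrix_tangent hF A openT I d
  (fun v _ => radial_projection_indicatrix hF (w0 v)).
rewrite duE hyperplane_chart0 innerDr !innerZr yw tB mulr0 addr0 mulr1 => e.
rewrite jacE e scale0r add0r.
have -> : rho 0 = 1 by rewrite /rho /w mul0mx addr0 y1 invr1.
by rewrite scale1r.
Qed.

End HyperplaneChart.

(** * Constant curvature implies conformally flat *)

Section ConstantCurvatureImpliesConformallyFlat.
Context {R : realType} {N : nat} (hN : (3 <= N)%N) (F : 'rV[R]_N -> R)
  (hF : minkowski_norm F).
Let g := finsler_metric F.
Context (K : R) (KP : forall V u, local_parametrization (indicatrix F) V u ->
  forall v, V v -> forall A B : 'rV[R]_N.-1, row_free (col_mx A B) ->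
  sectional_curvature (induced_metric g u) v A B = K).
Implicit Types (y X Y Z W : 'rV[R]_N).

(** If the area vanishes, then Y is a multiple of X or X = 0. *)
Lemma cartan_curv_dependent y X Y : y != 0 -> area2 (inner g y) X Y = 0 ->
  cartan_curv F y X Y Y X = 0.
Proof.
move=> y0 a0; have [[_ l2 l3 _] anti _ _] := curvature_like_cartan hF y0.
have same A B C : cartan_curv F y A A B C = 0.
  apply: (mulfI (_ : 2 != 0 :> R)) => //; rewrite mulr0 mulr_natl mulr2n.
  by rewrite [X in X + _]anti addNr.
have [->|X0] := eqVneq X 0; first by rewrite -(scale0r 0) cartan_curvZl mul0r.
have XX0 : inner g y X X != 0 by rewrite (inner_eq0 hF).
have := inner_gram hF X Y y0; rewrite a0 mulr0 => /eqP.
rewrite (inner_eq0 hF)// subr_eq0 => /eqP e.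
apply: (mulfI XX0); rewrite mulr0.
have [_ Z2] := l2 X Y X; rewrite -Z2 e.
by rewrite Z2 same mulr0.
Qed.

Lemma indicatrix_isotropic y : F y = 1 -> isotropic_at F y (K - 1).
Proof.
move=> y1; have y0 := indicatrix_neq0 hF y1 => X Y tX tY.
have [a0|a0] := eqVneq (area2 (inner g y) X Y) 0.
  by rewrite cartan_curv_dependent// a0 mulr0.
have [Bm [fB tB sB]] := tangent_basis hF y0.
have [A XA] := sB X tX; have [B YB] := sB Y tY.
have pu := hyperplane_chart_param hF y1 fB tB.
have fAB : row_free (col_mx A B).
  apply/row_free_col2 => c d e.
  have := a0; rewrite (area2_eq0 hF)// negbK => /row_free_col2; apply.
  by rewrite XA YB !scalemxAl -mulmxDl e mul0mx.
have mN : (N.-1.+1 = N)%N by rewrite prednK// (leq_trans _ hN).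
have := KP pu (I : setT 0) fAB.
rewrite (sectional_curvature_indicatrix hF A B mN pu (I : setT 0)).
rewrite !(jacobian_hyperplane_chart0 hF y1 tB) (hyperplane_chart0 y1) -XA -YB.
by move=> <-; rewrite mulrBl mul1r divfK// addrK.
Qed.

Lemma tangent_space_isotropic y : y != 0 -> isotropic_at F y ((K - 1) / F y ^+ 2).
Proof.
move=> y0; have Fy := mink_pos hF y0.
have h1 := radial_projection_indicatrix hF y0.
have e : F y *: ((F y)^-1 *: y) = y.
  by rewrite scalerA divff ?scale1r// gt_eqF.
have h := isotropic_at_scale hF Fy (indicatrix_neq0 hF h1) (indicatrix_isotropic h1).
rewrite e in h; exact h.
Qed.

Lemma indicatrix_curvature_ge1 : 1 <= K.
Proof.
have [y y0 h] := isotropic_coef_ge0 hN hF.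
have := h _ (tangent_space_isotropic y0).
by rewrite pmulr_lge0 ?subr_ge0// invr_gt0 exprn_gt0// (mink_pos hF).
Qed.

Let c := Num.sqrt K - 1.
Let lam y : R := (F y ^+ 2) `^ c.

Let K0 : 0 <= K. Proof. exact: le_trans indicatrix_curvature_ge1. Qed.

Let cK : (c + 1) ^+ 2 = K.
Proof. by rewrite /c subrK sqr_sqrtr. Qed.

Let q0 y : y != 0 -> 0 < F y ^+ 2.
Proof. by move=> y0; rewrite exprn_gt0// (mink_pos hF). Qed.

Let lam0 y : y != 0 -> 0 < lam y.
Proof. by move=> y0; rewrite powR_gt0// q0. Qed.

Let Slam : smooth_on (@slit_space R N) lam.
Proof.
move=> k; apply: Ck_on_powR; [exact: slit_open|exact: q0|exact: mink_sq_smooth].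
Qed.

Let ph y X : R := (2 * lam y)^-1 * 'D_X lam y.
Let H y X Y : R := 'D_X (fun z => ph z Y) y.

Let phE y X : y != 0 -> ph y X = c * inner g y y X / F y ^+ 2.
Proof.
move=> y0; rewrite /ph.
have [_ ->] := is_derive_powR (f := fun z => F z ^+ 2) c (q0 y0)
  (mink_sq_diff hF y0)
  (differentiable_is_derive X (mink_sq_diff hF y0)).
rewrite (metric_radial hF)// [_ `^ (c - 1)]powRB; last first.
  by rewrite (gt_eqF (q0 y0)) implybT.
rewrite powRr1 ?ltW ?q0//.
rewrite -/(lam y); have := lt0r_neq0 (q0 y0); have := lt0r_neq0 (lam0 y0).
move: (lam y) (F y ^+ 2) (inner g y y X) => l q p l0 q0'.
by field; rewrite l0 q0'.
Qed.

Let HE y X Y : y != 0 -> H y X Y =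
  c * (inner g y X Y / F y ^+ 2 - 2 * inner g y y X * inner g y y Y / F y ^+ 2 ^+ 2).
Proof.
move=> y0; rewrite /H.
rewrite (derive_open_eq (g := fun z => c * inner g z z Y * (F z ^+ 2)^-1)
  _ (@slit_open R N) y0); last by move=> z z0; exact: phE.
have d2 : is_derive y X (fun z => inner g z z Y) (inner g y X Y).
  have did : differentiable (fun z : 'rV[R]_N => z) y by exact: differentiable_idfun.
  have h := is_derive_metric_field (a := X) hF did y0
    (differentiable_is_derive X did) (is_derive_cst Y y X).
  apply: (is_derive_eq h).
  have -> : 'D_X (fun z : 'rV[R]_N => z) y = X by exact: derive_id.
  rewrite inner0r addr0.
  by rewrite (cartanCl hF)// (cartan_radial hF)// mulr0 add0r.
have dq := differentiable_is_derive X (mink_sq_diff hF y0).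
rewrite (metric_radial hF)// in dq.
have [_ ->] := is_derive_mul (is_derive_cmul c d2)
  (is_derive_inv (f := fun z => F z ^+ 2) (lt0r_neq0 (q0 y0)) dq).
have := lt0r_neq0 (q0 y0).
move: (F y ^+ 2) (inner g y X Y) (inner g y y X) (inner g y y Y) => q b p r q0'.
by field.
Qed.

Let gradE y : y != 0 -> conf_grad F ph y = (c / F y ^+ 2) *: y.
Proof.
move=> y0; rewrite /conf_grad.
have -> : \row_j ph y (delta_mx 0 j) = ((c / F y ^+ 2) *: y) *m g y.
  apply/rowP => j; rewrite mxE phE// -scalemxAl [RHS]mxE mulrAC.
  by congr (_ * _); rewrite /inner trmx_delta -colE [LHS]mxE.
by rewrite mulmxK// (finsler_metric_unit hF).
Qed.

Let schoutenE y X Y : y != 0 -> conf_schouten F ph H y X Y =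
  2^-1 * (K - 1) * (inner g y X Y / F y ^+ 2
    - 2 * inner g y y X * inner g y y Y / F y ^+ 2 ^+ 2).
Proof.
move=> y0; rewrite /conf_schouten HE// gradE// !phE//.
rewrite cartanZr (cartanCr hF)// (cartanCl hF)// (cartan_radial hF)// mulr0 subr0.
rewrite !innerZl !innerZr (metric_radial_radial hF)// -cK.
have := lt0r_neq0 (q0 y0).
move: (F y ^+ 2) (inner _ y X Y) (inner _ y y X) (inner _ y y Y) => q b p r q0'.
by field.
Qed.

(** For lam = (F^2)^c with (c + 1)^2 = K one has dphi = c p / F^2, and the tensor
   P is (K - 1) / 2 times (g / F^2 - 2 p p / F^4), where p = g(y, .). This is the P
   that matches the curvature tensor found in [cartan_curv_of_isotropic]. *)
Theorem constant_curvature_conformally_flat :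
  conformally_flat_on (@slit_space R N) g.
Proof.
move=> x x0; exists (@slit_space R N), lam.
split; [exact: slit_open|exact: x0|by []|exact: Slam|split; first exact: lam0].
move=> y y0.
have V0 (z : 'rV[R]_N) : @slit_space R N z -> z != 0 by [].
have phE' (z Z : 'rV[R]_N) : (2 * lam z)^-1 * 'D_Z lam z = ph z Z by [].
have HE' (z Z W : 'rV[R]_N) : 'D_Z (fun x => ph x W) z = H z Z W by [].
have fP := conf_flatP hF (@slit_open R N) V0 Slam lam0 (fun=> erefl) phE' HE' y0.
apply/fP => X Y Z W.
  rewrite (cartan_curv_of_isotropic hF y0 (tangent_space_isotropic y0)).
  rewrite /kulkarni_nomizu !schoutenE// /metric_curv /angular_metric -/g.
  have := lt0r_neq0 (q0 y0).
  move: (F y ^+ 2) (inner g y X Z) (inner g y Y Z) (inner g y X W) (inner g y Y W)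
   (inner g y y X) (inner g y y Y) (inner g y y Z) (inner g y y W) =>
   q b1 b2 b3 b4 p1 p2 p3 p4 q0'.
  by field.
Qed.

End ConstantCurvatureImpliesConformallyFlat.

(** * The tangent space at a point of a Finsler manifold *)

Lemma Ck_on_slice (R : realType) (V W : normedModType R) k
    (U : set (V * W)) (O : set W) (p : V) (f : V * W -> R) :
  (forall y, O y -> U (p, y)) -> Ck_on k U f -> Ck_on k O (fun y => f (p, y)).
Proof.
move=> OU; elim: k f => [|k IH] f.
  move=> cf y Oy; apply: (@continuous_comp _ _ _ (fun y => (p, y)) f).
    by apply: cvg_pair; [exact: cvg_cst|exact: cvg_id].
  exact: (cf _ (OU _ Oy)).
case=> df Cf; split=> [y Oy|v].
  have dp : differentiable (fun z : W => (p, z)) y.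
    exact: (differentiable_pair (differentiable_cst p y) (differentiable_idfun y)).
  exact: (differentiable_comp dp (df _ (OU _ Oy))).
have -> : (fun y => 'D_v (fun z => f (p, z)) y) =
    (fun y => 'D_((0, v) : V * W) f (p, y)).
  apply/funext => y; rewrite /derive.
  have -> : (fun h : R => h^-1 *: (((fun z => f (p, z)) \o shift y) (h *: v)
      - f (p, y))) = (fun h : R => h^-1 *: ((f \o shift (p, y))
      (h *: ((0, v) : V * W)) - f (p, y))); last by [].
  apply/funext => h /=.
  have -> : h *: ((0, v) : V * W) + (p, y) = (p, h *: v + y); last by [].
  by congr (_, _); rewrite /= scaler0 add0r.
exact: (IH _ (Cf _)).
Qed.

(** In the chart, the Finsler function is smooth in position and velocity
   together; its slice at a fixed position is smooth in the velocity. *)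
Lemma finsler_minkowski_norm (R : realType) (N : nat) (M : smooth_manifold R N)
    (F : finsler_structure M) (x : M) (i : atlas_index M) :
  chart_dom (atlas i) x -> minkowski_norm (F i x).
Proof.
move=> hx; split.
- move=> k.
  pose f (z : 'rV[R]_N * 'rV[R]_N) : R := F i (chart_inv (atlas i) z.1) z.2.
  have : Ck_on k (@slit_space R N) (fun y => f (chart_map (atlas i) x, y)).
    apply: (Ck_on_slice (U := (chart_map (atlas i) @` chart_dom (atlas i))
      `*` @slit_space R N)).
      by move=> y y0; split=> //; exists x.
    exact: (finsler_smooth F i k).
  by rewrite /f /= chart_mapK.
- by move=> y; exact: finsler_pos.
- by move=> c y; exact: finsler_homogeneous.
- by move=> y v; exact: finsler_strongly_convex.
Qed.

Theorem mainTheorem6 (R : realType) (N : nat) (hN : (3 <= N)%N)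
    (M : smooth_manifold R N) (F : finsler_structure M)
    (x : M) (i : atlas_index M) (hx : chart_dom (atlas i) x) :
  conformally_flat_on (@slit_space R N) (finsler_metric (F i x)) <->
  has_constant_curvature N.-1 (indicatrix (F i x)) (finsler_metric (F i x)).
Proof.
have hF := finsler_minkowski_norm F hx.
split=> [CF|[K KP]]; first exact: conformally_flat_constant_curvature.
exact: (constant_curvature_conformally_flat hN hF KP).
Qed.
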